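(* Let $\Omega=(a,b)$ be a finite open interval, $0<\alpha<1$ and $1\le p<\infty$. Assume that $\alpha p<1$ and that $\mu\in\mathbb{R}$ satisfies $\mu>p(1-\alpha p)^{-1}$. Then for every bounded domain $\Omega'\supset\supset\Omega$ there exist mappings $E_{\pm}:{}^{\pm}W^{\alpha,p}(\Omega)\cap L^\mu(\Omega)\to{}^{\pm}W^{\alpha,p}(\mathbb{R})$ and a constant $C=C(\alpha,p,\Omega')>0$ such that for any $u\in{}^{\pm}W^{\alpha,p}(\Omega)\cap L^\mu(\Omega)$: (i) $E_{\pm}u=u$ a.e. in $\Omega$; (ii) $\operatorname{supp}(E_{\pm}u)\subset\subset\Omega'$; (iii) $\|E_{\pm}u\|_{{}^{\pm}W^{\alpha,p}(\mathbb{R})}\le C\bigl(\|u\|_{{}^{\pm}W^{\alpha,p}(\Omega)}+\|u\|_{L^\mu(\Omega)}\bigr)$. (The sign is chosen consistently: one assertion for $-$, one for $+$.)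
   Context: $A\subset\subset B$ means $\overline{A}$ is a compact subset of $B$. For $0<\alpha<1$ and $\varphi\in C_0^\infty(\mathbb{R})$: ${}^{-}D^{\alpha}\varphi(x)=\frac{1}{\Gamma(1-\alpha)}\frac{d}{dx}\int_{-\infty}^x\frac{\varphi(y)}{(x-y)^{\alpha}}dy$ and ${}^{+}D^{\alpha}\varphi(x)=\frac{-1}{\Gamma(1-\alpha)}\frac{d}{dx}\int_x^{\infty}\frac{\varphi(y)}{(y-x)^{\alpha}}dy$. For $U=\Omega$ or $U=\mathbb{R}$, and $u\in L^1(U)$ (or, with the same identity, $u\in L^p(U)$), $v\in L^1_{loc}(U)$ is the left (resp. right) weak fractional derivative of $u$ on $U$, $v={}^{-}\mathcal{D}^{\alpha}u$ (resp. ${}^{+}\mathcal{D}^{\alpha}u$), if $\int_U v\varphi\,dx=\int_U u\,{}^{+}D^{\alpha}\tilde\varphi\,dx$ (resp. with ${}^{-}D^{\alpha}\tilde\varphi$) for all $\varphi\in C_0^\infty(U)$, where $\tilde\varphi$ is the zero extension of $\varphi$ to $\mathbb{R}$. ${}^{\pm}W^{\alpha,p}(U)=\{u\in L^p(U): {}^{\pm}\mathcal{D}^{\alpha}u\in L^p(U)\}$ with norm $(\|u\|_{L^p(U)}^p+\|{}^{\pm}\mathcal{D}^{\alpha}u\|_{L^p(U)}^p)^{1/p}$. *)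

(* Defs.v *)
From HB Require Import structures.
From mathcomp Require Import all_boot all_order all_algebra.
From mathcomp Require Import all_classical all_reals all_analysis.

Set Implicit Arguments.
Unset Strict Implicit.
Unset Printing Implicit Defensive.
Import Order.TTheory GRing.Theory Num.Theory.
Import numFieldNormedType.Exports.

Local Open Scope classical_set_scope.
Local Open Scope ring_scope.

(* [minus] stands for the left derivative, [plus] for the right one. *)
Inductive side := minus | plus.

Definition opposite (s : side) : side :=
  match s with minus => plus | plus => minus end.

Definition compactly_contained {T : topologicalType} (A B : set T) : Prop :=
  compact (closure A) /\ closure A `<=` B.

Definition bounded_domain {R : realType} (U : set R) : Prop :=
  [/\ open U, connected U, U !=set0 & bounded_set U].

Definition Gamma {R : realType} (s : R) : R :=
  \int[lebesgue_measure]_(t in `]0, +oo[) (t `^ (s - 1) * expR (- t)).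

Definition smooth {R : realType} (phi : R -> R) : Prop :=
  forall (n : nat) (x : R), derivable (derive1n n phi) x 1.

(* A test function on U is represented by its zero extension to R, so the
   extension does not appear again in the definition of weak derivatives. *)
Definition test_function {R : realType} (U : set R) (phi : R -> R) : Prop :=
  smooth phi /\ compactly_contained [set x | phi x != 0] U.

Definition frac_der {R : realType} (s : side) (alpha : R) (phi : R -> R) :
    R -> R :=
  match s with
  | minus => fun x => (Gamma (1 - alpha))^-1 *
      (fun z : R => \int[lebesgue_measure]_(y in `]-oo, z[)
                      (phi y / (z - y) `^ alpha))^`()%classic x
  | plus => fun x => - (Gamma (1 - alpha))^-1 *
      (fun z : R => \int[lebesgue_measure]_(y in `]z, +oo[)
                      (phi y / (y - z) `^ alpha))^`()%classic x
  end.

(* Elements of L^p(U) are represented by functions on R; only the values on U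
   matter for L^p(U), weak derivatives on U and W(U).  Measurability is with
   respect to the Borel sigma-algebra, so that representatives are Borel. *)
Definition in_Lp {R : realType} (p : R) (U : set R) (u : R -> R) : Prop :=
  u \_ U \in Lfun (@lebesgue_measure R) p%:E.

Definition Lp_norm {R : realType} (p : R) (U : set R) (u : R -> R) : \bar R :=
  'N[@lebesgue_measure R]_p%:E[EFin \o (u \_ U)]%E.

Definition is_weak_frac_der {R : realType} (s : side) (alpha : R) (U : set R)
    (u v : R -> R) : Prop :=
  locally_integrable U v /\
  forall phi : R -> R, test_function U phi ->
    \int[lebesgue_measure]_(x in U) (v x * phi x) =
    \int[lebesgue_measure]_(x in U) (u x * frac_der (opposite s) alpha phi x).

(* Weak derivatives are unique up to a null subset of U; this picks one, and is
   a junk value when there is none. *)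
Definition weak_frac_der {R : realType} (s : side) (alpha : R) (U : set R)
    (u : R -> R) : R -> R :=
  xget (fun=> 0) [set v | is_weak_frac_der s alpha U u v].

Definition in_W {R : realType} (s : side) (alpha p : R) (U : set R)
    (u : R -> R) : Prop :=
  in_Lp p U u /\ exists2 v, is_weak_frac_der s alpha U u v & in_Lp p U v.

Definition W_norm {R : realType} (s : side) (alpha p : R) (U : set R)
    (u : R -> R) : \bar R :=
  ((Lp_norm p U u `^ p + Lp_norm p U (weak_frac_der s alpha U u) `^ p)
    `^ p^-1)%E.

Definition eq_ae_on {R : realType} (U : set R) (u v : R -> R) : Prop :=
  {ae @lebesgue_measure R, forall x, U x -> u x = v x}.

(* Support of an a.e.-class: the complement of the largest open set on which
   f vanishes almost everywhere. *)
Definition ess_support {R : realType} (f : R -> R) : set R :=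
  ~` (\bigcup_(O in [set O : set R | open O /\ eq_ae_on O f (fun=> 0)]) O).

(* Main.v *)
(* The extension is by zero.  Let [w] be the Abel integral of [u], with kernel
   [(x - y) ^ (- alpha)], and [F] the primitive of the weak derivative [v].  On
   [a, b] the weak equation says that [w / Gamma (1 - alpha)] and [F] have the same
   distributional derivative, so they differ by a constant.  It vanishes because
   [u] is in [L^mu] with [alpha + 1 / mu < 1], which forces the mean of [w] over
   [a, a + e] to tend to [0].  At [x > b], [w x] is a weighted average of the
   values of [w] inside the interval, hence of [F]; integrating by parts, the zero
   extension of [u] has the weak derivative [v] on [a, b], [0] before [a], and
   [- (1 / c) * int_a^b v(r) (b - r) ^ alpha (x - b) ^ (- alpha) / (x - r) dr]
   after [b], with [c = int_0^oo z ^ (alpha - 1) / (1 + z) dz].  By a Schur test with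
   the weight [(b - r) ^ (- 1 / p)], whose integrals converge since
   [0 < alpha < 1 / p], this kernel is bounded on [L^p] with a norm depending only
   on [alpha] and [p].  The right derivative follows by [x |-> - x]. *)
Require Import Defs.
From HB Require Import structures.
From mathcomp Require Import all_boot all_order all_algebra.
From mathcomp Require Import all_classical all_reals all_analysis.
From mathcomp Require Import measurable_realfun.
From mathcomp Require Import ring lra.
Set Implicit Arguments.
Unset Strict Implicit.
Unset Printing Implicit Defensive.
Import Order.TTheory GRing.Theory Num.Theory.
Import numFieldNormedType.Exports.
Local Open Scope classical_set_scope.
Local Open Scope ring_scope.

(** * Lebesgue integrals under affine isometries *)

(** The integrability in [L^mu] guards the left endpoint. The function [(x - a) ^ (alpha - 1)] has a
    constant Abel integral on []a, b[], hence weak derivative [0] there, and it lies in [L^p] when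
    [(1 - alpha) p < 1]; yet the derivative of its zero extension has a Dirac mass at [a]. It is in
    [L^mu] only if [alpha + 1 / mu > 1], whereas the hypothesis on [mu] gives
    [1 / mu < 1 / p - alpha <= 1 - alpha]. The right endpoint has another difficulty: beyond [b] the
    Abel integral keeps a memory of [u], and it must be expressed by [v] alone to be estimated. The
    averaging kernel is the Poisson (balayage) kernel of a half-line, up to the factor [c]. Its mass
    on []r, b[] tends to the full mass [c] as [x] decreases to [b], so the boundary terms at [b]
    from both sides cancel and no Dirac mass appears there. The kernel after [b] is homogeneous of
    degree [-1] in [(b - r, x - b)]. The Schur integrals are thus scale free, which is why one
    constant serves all intervals at once and [Omega'] enters only through the support. *)

Section reflection.
Context {R : realType}.
Local Notation mu := (@lebesgue_measure R).

(** Lebesgue measure is determined by its values on half-open intervals, and the reflection turns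
    []a, b]] into [[c - b, c - a[], of the same length. *)
Lemma lebesgue_measure_subl (c : R) (A : set R) : measurable A ->
  pushforward mu (fun x : measurableTypeR R => (c - x : measurableTypeR R)) A = mu A.
Proof.
move=> mA; apply/esym.
have mc : measurable_fun setT (fun x : measurableTypeR R => (c - x : measurableTypeR R)).
  exact: measurable_funB.
apply: (@lebesgue_measure_unique _ (pushforward mu (fun x : measurableTypeR R => (c - x : measurableTypeR R)))) => //= _ [[a b]] _ <-.
rewrite /pushforward.
have -> : (fun x : R => c - x) @^-1` `]a, b] = `[c - b, c - a[%classic.
  by apply/seteqP; split => x /=; rewrite !in_itv/= => /andP[? ?]; apply/andP; split; lra.
rewrite !lebesgue_measure_itv/= !lte_fin.
have -> : (c - b < c - a) = (a < b) by apply/idP/idP; lra.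
by case: ifPn => // _; rewrite -!EFinB; congr (_%:E); ring.
Qed.

Lemma measurable_subl (c : R) : measurable_fun setT (fun x : R => c - x).
Proof. exact: measurable_funB. Qed.

Lemma ge0_integral_subl (c : R) (f : R -> \bar R) :
  measurable_fun setT f -> (forall x, 0 <= f x)%E ->
  (\int[mu]_x f (c - x)%R = \int[mu]_x f x)%E.
Proof.
move=> mf f0.
have := @ge0_integral_pushforward _ _ (measurableTypeR R) (measurableTypeR R) R _
  (measurable_subl c) mu setT f measurableT mf (fun x _ => f0 x).
rewrite preimage_setT => <-.
apply: eq_measure_integral; first exact: measurable_subl.
by move=> mc A mA _; exact: lebesgue_measure_subl.
Qed.

Lemma Rintegral_subl (c : R) (f : R -> R) : measurable_fun setT f ->
  \int[mu]_x f (c - x) = \int[mu]_x f x.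
Proof.
move=> mf; rewrite /Rintegral; congr fine; rewrite integralE [RHS]integralE.
have mf' : measurable_fun setT (EFin \o f) by exact/measurable_EFinP.
congr (_ - _)%E.
  rewrite -[RHS](ge0_integral_subl c (measurable_funepos mf') (fun x => funepos_ge0 _ x)).
  by apply: eq_integral => x _; rewrite !funeposE.
rewrite -[RHS](ge0_integral_subl c (measurable_funeneg mf') (fun x => funeneg_ge0 _ x)).
by apply: eq_integral => x _; rewrite !funenegE.
Qed.

(** A translation is the composite of two reflections, [c + x = c - (0 - x)]. *)
Lemma Rintegral_addl (c : R) (f : R -> R) : measurable_fun setT f ->
  \int[mu]_x f (c + x) = \int[mu]_x f x.
Proof.
move=> mf; rewrite -(Rintegral_subl c mf).
have mg : measurable_fun setT (fun x : R => f (c - x)).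
  exact: measurableT_comp mf (measurable_subl c).
by rewrite -(Rintegral_subl 0 mg); apply: eq_Rintegral => x _; rewrite sub0r opprK.
Qed.

Lemma integrable_subl (c : R) (f : R -> \bar R) :
  mu.-integrable setT f -> mu.-integrable setT (fun x => f (c - x)).
Proof.
move=> /integrableP[mf intf]; apply/integrableP; split.
  exact: measurableT_comp mf (measurable_subl c).
rewrite (ge0_integral_subl c (f := fun x => `|f x|%E))//.
exact: measurableT_comp.
Qed.

Lemma ae_lebesgueS (P Q : R -> Prop) : (forall x, P x -> Q x) ->
  {ae mu, forall x, P x} -> {ae mu, forall x, Q x}.
Proof. by move=> PQ; apply: filterS => //; exact: (ae_filter_ringOfSetsType mu). Qed.

Lemma lebesgue_integrableZl (D : set R) (f : R -> R) (k : R) : measurable D ->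
  mu.-integrable D (EFin \o f) -> mu.-integrable D (fun x => (k * f x)%:E).
Proof. by move=> mD iF; exact: (@integrableZl _ _ _ mu D mD k _ iF). Qed.

Lemma lebesgue_integrableB (D : set R) (f g : R -> R) : measurable D ->
  mu.-integrable D (EFin \o f) -> mu.-integrable D (EFin \o g) ->
  mu.-integrable D (fun x => (f x - g x)%:E).
Proof. by move=> mD iF iG; exact: (@integrableB _ _ _ mu D mD _ _ iF iG). Qed.

Lemma Rintegral_lin2 (D : set R) (f g : R -> R) (k l : R) : measurable D ->
  mu.-integrable D (EFin \o f) -> mu.-integrable D (EFin \o g) ->
  \int[mu]_(x in D) (k * f x + l * g x) =
  k * \int[mu]_(x in D) f x + l * \int[mu]_(x in D) g x.
Proof.
move=> mD iF iG; rewrite RintegralD//; last 2 first.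
  exact: lebesgue_integrableZl.
  exact: lebesgue_integrableZl.
by congr (_ + _); exact: RintegralZl.
Qed.

End reflection.

(** * Integral operators *)

Section measurable_kernel.
Context d1 d2 (T1 : measurableType d1) (T2 : measurableType d2) {R : realType}.
Variable m2 : {sigma_finite_measure set T2 -> \bar R}.
Implicit Types h : T1 -> T2 -> R.

(** Tonelli makes the integrals of the positive and negative parts measurable in the parameter;
    their difference followed by [fine] stays measurable even at parameters where the section is not
    integrable. *)
Lemma measurable_Rintegral_kernel h :
  measurable_fun setT (fun z : T1 * T2 => h z.1 z.2) ->
  measurable_fun setT (fun x => \int[m2]_r h x r).
Proof.
move=> mh; have mh' : measurable_fun setT (fun z : T1 * T2 => (h z.1 z.2)%:E).
  exact/measurable_EFinP.
apply: measurableT_comp => //.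
under eq_fun do rewrite integralE.
apply: emeasurable_funB.
- have := @measurable_fun_fubini_tonelli_F _ _ T1 T2 R m2 _ (measurable_funepos mh').
  move=> /(_ (fun x => funepos_ge0 _ x)).
  congr (measurable_fun _ _); apply/funext => x; apply: eq_integral => y _ /=.
  by rewrite !funeposE.
- have := @measurable_fun_fubini_tonelli_F _ _ T1 T2 R m2 _ (measurable_funeneg mh').
  move=> /(_ (fun x => funeneg_ge0 _ x)).
  congr (measurable_fun _ _); apply/funext => x; apply: eq_integral => y _ /=.
  by rewrite !funenegE.
Qed.

End measurable_kernel.

Section kernels.
Context d1 d2 (T1 : measurableType d1) (T2 : measurableType d2) {R : realType}.
Variables (m1 : {sigma_finite_measure set T1 -> \bar R})
  (m2 : {sigma_finite_measure set T2 -> \bar R}).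
Implicit Types h : T1 -> T2 -> R.

(** Fubini for real-valued integrals. [fine] of the inner integral agrees with the extended one only
    where the section is integrable, which is almost everywhere; the two sides are therefore
    compared through almost-everywhere equality. *)
Lemma Rintegral_swap h :
  measurable_fun setT (fun z : T1 * T2 => h z.1 z.2) ->
  (\int[m2]_y \int[m1]_x `|h x y|%:E < +oo)%E ->
  [/\ {ae m1, forall x, m2.-integrable setT (EFin \o h x)},
      m1.-integrable setT (fun x => (\int[m2]_y h x y)%:E) &
      \int[m1]_x (\int[m2]_y h x y) = \int[m2]_y (\int[m1]_x h x y)].
Proof.
move=> mh hfin; have mh' : measurable_fun setT (fun z : T1 * T2 => (h z.1 z.2)%:E).
  exact/measurable_EFinP.
have ih : (m1 \x m2)%E.-integrable setT (fun z : T1 * T2 => (h z.1 z.2)%:E).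
  exact/integrable21ltyP.
have ae1 := ae_integrable1 ih.
have ae2 := ae_integrable2 ih.
have iF := integrable_fubini_F ih.
have iG : m2.-integrable setT (fubini_G m1 (fun z : T1 * T2 => (h z.1 z.2)%:E)).
  apply/integrableP; split; first exact: (measurable_fubini_G ih).
  apply: le_lt_trans hfin; apply: ge0_le_integral => //.
  - by apply: measurableT_comp => //; exact: (measurable_fubini_G ih).
  - apply: (@measurable_fun_fubini_tonelli_G _ _ T1 T2 R m1 (fun z : T1 * T2 => `|h z.1 z.2|%:E)).
      by apply/measurable_EFinP; exact: measurableT_comp.
    by move=> z; rewrite lee_fin.
  - move=> y _; apply: le_abse_integral => //.
    by apply/measurable_EFinP; exact: (measurableT_comp mh (pair2_measurable y)).
have EF : ae_eq m1 setT (fubini_F m2 (fun z : T1 * T2 => (h z.1 z.2)%:E))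
  (fun x => (\int[m2]_y h x y)%:E).
  apply: filterS ae1 => x ix _ /=; rewrite fineK//; exact: integrable_fin_num.
have EG : ae_eq m2 setT (fubini_G m1 (fun z : T1 * T2 => (h z.1 z.2)%:E))
  (fun y => (\int[m1]_x h x y)%:E).
  apply: filterS ae2 => x ix _ /=; rewrite fineK//; exact: integrable_fin_num.
have mF : measurable_fun setT (fun x => (\int[m2]_y h x y)%:E).
  by apply/measurable_EFinP; exact: measurable_Rintegral_kernel.
have mG : measurable_fun setT (fun y => (\int[m1]_x h x y)%:E).
  apply/measurable_EFinP; apply: (measurable_Rintegral_kernel m1 (h := fun y x => h x y)).
  apply: (measurableT_comp (f := fun z : T1 * T2 => h z.1 z.2) (g := fun z : T2 * T1 => (z.2, z.1))) => //.
  exact: measurable_fun_pair.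
split=> //.
- apply/integrableP; split => //.
  have /integrableP[_] := iF; apply: le_lt_trans.
  apply: ae_ge0_le_integral => //.
  + exact: measurableT_comp.
  + by apply: measurableT_comp => //; have /integrableP[] := iF.
  + by apply: filterS EF => x /(_ I) <-.
- rewrite /Rintegral; congr fine.
  have := Fubini ih.
  have -> : (\int[m1]_x \int[m2]_y (h (x, y).1 (x, y).2)%:E =
    \int[m1]_x (\int[m2]_y h x y)%:E)%E.
    by apply: ae_eq_integral => //; have /integrableP[] := iF.
  move=> ->.
  by apply: ae_eq_integral => //; have /integrableP[] := iG.
Qed.

(** A uniform bound on the integrals of [g x * h x r] in [x] makes the absolute double integral at
    most [C] times the [L^1] norm of [v], so Fubini applies. The bound is asked only where
    [v r != 0], so that [v] may be a function patched by zero outside a set. *)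
Lemma kernel_swap (v : T2 -> R) (g : T1 -> R) h (C : R) :
  m2.-integrable setT (EFin \o v) -> measurable_fun setT g ->
  measurable_fun setT (fun z : T1 * T2 => h z.1 z.2) ->
  (forall r, v r != 0 -> (\int[m1]_x `|g x * h x r|%:E <= C%:E)%E) ->
  m1.-integrable setT (fun x => (g x * \int[m2]_r (v r * h x r))%:E) /\
  \int[m1]_x (g x * \int[m2]_r (v r * h x r)) =
  \int[m2]_r (v r * \int[m1]_x (g x * h x r)).
Proof.
move=> iv mg mh hC; have mv : measurable_fun setT v.
  by apply/measurable_EFinP; exact: measurable_int iv.
pose H x r := g x * (v r * h x r).
have mH : measurable_fun setT (fun z : T1 * T2 => H z.1 z.2).
  apply: measurable_funM; first exact: measurableT_comp.
  by apply: measurable_funM => //; exact: measurableT_comp.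
have mgh r : measurable_fun setT (fun x => g x * h x r).
  by apply: measurable_funM => //; exact: (measurableT_comp mh (pair2_measurable r)).
have Hr r : (\int[m1]_x `|H x r|%:E = `|v r|%:E * \int[m1]_x `|g x * h x r|%:E)%E.
  rewrite -ge0_integralZl//; last by apply/measurable_EFinP; exact: measurableT_comp.
  by apply: eq_integral => x _; rewrite -EFinM /H mulrCA normrM.
have Hfin : (\int[m2]_r \int[m1]_x `|H x r|%:E < +oo)%E.
  apply: (@le_lt_trans _ _ (\int[m2]_r (`|C|%:E * `|v r|%:E))%E).
    apply: ge0_le_integral => //.
    - by move=> r _; exact: integral_ge0.
    - apply: (@measurable_fun_fubini_tonelli_G _ _ T1 T2 R m1 (fun z : T1 * T2 => `|H z.1 z.2|%:E)).
        by apply/measurable_EFinP; exact: measurableT_comp.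
      by move=> z; rewrite lee_fin.
    - apply/measurable_EFinP; apply: measurable_funM => //; exact: measurableT_comp.
    - move=> r _; rewrite Hr; have [->|vr0] := eqVneq (v r) 0.
        by rewrite normr0 mul0e mule0.
      rewrite muleC lee_wpmul2r// (le_trans (hC r vr0))// lee_fin; exact: ler_norm.
  rewrite ge0_integralZl//; last first.
    by apply/measurable_EFinP; exact: measurableT_comp.
  by rewrite lte_mul_pinfty//; have /integrableP[] := iv.
have [ae1 iH HE] := Rintegral_swap mH Hfin.
(* Where [g x] vanishes nothing is known about the integrability of [v r * h x r], but both sides
   are [0]; elsewhere integrability is recovered by dividing by [g x]. *)
have HF : {ae m1, forall x, \int[m2]_r H x r = g x * \int[m2]_r (v r * h x r)}.
  apply: filterS ae1 => x ix; have [gx0|gx0] := eqVneq (g x) 0.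
    by rewrite gx0 mul0r /Rintegral integral0_eq// => r _; rewrite /H gx0 mul0r.
  rewrite -RintegralZl//.
  have := integrableZl measurableT (g x)^-1 ix.
  apply: eq_integrable => // r _ /=; by rewrite -EFinM /H mulKf.
have mK : measurable_fun setT (fun x => g x * \int[m2]_r (v r * h x r)).
  apply: measurable_funM => //; apply: (measurable_Rintegral_kernel m2 (h := fun x r => v r * h x r)).
  by apply: measurable_funM => //; exact: measurableT_comp.
have mK' : measurable_fun setT (fun x => (g x * \int[m2]_r (v r * h x r))%:E).
  exact/measurable_EFinP.
split.
  apply/integrableP; split => //; have /integrableP[_] := iH; apply: le_lt_trans.
  apply: ae_ge0_le_integral => //.
  - exact: measurableT_comp.
  - by apply: measurableT_comp => //; exact: measurable_int iH.
  - by apply: filterS HF => x ->.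
transitivity (\int[m1]_x \int[m2]_r H x r).
  congr fine; apply: ae_eq_integral => //; first exact: measurable_int iH.
  by apply: filterS HF => x ->.
rewrite HE; apply: eq_Rintegral => r _.
have [vr0|vr0] := eqVneq (v r) 0.
  by rewrite vr0 mul0r /Rintegral integral0_eq// => x _; rewrite /H vr0 mul0r mulr0.
rewrite -RintegralZl//; first by apply: eq_Rintegral => x _; rewrite /H mulrCA.
apply/integrableP; split; first exact/measurable_EFinP.
by apply: le_lt_trans (hC r vr0) _; exact: ltry.
Qed.

End kernels.

(** * Improper integrals of derivatives *)

Section improper_FTC.
Context {R : realType}.
Local Notation mu := (@lebesgue_measure R).
Implicit Types (f F : R -> R) (a b : R).

(* A synonym that keeps typeclass resolution from searching for derivatives
   when the lemmas below are applied. *)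
Definition has_derivative F (x d : R) := is_derive x 1 F d.

Lemma continuous_within_cc f a b :
  (forall x, a <= x <= b -> {for x, continuous f}) -> {within `[a, b], continuous f}.
Proof.
move=> cf; apply: continuous_in_subspaceT => x /set_mem/=; rewrite in_itv/=.
exact: cf.
Qed.

Lemma has_derivative_FTC2 f F a b : a <= b ->
  (forall x, a <= x <= b -> has_derivative F x (f x)) ->
  (forall x, a <= x <= b -> {for x, continuous f}) ->
  (\int[mu]_(x in `[a, b]) (f x)%:E)%E = (F b - F a)%:E.
Proof.
rewrite le_eqVlt => /predU1P[<- _ _|ab dF cf].
  by rewrite set_itv1 integral_set1 subrr.
have cF x : a <= x <= b -> {for x, continuous F}.
  move=> xab; apply: differentiable_continuous.
  by apply/derivable1_diffP; have [] := dF _ xab.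
rewrite (@continuous_FTC2 _ f F a b) ?EFinB//.
- exact: continuous_within_cc.
- split.
  + move=> x; rewrite in_itv/= => /andP[ax xb].
    by have [] := dF x; rewrite ?(ltW ax) ?(ltW xb).
  + by apply: cvg_at_right_filter; apply: cF; rewrite lexx ltW.
  + by apply: cvg_at_left_filter; apply: cF; rewrite lexx ltW.
- move=> x; rewrite in_itv/= => /andP[ax xb].
  have H : is_derive x 1 F (f x) by apply: dF; rewrite !ltW.
  by rewrite derive1E derive_val.
Qed.

(** Monotone convergence along an exhaustion by compact intervals. Positivity of [f] lets the value,
    and with it the finiteness of the improper integral, come out of the limits of [F]. *)
Lemma ge0_FTC_bigcup f F (D : set R) (a_ b_ : R^nat) (A B : R) :
  (forall n, a_ n <= b_ n) -> nonincreasing_seq a_ -> nondecreasing_seq b_ ->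
  D = \bigcup_n `[a_ n, b_ n]%classic ->
  (forall x, D x -> 0 <= f x) ->
  (forall x, D x -> {for x, continuous f}) ->
  (forall x, D x -> has_derivative F x (f x)) ->
  F (a_ n) @[n --> \oo] --> A -> F (b_ n) @[n --> \oo] --> B ->
  (\int[mu]_(x in D) (f x)%:E)%E = (B - A)%:E.
Proof.
move=> ab na nb DE f0 cf dF FA FB.
have inD n x : a_ n <= x <= b_ n -> D x by move=> xn; rewrite DE; exists n; rewrite //= in_itv.
have : (\int[mu]_(x in `[a_ n, b_ n]) (f x)%:E)%E @[n --> \oo] --> (\int[mu]_(x in D) (f x)%:E)%E.
  rewrite DE; apply: ge0_nondecreasing_set_cvg_integral => //.
  - move=> n m nm; rewrite subsetEset => x /=; rewrite !in_itv/= => /andP[ax xb].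
    by rewrite (le_trans (na _ _ nm) ax) (le_trans xb (nb _ _ nm)).
  - move=> n; apply/measurable_EFinP; apply: subspace_continuous_measurable_fun => //.
    by apply: continuous_within_cc => x xn; apply: cf; exact: inD xn.
  - by move=> n x /=; rewrite in_itv/= => xn; rewrite lee_fin; apply: f0; exact: inD xn.
have -> : (fun n => (\int[mu]_(x in `[a_ n, b_ n]) (f x)%:E)%E) =
    (fun n => (F (b_ n) - F (a_ n))%:E).
  apply/funext => n; apply: has_derivative_FTC2 => // x xn.
    by apply: dF; exact: inD xn.
  by apply: cf; exact: inD xn.
move=> H; apply/esym; apply: (cvg_unique _ _ H) => //.
by apply: cvg_EFin; [exact: nearW|exact: cvgB].
Qed.

Let invn_cvg0 : (n.+2%:R^-1 : R) @[n --> \oo] --> 0.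
Proof.
have : (n.+1%:R^-1 : R) @[n --> \oo] --> 0 by exact: (@cvg_harmonic R).
by move/(cvg_comp _ _ (cvg_addnr 1)); apply: cvg_trans; apply: near_eq_cvg; apply: nearW => n; rewrite /= addn1.
Qed.

Lemma ge0_FTC_oo f F a b (A B : R) : a < b ->
  (forall x, a < x < b -> 0 <= f x) ->
  (forall x, a < x < b -> {for x, continuous f}) ->
  (forall x, a < x < b -> has_derivative F x (f x)) ->
  F x @[x --> a^'+] --> A -> F x @[x --> b^'-] --> B ->
  (\int[mu]_(x in `]a, b[) (f x)%:E)%E = (B - A)%:E.
Proof.
move=> ab f0 cf dF FA FB.
have ba0 : 0 < b - a by rewrite subr_gt0.
have i0 n : 0 < (n.+2%:R^-1 : R) by rewrite invr_gt0.
(* The shift by two keeps every reciprocal at most one half, so that the left ends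
   [a + (b - a) / n.+2] never pass the right ends [b - (b - a) / n.+2]. *)
have i2 n : (n.+2%:R^-1 : R) <= 2^-1 by rewrite lef_pV2 ?posrE// ler_nat.
have im n m : (n <= m)%N -> (m.+2%:R^-1 : R) <= n.+2%:R^-1.
  by move=> nm; rewrite lef_pV2 ?posrE// ler_nat.
apply: (@ge0_FTC_bigcup f F _ (fun n => a + (b - a) * n.+2%:R^-1) (fun n => b - (b - a) * n.+2%:R^-1)).
- by move=> n; move: (_^-1) (i2 n) => t t2; nra.
- by move=> n m /im nm; rewrite lerD2l ler_wpM2l// ltW.
- by move=> n m /im nm; rewrite lerD2l lerN2 ler_wpM2l// ltW.
- apply/seteqP; split => x /=.
    rewrite in_itv/= => /andP[ax xb].
    have : \forall n \near \oo, (n.+2%:R^-1 : R) < Num.min ((x - a) / (b - a)) ((b - x) / (b - a)).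
      apply: (@cvgr_lt _ _ _ _ _ (0 : R)) => //.
      by rewrite lt_min !divr_gt0 ?subr_gt0.
    move=> [n _ /(_ n (leqnn n))/=]; rewrite lt_min !ltr_pdivlMr// => /andP[h1 h2].
    exists n => //=; rewrite in_itv/=; move: (_^-1) h1 h2 => t h1 h2.
    by apply/andP; split; nra.
  move=> [n _ /=]; rewrite !in_itv/= => /andP[h1 h2].
  by move: (_^-1) (i2 n) (i0 n) h1 h2 => t t2 t0 h1 h2; apply/andP; split; nra.
- by move=> x /=; rewrite in_itv/=; exact: f0.
- by move=> x /=; rewrite in_itv/=; exact: cf.
- by move=> x /=; rewrite in_itv/=; exact: dF.
- move/cvg_at_rightP : FA; apply; split.
    by move=> n; rewrite ltrDl mulr_gt0.
  have -> : nbhs a = nbhs (a + (b - a) * 0) by rewrite mulr0 addr0.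
  by apply: cvgD; [exact: cvg_cst|apply: cvgM => //; exact: cvg_cst].
- move/cvg_at_leftP : FB; apply; split.
    by move=> n; rewrite ltrBlDr ltrDl mulr_gt0.
  have -> : nbhs b = nbhs (b - (b - a) * 0) by rewrite mulr0 subr0.
  by apply: cvgB; [exact: cvg_cst|apply: cvgM => //; exact: cvg_cst].
Qed.

Lemma ge0_FTC_oy f F a (A B : R) :
  (forall x, a < x -> 0 <= f x) ->
  (forall x, a < x -> {for x, continuous f}) ->
  (forall x, a < x -> has_derivative F x (f x)) ->
  F x @[x --> a^'+] --> A -> F x @[x --> +oo] --> B ->
  (\int[mu]_(x in `]a, +oo[) (f x)%:E)%E = (B - A)%:E.
Proof.
move=> f0 cf dF FA FB.
have i0 n : 0 < (n.+2%:R^-1 : R) by rewrite invr_gt0.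
have i2 n : (n.+2%:R^-1 : R) <= 2^-1 by rewrite lef_pV2 ?posrE// ler_nat.
have im n m : (n <= m)%N -> (m.+2%:R^-1 : R) <= n.+2%:R^-1.
  by move=> nm; rewrite lef_pV2 ?posrE// ler_nat.
apply: (@ge0_FTC_bigcup f F _ (fun n => a + n.+2%:R^-1) (fun n => a + n.+2%:R)).
- by move=> n; rewrite lerD2l (le_trans (i2 n))// (@le_trans _ _ 1) ?ler1n//; lra.
- by move=> n m /im nm; rewrite lerD2l.
- by move=> n m nm; rewrite lerD2l ler_nat.
- apply/seteqP; split => x /=.
    rewrite in_itv/= andbT => ax.
    have : \forall n \near \oo, (n.+2%:R^-1 : R) < x - a.
      by apply: (@cvgr_lt _ _ _ _ _ (0 : R)) => //; rewrite subr_gt0.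
    move=> [n _ nH].
    have [m xm] : exists m, (x - a) < m%:R.
      by exists (Num.bound (x - a)); apply: archi_boundP; rewrite subr_ge0 ltW.
    exists (maxn n m) => //=; rewrite in_itv/=.
    have /= := nH (maxn n m) (leq_maxl _ _) => h1.
    have h2 : (m%:R <= (maxn n m).+2%:R :> R) by rewrite ler_nat (leq_trans (leq_maxr n m))// ltnW.
    by rewrite -lerBrDl ltW//= -lerBlDl (le_trans (ltW xm)).
  move=> [n _ /=]; rewrite !in_itv/= andbT => /andP[h1 h2].
  by move: (_^-1) h1 (i0 n) => t h1 t0; lra.
- by move=> x /=; rewrite in_itv/= andbT; exact: f0.
- by move=> x /=; rewrite in_itv/= andbT; exact: cf.
- by move=> x /=; rewrite in_itv/= andbT; exact: dF.
- move/cvg_at_rightP : FA; apply; split.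
    by move=> n; rewrite ltrDl.
  by rewrite -[X in _ --> X]addr0; apply: cvgD => //; exact: cvg_cst.
- move/cvg_pinftyP : FB; apply.
  apply/cvgryPge => M; near=> n.
  rewrite -lerBlDl; apply: (@le_trans _ _ n%:R); first by near: n; exact: nbhs_infty_ger.
  by rewrite ler_nat ltnW.
Unshelve. all: by end_near. Qed.

End improper_FTC.

(** * Test functions *)

Section smooth_bumps.
Context {R : realType}.
Implicit Types (x y z : R) (f g : R -> R).

(* These functions are stable under differentiation, see [is_derive_flat]; the
   smoothness of everything built from [exp (-1/x)] follows by induction. *)
Definition flat (k : nat) (x : R) : R :=
  if 0 < x then (x^-1) ^+ k * expR (- x^-1) else 0.

Lemma flat_le0 k x : x <= 0 -> flat k x = 0.
Proof. by rewrite /flat leNgt => /negbTE ->. Qed.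

Lemma flat_ge0 k x : 0 <= flat k x.
Proof.
by rewrite /flat; case: ifPn => // x0; rewrite mulr_ge0 ?expR_ge0// exprn_ge0// invr_ge0 ltW.
Qed.

Lemma flat0_le1 x : flat 0 x <= 1.
Proof.
rewrite /flat; case: ifPn => // x0; rewrite expr0 mul1r -[leRHS]expR0 ler_expR.
by rewrite oppr_le0 invr_ge0 ltW.
Qed.

(** The exponential at [x^-1] dominates its Taylor term of order [k.+1], which leaves one spare
    factor [x]. *)
Lemma flat_le k x : flat k x <= (k.+1)`!%:R * `|x|.
Proof.
rewrite /flat; case: ifPn => x0; last by rewrite mulr_ge0.
rewrite gtr0_norm// expRN -ler_pdivrMr// mulrC mulrA -exprS.
rewrite ler_pdivrMr ?expR_gt0// -ler_pdivrMl ?ltr0n ?fact_gt0// mulrC.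
have := @expR_ge1Dxn R (x^-1) k; rewrite invr_ge0 (ltW x0) => /(_ isT).
by apply: le_trans; rewrite lerDr.
Qed.

Lemma continuous_flat0 k : {for 0, continuous (flat k)}.
Proof.
change (flat k x @[x --> 0] --> flat k 0); rewrite (flat_le0 k (lexx 0)).
apply: (@squeeze_cvgr _ _ _ _ (cst 0) (fun x => (k.+1)`!%:R * `|x|)).
- by apply: nearW => x; rewrite flat_ge0 flat_le.
- exact: cvg_cst.
- rewrite -[X in _ --> X](mulr0 (k.+1)`!%:R).
  apply: cvgM; first exact: cvg_cst.
  by have := @norm_continuous R R 0; rewrite /continuous_at normr0.
Qed.

Lemma is_derive_flat k x :
  is_derive x 1 (flat k) (- k%:R * flat k.+1 x + flat k.+2 x).
Proof.
have [x0|x0|->] := ltrgtP x 0.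
- rewrite !flat_le0 ?(ltW x0)// mulr0 addr0.
  have : is_derive x (1 : R) (cst 0 : R -> R) 0 by exact: is_derive_cst.
  apply: near_eq_is_derive.
  by near=> z; rewrite flat_le0//; apply: ltW; near: z; exact: lt_nbhsl.
- pose h y : R := y ^+ k * expR (- y).
  have dh y : is_derive y 1 h (y ^+ k *: (expR (- y) * (-1)) + expR (- y) *: ((k%:R * y ^+ k.-1) *: 1)).
    have de : is_derive y 1 (fun y : R => expR (- y)) (expR (- y) * (-1)).
      exact: (@is_derive1_comp _ expR -%R).
    have dp : is_derive y 1 (fun y : R => y ^+ k) ((k%:R * y ^+ k.-1) *: 1).
      have -> : (fun y : R => y ^+ k) = (@id R) ^+ k by apply/funext => z; rewrite fctE.
      exact: is_deriveX.
    exact: (@is_deriveM _ _ (fun y => y ^+ k) (fun y => expR (- y))).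
  have di : is_derive x 1 (fun z : R => z^-1) (- x ^- 2 *: 1).
    by apply: (@is_deriveV _ id); rewrite gt_eqF.
  have D := is_derive1_comp (dh x^-1) di.
  have -> : - k%:R * flat k.+1 x + flat k.+2 x =
    (x^-1 ^+ k *: (expR (- x^-1) * -1) + expR (- x^-1) *: ((k%:R * x^-1 ^+ k.-1) *: 1)) * (- x ^- 2 *: 1).
    rewrite /flat x0 -exprVn /GRing.scale/= !mulr1.
    by case: (k) => [|j]; rewrite /= ?mul0r !exprS; ring.
  apply: near_eq_is_derive D.
  by near=> z; rewrite /h/= /flat ifT//; near: z; exact: lt_nbhsr.
- rewrite !flat_le0 ?lexx// mulr0 addr0.
  (* At [0] the difference quotient of [flat k] is [flat k.+1] itself, since
     [flat k z = flat k.+1 z * z]; continuity of the latter at [0] gives the derivative. *)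
  apply/is_derive1_caratheodory; exists (flat k.+1); split.
  + move=> z; rewrite (@flat_le0 _ 0)// !subr0 /flat; case: ifPn => z0; last by rewrite mul0r.
    by rewrite exprS mulrAC -mulrA mulrC mulrACA mulVf ?mul1r ?gt_eqF// mulrC.
  + exact: continuous_flat0.
  + by rewrite flat_le0.
Unshelve. all: by end_near. Qed.

(** A syntactic class closed under differentiation, so that no formula for higher derivatives of a
    bump is ever needed. *)
Inductive bumpy : (R -> R) -> Prop :=
| bumpy_cst c : bumpy (fun=> c)
| bumpy_flat k a b : bumpy (fun x => flat k (a * x + b))
| bumpyD f g : bumpy f -> bumpy g -> bumpy (fun x => f x + g x)
| bumpyM f g : bumpy f -> bumpy g -> bumpy (fun x => f x * g x).

Lemma bumpy_derive f : bumpy f ->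
  exists2 g, bumpy g & forall x, is_derive x 1 f (g x).
Proof.
elim => [c|k a b|{}f g bf [f' bf' df] bg [g' bg' dg]|{}f g bf [f' bf' df] bg [g' bg' dg]].
- by exists (fun=> 0); [exact: bumpy_cst|move=> x; exact: is_derive_cst].
- exists (fun x => (- k%:R * flat k.+1 (a * x + b) + flat k.+2 (a * x + b)) * a).
    by do !(apply: bumpyD || apply: bumpyM); by [exact: bumpy_cst|exact: bumpy_flat].
  move=> x; have da : is_derive x 1 (fun x => a * x + b) a.
    have -> : (fun x => a * x + b) = (a *: (@id R)) + cst b by [].
    have : is_derive x 1 ((a *: (@id R)) + cst b) (a *: 1 + 0).
      exact: is_deriveD.
    by rewrite addr0 /GRing.scale/= mulr1.
  exact: (@is_derive1_comp _ (flat k) (fun x => a * x + b) _ _ _ (is_derive_flat k _) da).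
- exists (fun x => f' x + g' x); first exact: bumpyD.
  by move=> x; exact: (@is_deriveD _ _ _ f g).
- exists (fun x => f x * g' x + g x * f' x).
    by apply: bumpyD; exact: bumpyM.
  by move=> x; exact: (@is_deriveM _ _ f g).
Qed.

Lemma smoothP f g : (forall x, is_derive x 1 f (g x)) -> smooth g -> smooth f.
Proof.
move=> df sg [|n] x; first by have [] := df x.
rewrite /derive1n iterSr (_ : f^`()%classic = g); first exact: sg.
by apply/funext => y; rewrite derive1E; have H := df y; rewrite derive_val.
Qed.

Lemma smooth_bumpy f : bumpy f -> smooth f.
Proof.
move=> bf n; elim: n f bf => [|n IH] f /bumpy_derive[g bg df] x.
  by have [] := df x.
rewrite /derive1n iterSr (_ : f^`()%classic = g); first exact: IH.
by apply/funext => y; rewrite derive1E; have H := df y; rewrite derive_val.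
Qed.

(** Values lie in [[0, 1]], the function vanishes outside []c, d[], and as [n] grows the factor
    [n.+1] steepens both flanks: the limit is the indicator of []c, d[]. Smooth test functions
    thereby reach interval integrals. *)
Definition flat_bump (n : nat) (c d x : R) : R :=
  flat 0 (n.+1%:R * (x - c)) * flat 0 (n.+1%:R * (d - x)).

Lemma bumpy_bump n c d : bumpy (flat_bump n c d).
Proof.
have -> : flat_bump n c d = fun x => flat 0 (n.+1%:R * x + (- n.+1%:R * c)) *
   flat 0 (- n.+1%:R * x + n.+1%:R * d).
  by apply/funext => x; rewrite /flat_bump; congr (flat _ _ * flat _ _); ring.
by apply: bumpyM; exact: bumpy_flat.
Qed.

Lemma bump_ge0 n c d x : 0 <= flat_bump n c d x.
Proof. by rewrite mulr_ge0// flat_ge0. Qed.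

Lemma bump_le1 n c d x : flat_bump n c d x <= 1.
Proof. by rewrite mulr_ile1// ?flat_ge0// flat0_le1. Qed.

Lemma bump_out n c d x : ~~ (c < x < d) -> flat_bump n c d x = 0.
Proof.
rewrite negb_and -!leNgt /flat_bump => /orP[xc|dx].
- by rewrite flat_le0 ?mul0r// pmulr_rle0// subr_le0.
- by rewrite [X in _ * X]flat_le0 ?mulr0// pmulr_rle0// subr_le0.
Qed.

Lemma continuous_bumpy f : bumpy f -> continuous f.
Proof.
move=> /bumpy_derive[g _ df] x; apply: differentiable_continuous.
by apply/derivable1_diffP; have [] := df x.
Qed.

Lemma cvg_flat0 z : 0 < z -> flat 0 (n.+1%:R * z) @[n --> \oo] --> (1 : R).
Proof.
move=> z0.
have -> : (fun n : nat => flat 0 (n.+1%:R * z)) = (fun n : nat => expR (- (n.+1%:R^-1 * z^-1))).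
  by apply/funext => n; rewrite /flat mulr_gt0// expr0 mul1r invfM.
have H : - (n.+1%:R^-1 * z^-1) @[n --> \oo] --> - (0 * z^-1 : R).
  by apply: cvgN; apply: cvgM; [exact: (@cvg_harmonic R)|exact: cvg_cst].
have := cvg_comp _ _ H (@continuous_expR R (- (0 * z^-1))).
by rewrite mul0r oppr0 expR0.
Qed.

Lemma cvg_bump c d x : c < x < d -> flat_bump n c d x @[n --> \oo] --> (1 : R).
Proof.
by move=> /andP[cx xd]; rewrite -[X in _ --> X]mulr1; apply: cvgM; apply: cvg_flat0; rewrite subr_gt0.
Qed.

End smooth_bumps.

Section test_functions.
Context {R : realType}.
Local Notation mu := (@lebesgue_measure R).
Implicit Types (U : set R) (phi f : R -> R).

Lemma smooth_is_derive phi (x : R) : smooth phi -> is_derive x 1 phi (phi^`()%classic x).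
Proof. by move=> s; rewrite derive1E; apply/derivableP; exact: (s 0%N x). Qed.

Lemma smooth_derive1 phi : smooth phi -> smooth phi^`()%classic.
Proof. by move=> s n x; have := s n.+1 x; rewrite /derive1n iterSr. Qed.

Lemma smooth_continuous phi : smooth phi -> continuous phi.
Proof.
move=> s x; apply: differentiable_continuous; apply/derivable1_diffP.
exact: (s 0%N x).
Qed.

Lemma test_function_itv U phi (c d : R) : smooth phi ->
  (forall x, phi x != 0 -> c <= x <= d) -> `[c, d] `<=` U -> test_function U phi.
Proof.
move=> s h cdU.
have sub : closure [set x | phi x != 0] `<=` `[c, d].
  rewrite [X in _ `<=` X](closure_id _).1; last exact: interval_closed.
  by apply: closure_subset => x /= /h; rewrite in_itv.
split=> //; split; last exact: subset_trans sub cdU.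
apply: subclosed_compact sub; [exact: closed_closure|exact: segment_compact].
Qed.

Lemma test_function_eq0 U phi x : test_function U phi ->
  ~ closure [set y | phi y != 0] x -> phi x = 0 /\ phi^`()%classic x = 0.
Proof.
move=> [s _] nx; split.
  by apply/eqP/negPn/negP => px; apply: nx; exact: subset_closure.
have nz : \forall z \near x, 0 = phi z.
  have := @open_nbhs_nbhs _ x (~` closure [set y | phi y != 0]).
  have oC : open_nbhs x (~` closure [set y | phi y != 0]).
    by split => //; apply: closed_openC; exact: closed_closure.
  move=> /(_ oC); apply: filterS => z nz; apply/esym/eqP/negPn/negP => pz.
  by apply: nz; exact: subset_closure.
have H : is_derive x (1 : R) phi 0.
  have H0 : is_derive x (1 : R) (cst 0 : R -> R) 0 by exact: is_derive_cst.
  exact: near_eq_is_derive nz H0.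
by rewrite derive1E derive_val.
Qed.

Lemma test_function_out U phi x : test_function U phi -> ~ U x ->
  phi x = 0 /\ phi^`()%classic x = 0.
Proof.
move=> tp Ux; apply: (test_function_eq0 tp) => cx; apply: Ux.
by have [_ [_]] := tp; apply.
Qed.

Lemma test_function_sub U V phi : U `<=` V -> test_function U phi -> test_function V phi.
Proof. by move=> UV [s [c cU]]; split => //; split => //; exact: subset_trans cU UV. Qed.

Lemma test_function_bounded U phi : test_function U phi ->
  exists M B : R, [/\ 0 < M, 0 < B,
    (forall x, `|phi x| <= B /\ `|phi^`()%classic x| <= B) &
    (forall x, M < `|x| -> phi x = 0 /\ phi^`()%classic x = 0)].
Proof.
move=> tp; have [s [cK _]] := tp.
have [M0 [M0r /(_ _ (ltr_pwDr ltr01 (ler_norm M0)))]] := compact_bounded cK.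
set M := `|M0| + 1 => KM.
have M_gt0 : 0 < M by rewrite ltr_wpDl.
have out x : M < `|x| -> phi x = 0 /\ phi^`()%classic x = 0.
  move=> Mx; apply: (test_function_eq0 tp) => /KM /=.
  by rewrite leNgt Mx.
have bnd (g : R -> R) : continuous g -> (forall x, M < `|x| -> g x = 0) ->
    exists2 B, 0 < B & forall x, `|g x| <= B.
  move=> cg g0.
  have [|c _ gc] := @EVT_max R (fun x => `|g x|) (- M) M (ge0_cp (ltW M_gt0)).2.
    apply: continuous_subspaceT => x; apply: continuous_comp; first exact: cg.
    exact: norm_continuous.
  exists (`|g c| + 1); first by rewrite ltr_wpDl.
  move=> x; have [xM|/g0->] := leP `|x| M; last by rewrite normr0 addr_ge0.
  by rewrite (le_trans (gc x _)) ?lerDl// in_itv/= -ler_norml.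
have [B1 B10 h1] := bnd phi (smooth_continuous s) (fun x h => (out x h).1).
have [B2 B20 h2] := bnd _ (smooth_continuous (smooth_derive1 s)) (fun x h => (out x h).2).
exists M, (B1 + B2); split => //; first exact: addr_gt0.
move=> x; split.
  by rewrite (le_trans (h1 x))// lerDl ltW.
by rewrite (le_trans (h2 x))// lerDr ltW.
Qed.

Lemma measurable_test U phi : test_function U phi -> measurable_fun setT phi.
Proof. by move=> [s _]; apply: continuous_measurable_fun; exact: smooth_continuous. Qed.

Lemma measurable_test_derive1 U phi : test_function U phi ->
  measurable_fun setT phi^`()%classic.
Proof.
by move=> [s _]; apply: continuous_measurable_fun; exact: smooth_continuous (smooth_derive1 s).
Qed.

Lemma test_function_bump U n (c d : R) : `[c, d] `<=` U -> test_function U (flat_bump n c d).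
Proof.
move=> cdU; apply: test_function_itv cdU; first exact: smooth_bumpy (bumpy_bump _ _ _).
move=> x; apply: contraNT => ncd; rewrite bump_out//; apply: contraNN ncd.
by move=> /andP[? ?]; rewrite !ltW.
Qed.

End test_functions.

(** * The fundamental lemma and the du Bois-Reymond lemma *)

Section fundamental_lemma.
Context {R : realType}.
Local Notation mu := (@lebesgue_measure R).
Implicit Types (U : set R) (f g : R -> R).

Lemma integrable_boundedM (D : set R) f g (C : R) : measurable D ->
  mu.-integrable D (EFin \o f) -> measurable_fun D g ->
  (forall x, D x -> `|g x| <= C) -> mu.-integrable D (fun x => (f x * g x)%:E).
Proof.
move=> mD intf mg gC.
have := @integrableMl _ _ _ mu _ mD _ g intf mg.
apply; exists C; split; first exact: num_real.
by move=> x Cx y Dy; rewrite /= (le_trans (gC y Dy))// ltW.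
Qed.

Lemma cvg_Rintegral_bump f (c d : R) : mu.-integrable `]c, d[ (EFin \o f) ->
  (\int[mu]_(x in `]c, d[) (f x * flat_bump n c d x)) @[n --> \oo] -->
  \int[mu]_(x in `]c, d[) f x.
Proof.
move=> intf; have mb n : measurable_fun setT (flat_bump n c d).
  exact: continuous_measurable_fun (continuous_bumpy (bumpy_bump n c d)).
have mf : measurable_fun `]c, d[ f by apply/measurable_EFinP; exact: measurable_int intf.
apply: fine_cvg; rewrite fineK; last exact: integrable_fin_num.
have [|||||_ _ H] := @dominated_convergence _ _ R mu `]c, d[%classic (measurable_itv _)
  (fun n x => (f x * flat_bump n c d x)%:E) (EFin \o f) (fun x => `|f x|%:E).
- by move=> n; apply/measurable_EFinP; apply: measurable_funM => //; exact: measurable_funTS (mb n).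
- by apply/measurable_EFinP.
- apply: aeW => x /=; rewrite in_itv/= => cxd.
  apply: cvg_EFin; first exact: nearW.
  by rewrite -[X in _ --> X]mulr1; apply: cvgM; [exact: cvg_cst|exact: cvg_bump].
- exact: integrable_norm intf.
- apply: aeW => x n _; rewrite lee_fin normrM ler_piMr//.
  by rewrite ger0_norm ?bump_ge0// bump_le1.
- exact: H.
Qed.

Lemma Rintegral_bump_sub U f n (c d : R) : `]c, d[ `<=` U ->
  \int[mu]_(x in U) (f x * flat_bump n c d x) =
  \int[mu]_(x in `]c, d[) (f x * flat_bump n c d x).
Proof.
move=> cdU; rewrite Rintegral_mkcond [RHS]Rintegral_mkcond.
apply: eq_Rintegral => z _; rewrite !patchE; case: ifPn => zU.
  case: ifPn => // zcd; rewrite bump_out ?mulr0//.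
  by apply: contraNN zcd => zcd; rewrite inE/= in_itv.
by case: ifPn => // /[!inE] /cdU/mem_set; rewrite (negbTE zU).
Qed.

(** Lebesgue differentiation: the primitive from [-oo] of [f] patched by zero vanishes identically,
    and its derivative is [f] almost everywhere on the interval. *)
Lemma ae_eq0_Rintegral0 f (c d : R) : mu.-integrable `]c, d[ (EFin \o f) ->
  (forall x, c < x <= d -> \int[mu]_(t in `]c, x[) f t = 0) ->
  {ae mu, forall x, c < x < d -> f x = 0}.
Proof.
move=> intf f0; pose g := f \_ `]c, d[.
have intg : mu.-integrable setT (EFin \o g).
  by rewrite -restrict_EFin; apply/integrable_restrict => //=; rewrite setTI.
have locg : locally_integrable setT g by exact: integrable_locally_restrict.
have intNy y : mu.-integrable `]-oo, y] (EFin \o g) by exact: integrableS intg.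
have := FTC1Ny intNy locg; apply: ae_lebesgueS => x [_ gx] cxd.
have -> : f x = g x by rewrite /g patchE mem_set//= in_itv/= cxd.
rewrite -gx.
have -> : (fun x => \int[mu]_(t in `]-oo, x]) g t) = cst 0; last by rewrite derive1_cst.
apply/funext => y /=; rewrite -Rintegral_mkcondr.
have [yc|cy] := leP y c.
  rewrite (_ : _ `&` _ = set0) ?Rintegral_set0//.
  apply/seteqP; split => z //=; rewrite !in_itv/= => -[zy /andP[cz _]]; lra.
have [yd|dy] := ltP y d.
  rewrite (_ : _ `&` _ = `]c, y]%classic).
    rewrite -Rintegral_itv_bndo_bndc; first by rewrite f0// cy ltW.
    apply: integrableS intf => //; apply: subset_itvl; by rewrite bnd_simp ltW.
  by apply/seteqP; split => z /=; rewrite !in_itv/=; [move=> [zy /andP[cz _]]|move=> /andP[cz zy]; split => //]; apply/andP; split => //; lra.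
have [cd|dc] := ltP c d.
  rewrite (_ : _ `&` _ = `]c, d[%classic); first by rewrite f0// cd lexx.
  apply/seteqP; split => z /=; rewrite !in_itv/=; first by case.
  by move=> /andP[cz zd]; split; [lra|apply/andP].
rewrite (_ : _ `&` _ = set0) ?Rintegral_set0//.
apply/seteqP; split => z //=; rewrite !in_itv/= => -[zy /andP[cz zd]]; lra.
Qed.

Lemma locally_integrable_itv U f (c d : R) : locally_integrable U f -> `[c, d] `<=` U ->
  mu.-integrable `[c, d] (EFin \o f).
Proof.
move=> [mf oU fK] cdU; apply/integrableP; split.
  apply/measurable_EFinP; apply: measurable_funS mf => //; exact: open_measurable.
by have := fK _ cdU (@segment_compact _ c d).
Qed.

(** Bumps that tend to the indicator of []c, x[] are test functions on [U], so the integral of [f]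
    over each []c, x[] vanishes in the limit. *)
Lemma fundamental_lemma_itv U f (c d : R) : locally_integrable U f ->
  (forall phi, test_function U phi -> \int[mu]_(x in U) (f x * phi x) = 0) ->
  `[c, d] `<=` U -> {ae mu, forall x, c < x < d -> f x = 0}.
Proof.
move=> lf f0 cdU; have icc := locally_integrable_itv lf cdU.
have ioo : mu.-integrable `]c, d[ (EFin \o f).
  by apply: integrableS icc => //; exact: subset_itv_oo_cc.
apply: ae_eq0_Rintegral0 => // x /andP[cx xd].
have sub : `]c, x[ `<=` `]c, d[.
  by apply: subset_itvl; rewrite bnd_simp.
have iox : mu.-integrable `]c, x[ (EFin \o f) by exact: integrableS ioo.
have := cvg_Rintegral_bump iox.
have -> : (fun n => \int[mu]_(x0 in `]c, x[) (f x0 * flat_bump n c x x0)) = (fun=> 0).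
  apply/funext => n; have [lfm oU _] := lf.
  have cxU : `[c, x] `<=` U.
    by apply: subset_trans cdU; apply: subset_itvl; rewrite bnd_simp.
  rewrite -(Rintegral_bump_sub (U := U)) ?(f0 _ (test_function_bump n cxU))//.
  exact: subset_trans (@subset_itv_oo_cc _ _ c x) cxU.
by move=> /(cvg_unique _ (cvg_cst 0)) => /(_ (@Rhausdorff R)) <-.
Qed.

Lemma ae_open U (P : R -> Prop) : open U ->
  (forall c d : R, `[c, d] `<=` U -> {ae mu, forall x, c < x < d -> P x}) ->
  {ae mu, forall x, U x -> P x}.
Proof.
move=> oU UP.
(* Countably many exceptional sets suffice: intervals with rational endpoints are enumerated by
   [unpickle], with the default pair [(0, 0)] for numbers that code nothing. *)
have : {ae mu, forall x (n : nat), let q := odflt (0, 0) (unpickle n) in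
    `[ratr q.1, ratr q.2] `<=` U -> ratr q.1 < x < ratr q.2 -> P x}.
  apply: ae_foralln => n /=; set q := odflt _ _.
  have [cdU|ncdU] := pselect (`[(ratr q.1 : R), ratr q.2] `<=` U); last by apply: aeW.
  by have := UP _ _ cdU; apply: ae_lebesgueS => x h _.
apply: ae_lebesgueS => x h Ux.
have [e /= e0 eU] := (nbhs_ballP _ _).1 (open_nbhs_nbhs (conj oU Ux)).
have [c] := @rat_in_itvoo R (x - e) x ltac:(lra); rewrite in_itv/= => /andP[c1 c2].
have [d] := @rat_in_itvoo R x (x + e) ltac:(lra); rewrite in_itv/= => /andP[d1 d2].
apply: (h (pickle (c, d))); rewrite pickleK/=; last by rewrite c2 d1.
move=> z /=; rewrite in_itv/= => /andP[cz zd]; apply: eU.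
by rewrite /ball/= ltr_distlC; apply/andP; split; lra.
Qed.

Lemma fundamental_lemma U f : locally_integrable U f ->
  (forall phi, test_function U phi -> \int[mu]_(x in U) (f x * phi x) = 0) ->
  {ae mu, forall x, U x -> f x = 0}.
Proof.
move=> lf f0; have [_ oU _] := lf; apply: ae_open => // c d.
exact: fundamental_lemma_itv lf f0.
Qed.

(** The primitive vanishes before [e] by the support of [psi], and after [g] because [psi] has mean
    zero; in between it is smooth since its derivative is [bumpy]. *)
Lemma primitive_test_function U psi (e g : R) : bumpy psi -> e <= g ->
  (forall x, ~~ (e < x < g) -> psi x = 0) -> `[e, g] `<=` U ->
  \int[mu]_(x in `]e, g[) psi x = 0 ->
  exists2 Phi, test_function U Phi & Phi^`()%classic = psi.
Proof.
move=> bpsi eg psi0 egU ipsi.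
have cpsi := continuous_bumpy bpsi.
have int_psi : mu.-integrable setT (EFin \o psi).
  have -> : psi = psi \_ `[e, g].
    apply/funext => x; rewrite patchE; case: ifPn => // xeg; apply: psi0.
    by apply: contraNN xeg => /andP[? ?]; rewrite inE/= in_itv/= !ltW.
  rewrite -restrict_EFin; apply/integrable_restrict => //=; rewrite setTI.
  apply: continuous_compact_integrable; first exact: segment_compact.
  exact: continuous_subspaceT.
pose Phi x := \int[mu]_(t in `]-oo, x]) psi t.
have dPhi (x : R) : is_derive x 1 Phi (psi x).
  have int1 : mu.-integrable `]-oo, (x + 1)] (EFin \o psi) by exact: integrableS int_psi.
  have [|||dx <-] := @continuous_FTC1 R psi -oo%O x (x + 1) _ int1.
  - by rewrite ltrDl.
  - exact: ltNyr.
  - exact: cpsi.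
  - by rewrite derive1E; exact/derivableP.
exists Phi; last by apply/funext => x; rewrite derive1E; have H := dPhi x; rewrite derive_val.
apply: test_function_itv egU; first exact: smoothP dPhi (smooth_bumpy bpsi).
move=> x; apply: contraNT; rewrite negb_and -!ltNge => /orP[xe|gx]; apply/eqP.
  rewrite /Phi /Rintegral integral0_eq// => t /=; rewrite in_itv/= => tx.
  by rewrite psi0//; apply/negP => /andP[? ?]; lra.
rewrite -[RHS]ipsi /Phi Rintegral_mkcond [RHS]Rintegral_mkcond.
apply: eq_Rintegral => z _; rewrite !patchE; case: ifPn => zU.
  case: ifPn => // zcd; rewrite psi0//.
  by apply: contraNN zcd => zcd; rewrite inE/= in_itv.
case: ifPn => // /[!inE]/=; rewrite in_itv/= => /andP[_ zg].
move: zU; rewrite notin_setE/= in_itv/= => /negP; lra.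
Qed.

Lemma integrable_cst_itv (u v r : R) : mu.-integrable `]u, v[ (EFin \o (fun=> r)).
Proof.
apply/integrableP; split; first exact: measurable_cst.
rewrite /= integral_cst//= lebesgue_measure_itv/= lte_fin.
by case: ifPn => _; rewrite ?mule0 ?ltry// -EFinB -EFinM ltry.
Qed.

(** A combination of a bump on []c, d[] and a bump on the fixed middle third []c1, d1[], weighted by
    each other's masses, has mean zero and is thus the derivative of a test function. As the bumps
    sharpen, the mean of [h] over []c, d[] is seen to equal its mean over the middle third, which is
    the constant. *)
Lemma du_Bois_Reymond_itv h (a b : R) : a < b -> mu.-integrable `]a, b[ (EFin \o h) ->
  (forall phi, test_function `]a, b[ phi ->
    \int[mu]_(x in `]a, b[) (h x * phi^`()%classic x) = 0) ->
  exists C, forall c d, a < c -> c < d -> d < b ->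
    \int[mu]_(x in `]c, d[) h x = C * (d - c).
Proof.
move=> ab ih h0.
pose c1 := a + (b - a) / 3; pose d1 := b - (b - a) / 3.
have ac1 : a < c1 by rewrite /c1; lra.
have cd1 : c1 < d1 by rewrite /c1 /d1; lra.
have d1b : d1 < b by rewrite /d1; lra.
exists (\int[mu]_(x in `]c1, d1[) h x / (d1 - c1)) => c d ac cd db.
pose A n := \int[mu]_(x in `]c, d[) (1 * flat_bump n c d x).
pose A1 n := \int[mu]_(x in `]c1, d1[) (1 * flat_bump n c1 d1 x).
pose H n := \int[mu]_(x in `]c, d[) (h x * flat_bump n c d x).
pose H1 n := \int[mu]_(x in `]c1, d1[) (h x * flat_bump n c1 d1 x).
have cvA u v : u < v -> (fun n => \int[mu]_(x in `]u, v[) (1 * flat_bump n u v x)) @ \oo --> v - u.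
  move=> uv; have i1 := integrable_cst_itv u v 1.
  have := cvg_Rintegral_bump i1.
  by rewrite Rintegral_cst//= lebesgue_measure_itv/= lte_fin uv mul1r.
have sub u v : a < u -> v < b -> `]u, v[ `<=` `]a, b[.
  by move=> au vb; apply: subset_itv; rewrite bnd_simp ltW.
have cvH u v : a < u -> v < b -> (fun n => \int[mu]_(x in `]u, v[) (h x * flat_bump n u v x)) @ \oo -->
   \int[mu]_(x in `]u, v[) h x.
  by move=> au vb; apply: cvg_Rintegral_bump; apply: integrableS ih => //; exact: sub.
have mb n u v : measurable_fun setT (flat_bump n u v : R -> R).
  exact: continuous_measurable_fun (continuous_bumpy (bumpy_bump n u v)).
have ib (D : set R) f n u v : measurable D -> mu.-integrable D (EFin \o f) ->
    mu.-integrable D (fun x => (f x * flat_bump n u v x)%:E).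
  move=> mD iF; apply: (@integrable_boundedM _ _ _ 1) => //; first exact: measurable_funTS (mb n u v).
  by move=> x _; rewrite ger0_norm ?bump_ge0// bump_le1.
have key n : A1 n * H n - A n * H1 n = 0.
  pose psi x := A1 n * flat_bump n c d x + - A n * flat_bump n c1 d1 x.
  have i1 := integrable_cst_itv a b 1.
  have lin f : mu.-integrable `]a, b[ (EFin \o f) ->
      \int[mu]_(x in `]a, b[) (f x * psi x) =
      A1 n * \int[mu]_(x in `]c, d[) (f x * flat_bump n c d x)
      - A n * \int[mu]_(x in `]c1, d1[) (f x * flat_bump n c1 d1 x).
    move=> iF; rewrite -(Rintegral_bump_sub f n (sub _ _ ac db)) -(Rintegral_bump_sub f n (sub _ _ ac1 d1b)).
    rewrite -mulNr -Rintegral_lin2//; [|exact: ib|exact: ib].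
    by apply: eq_Rintegral => x _; rewrite /psi; ring.
  (* [[e, g]] contains both supports and still lies inside []a, b[], as a test function on []a, b[]
     requires. *)
  pose e := Num.min c c1; pose g := Num.max d d1.
  have [Phi tPhi dPhi] : exists2 Phi, test_function `]a, b[ Phi & Phi^`()%classic = psi.
    apply: (@primitive_test_function _ _ e g).
    - by apply: bumpyD; apply: bumpyM; by [exact: bumpy_cst|exact: bumpy_bump].
    - by rewrite /e /g ge_min le_max (ltW cd).
    - move=> x; rewrite negb_and /e /g gt_min lt_max !negb_or => xn.
      rewrite /psi !bump_out ?mulr0 ?addr0//.
        by rewrite negb_and; case/orP: xn => /andP[_ ->]; rewrite ?orbT.
      by rewrite negb_and; case/orP: xn => /andP[-> _]; rewrite ?orbT.
    - by apply: subset_itv; rewrite bnd_simp/= ?lt_min ?gt_max ?ac ?ac1 ?db ?d1b.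
    - transitivity (A1 n * A n - A n * A1 n); last by rewrite [X in X - _]mulrC subrr.
      rewrite -[RHS](lin _ i1).
      rewrite Rintegral_mkcond [RHS]Rintegral_mkcond.
      apply: eq_Rintegral => z _; rewrite !patchE mul1r.
      case: ifPn => zU.
        rewrite mem_set//; move: zU; rewrite inE/= !in_itv/= => /andP[ez zg].
        by rewrite (lt_trans _ ez) ?(lt_trans zg)// /e /g ?lt_min ?gt_max ?ac ?ac1 ?db ?d1b.
      case: ifPn => // _; rewrite /psi !bump_out ?mulr0 ?addr0//.
        by apply: contraNN zU; rewrite inE/= in_itv/= /e /g gt_min lt_max => /andP[-> ->]; rewrite !orbT.
      by apply: contraNN zU; rewrite inE/= in_itv/= /e /g gt_min lt_max => /andP[-> ->].
  by rewrite -[RHS](h0 _ tPhi) dPhi -lin.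
have : (fun n => A1 n * H n - A n * H1 n) @ \oo -->
    (d1 - c1) * \int[mu]_(x in `]c, d[) h x - (d - c) * \int[mu]_(x in `]c1, d1[) h x.
  apply: cvgB; apply: cvgM; [exact: cvA|exact: cvH|exact: cvA|exact: cvH].
have -> : (fun n => A1 n * H n - A n * H1 n) = (fun=> 0) by apply/funext => n; exact: key.
move=> /(cvg_unique _ (cvg_cst 0)) => /(_ (@Rhausdorff R)) /esym/eqP.
rewrite subr_eq0 => /eqP E; have d1c1 : d1 - c1 != 0 by rewrite subr_eq0 gt_eqF.
apply: (mulfI d1c1).
by rewrite E mulrA mulrCA divff// mulr1 mulrC.
Qed.

Lemma du_Bois_Reymond h (a b : R) : a < b -> mu.-integrable `]a, b[ (EFin \o h) ->
  (forall phi, test_function `]a, b[ phi ->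
    \int[mu]_(x in `]a, b[) (h x * phi^`()%classic x) = 0) ->
  exists C, {ae mu, forall x, a < x < b -> h x = C}.
Proof.
move=> ab ih /(du_Bois_Reymond_itv ab ih)[C hC]; exists C.
have : {ae mu, forall x, `]a, b[%classic x -> h x = C}.
  apply: ae_open; first exact: interval_open.
  move=> c d cdab; have [cd|dc] := ltP c d; last first.
    by apply: aeW => x /andP[cx /(lt_trans cx)]; rewrite ltNge dc.
  have : `]a, b[%classic c by apply: cdab; rewrite /= in_itv/= lexx ltW.
  have : `]a, b[%classic d by apply: cdab; rewrite /= in_itv/= lexx ltW.
  rewrite /= !in_itv/= => /andP[ad db] /andP[ac cb].
  have icd : mu.-integrable `]c, d[ (EFin \o h).
    by apply: integrableS ih => //; apply: subset_itv; rewrite bnd_simp ltW.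
  have ic : mu.-integrable `]c, d[ (fun x => (h x - C)%:E).
    exact: lebesgue_integrableB (integrable_cst_itv c d C).
  have := @ae_eq0_Rintegral0 (fun x => h x - C) c d ic.
  have h0 x : c < x <= d -> \int[mu]_(t in `]c, x[) (h t - C) = 0.
    move=> /andP[cx xd]; have sub : `]c, x[ `<=` `]c, d[ by apply: subset_itvl; rewrite bnd_simp.
    rewrite RintegralB//; [|exact: integrableS icd|exact: integrable_cst_itv].
    rewrite hC ?(le_lt_trans xd)// Rintegral_cst//= lebesgue_measure_itv/= lte_fin cx/= subrr//.
  by move=> /(_ h0); apply: ae_lebesgueS => x hx /hx /eqP; rewrite subr_eq0 => /eqP.
by apply: ae_lebesgueS => x hx xab; apply: hx; rewrite /= in_itv.
Qed.

End fundamental_lemma.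

(** * Power kernels *)

Section power_integrals.
Context {R : realType}.
Local Notation mu := (@lebesgue_measure R).
Implicit Types (e t x y : R).

Lemma powR_cvgy e : e < 0 -> z `^ e @[z --> +oo] --> (0 : R).
Proof.
move=> e0; apply/cvgrPdist_lt => eps eps0; near=> z.
rewrite sub0r normrN ger0_norm ?powR_ge0//.
have z0 : 0 < z by near: z; exact: nbhs_pinfty_gt.
have : eps `^ (e^-1) < z by near: z; apply: nbhs_pinfty_gt; exact: num_real.
move=> /(@gt0_ltr_powR _ (- e) _ _ _ _ _); rewrite !nnegrE powR_ge0 (ltW z0) oppr_gt0.
move=> /(_ e0 isT isT); rewrite -powRrM mulrN mulVf ?lt_eqF// powR_inv1 ?(ltW eps0)//.
by rewrite powRN ltf_pV2 ?posrE ?powR_gt0.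
Unshelve. all: by end_near. Qed.

Lemma continuous_powRr e x : 0 < x -> {for x, continuous (fun z => z `^ e)}.
Proof.
move=> x0; apply: differentiable_continuous; apply/derivable1_diffP.
by have [] := is_derive1_powR e x0.
Qed.

Lemma is_derive_powR_div e x : e != -1 -> 0 < x ->
  is_derive x 1 (fun z => z `^ (e + 1) / (e + 1)) (x `^ e).
Proof.
move=> e1 x0; have e10 : e + 1 != 0 by rewrite addr_eq0.
have D := is_derive1_powR (e + 1) x0.
have -> : (fun z : R => z `^ (e + 1) / (e + 1)) = (e + 1)^-1 *: (@powR R ^~ (e + 1)).
  by apply/funext => z; rewrite fctE /GRing.scale/= mulrC.
have : is_derive x 1 ((e + 1)^-1 *: (@powR R ^~ (e + 1))) ((e + 1)^-1 *: ((e + 1) * x `^ (e + 1 - 1))).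
  exact: is_deriveZ.
by rewrite /GRing.scale/= mulKf// addrK.
Qed.

Lemma integral_powR_0o e t : -1 < e -> 0 < t ->
  (\int[mu]_(x in `]0%R, t[) (x `^ e)%:E = (t `^ (e + 1) / (e + 1))%:E)%E.
Proof.
move=> e1 t0; rewrite -[X in (X)%:E]subr0.
have e10 : 0 < e + 1 by rewrite -ltrBlDr sub0r.
apply: (@ge0_FTC_oo _ _ (fun z => z `^ (e + 1) / (e + 1))) => //.
- by move=> x _; exact: powR_ge0.
- by move=> x /andP[x0 _]; exact: continuous_powRr.
- by move=> x /andP[x0 _]; apply: is_derive_powR_div => //; rewrite gt_eqF.
- rewrite -[X in _ --> X](mul0r (e + 1)^-1); apply: cvgM; last exact: cvg_cst.
  exact: powR_cvg0.
- apply: cvgM; last exact: cvg_cst.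
  by apply: cvg_at_left_filter; exact: continuous_powRr.
Qed.

Lemma integral_powR_oy e t : e < -1 -> 0 < t ->
  (\int[mu]_(x in `]t, +oo[) (x `^ e)%:E = (t `^ (e + 1) / - (e + 1))%:E)%E.
Proof.
move=> e1 t0; have -> : t `^ (e + 1) / - (e + 1) = 0 - t `^ (e + 1) / (e + 1).
  by rewrite invrN mulrN sub0r.
have e10 : e + 1 < 0 by rewrite -ltrBrDr sub0r.
apply: (@ge0_FTC_oy _ _ (fun z => z `^ (e + 1) / (e + 1))) => //.
- by move=> x _; exact: powR_ge0.
- by move=> x tx; apply: continuous_powRr; exact: lt_trans tx.
- by move=> x tx; apply: is_derive_powR_div; rewrite ?lt_eqF//; exact: lt_trans tx.
- apply: cvgM; last exact: cvg_cst.
  by apply: cvg_at_right_filter; exact: continuous_powRr.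
- rewrite -[X in _ --> X](mul0r (e + 1)^-1); apply: cvgM; last exact: cvg_cst.
  exact: powR_cvgy.
Qed.

Lemma measurable_stieltjes_kernel e t : 0 < t ->
  measurable_fun (`]0%R, +oo[ : set R) (fun x : R => x `^ e / (t + x)).
Proof.
move=> t0; apply: open_continuous_measurable_fun; first exact: interval_open.
move=> x /[!inE]/=; rewrite in_itv/= andbT => x0; apply: cvgM; first exact: continuous_powRr.
apply: cvgV; first by rewrite gt_eqF// addr_gt0.
by apply: cvgD; [exact: cvg_cst|exact: cvg_id].
Qed.

(** [(1 + e)^-1] is the integral of [x ^ e / t] over []0, t[] and [(- e)^-1] that of [x ^ (e - 1)]
    over []t, +oo[], both divided by [t ^ e]. *)
Definition stieltjes_bound e : R := (1 + e)^-1 + (- e)^-1.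

Lemma stieltjes_bound_gt0 e : -1 < e < 0 -> 0 < stieltjes_bound e.
Proof.
by move=> /andP[e1 e0]; rewrite addr_gt0// invr_gt0 ?oppr_gt0// -ltrBlDl sub0r.
Qed.

(* Split at [t] and use [1 / (t + x) <= min (1 / t) (1 / x)]. *)
Lemma stieltjes_integral_le e t : -1 < e < 0 -> 0 < t ->
  (\int[mu]_(x in `]0%R, +oo[) (x `^ e / (t + x))%:E <= (stieltjes_bound e * t `^ e)%:E)%E.
Proof.
move=> /andP[e1 e0] t0.
have mk := measurable_stieltjes_kernel e t0.
have ge0 x : 0 < x -> 0 <= x `^ e / (t + x).
  by move=> x0; rewrite divr_ge0 ?powR_ge0// addr_ge0// ltW.
have U : `]0, +oo[%classic = `]0, t] `|` `]t, +oo[ :> set R.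
  by rewrite -itv_bndbnd_setU// bnd_simp ltW.
rewrite U ge0_integral_setU//=; last 3 first.
- by rewrite -U; exact/measurable_EFinP.
- move=> x [] /=; rewrite in_itv/= ?andbT; first by move=> /andP[x0 _]; rewrite lee_fin ge0.
  by move=> tx; rewrite lee_fin ge0// (lt_trans t0).
- apply/disj_setPS => x [] /=; rewrite !in_itv/= andbT => /andP[_ xt] tx; lra.
rewrite /stieltjes_bound mulrDl EFinD; apply: leeD.
- rewrite -integral_itv_bndo_bndc; last first.
    apply/measurable_EFinP; apply: measurable_funS mk => //.
    by apply: subset_itvl; rewrite bnd_simp.
  apply: (@le_trans _ _ (\int[mu]_(x in `]0%R, t[) ((t^-1)%:E * (x `^ e)%:E))%E).
    apply: ge0_le_integral => //=.
    + by move=> x; rewrite in_itv/= => /andP[x0 _]; rewrite lee_fin ge0.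
    + apply/measurable_EFinP; apply: measurable_funS mk => //.
      by apply: subset_itvl; rewrite bnd_simp.
    + by apply/measurable_EFinP; apply: measurable_funM => //; apply: measurable_funTS; exact: measurable_powR.
    + move=> x; rewrite in_itv/= => /andP[x0 xt]; rewrite -EFinM lee_fin mulrC.
      by rewrite ler_wpM2r ?powR_ge0// lef_pV2 ?posrE ?addr_gt0// lerDl ltW.
  rewrite ge0_integralZl//=; last 3 first.
  + by apply/measurable_EFinP; apply: measurable_funTS; exact: measurable_powR.
  + by move=> x _; rewrite lee_fin powR_ge0.
  + by rewrite lee_fin invr_ge0 ltW.
  rewrite integral_powR_0o// -EFinM lee_fin powRD; last by rewrite gt_eqF ?t0 ?implybT// -ltrBlDr sub0r.
  rewrite powRr1 ?(ltW t0)// le_eqVlt; apply/orP; left; apply/eqP.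
  have t0' : t != 0 by rewrite gt_eqF.
  have e1' : 1 + e != 0 by rewrite gt_eqF// -ltrBlDl sub0r.
  by rewrite (addrC e 1); field; rewrite ?t0' ?e1'.
- apply: (@le_trans _ _ (\int[mu]_(x in `]t, +oo[) (x `^ (e - 1))%:E)%E).
    apply: ge0_le_integral => //=.
    + by move=> x; rewrite in_itv/= andbT => tx; rewrite lee_fin ge0// (lt_trans t0).
    + apply/measurable_EFinP; apply: measurable_funS mk => //.
      by apply: subset_itvr; rewrite bnd_simp ltW.
    + by apply/measurable_EFinP; apply: measurable_funTS; exact: measurable_powR.
    + move=> x; rewrite in_itv/= andbT => tx; have x0 := lt_trans t0 tx.
      rewrite lee_fin powRD ?powR_inv1 ?(ltW x0)//; last by rewrite (gt_eqF x0) implybT.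
      by rewrite ler_wpM2l ?powR_ge0// lef_pV2 ?posrE ?addr_gt0// lerDr ltW.
  by rewrite integral_powR_oy// ?subrK ?lee_fin ?(mulrC (- e)^-1)//; lra.
Qed.

Lemma measurable_invr : measurable_fun setT (fun x : R => x^-1).
Proof.
(* [powR] is measurable but agrees with the inverse only on nonnegative reals; squaring handles
   negative [x], and at [0] both sides are [0]. *)
have -> : (fun x : R => x^-1) = (fun x => x * (x ^+ 2) `^ (-1)).
  apply/funext => x; rewrite powR_inv1 ?sqr_ge0//.
  have [->|x0] := eqVneq x 0; first by rewrite invr0 mul0r.
  by rewrite expr2 invfM mulrA mulfV// mul1r.
apply: measurable_funM => //.
apply: (@measurableT_comp _ _ _ _ _ _ (fun x : R => x `^ (-1))); first exact: measurable_powR.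
exact: measurable_funX.
Qed.

Lemma measurable_fun_inv d (T : measurableType d) (f : T -> R) :
  measurable_fun setT f -> measurable_fun setT (fun z => (f z)^-1).
Proof. exact: measurableT_comp measurable_invr. Qed.

Lemma measurable_fun_powR d (T : measurableType d) (f : T -> R) e :
  measurable_fun setT f -> measurable_fun setT (fun z => f z `^ e).
Proof. exact: measurableT_comp (measurable_powR e). Qed.

Lemma measurable_fun_ltr_nat d (T : measurableType d) (f g : T -> R) :
  measurable_fun setT f -> measurable_fun setT g ->
  measurable_fun setT (fun z => (f z < g z)%R%:R : R).
Proof.
move=> mf mg; rewrite (_ : (fun z => _) = \1_[set z | f z < g z]).
  apply: measurable_indic; rewrite -[X in measurable X]setTI.
  by have := measurable_fun_ltr mf mg measurableT (Y := [set true]); apply.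
apply/funext => x; rewrite indicE.
by case: (boolP (f x < g x)) => fg; [rewrite mem_set|rewrite memNset//; exact/negP].
Qed.

End power_integrals.

(** * The profile [mker] and its incomplete integral *)

Section abel_kernels.
Context {R : realType}.
Local Notation mu := (@lebesgue_measure R).
Variable al : R.
Hypothesis al01 : 0 < al < 1.
Implicit Types (t x y z r s b : R).

Let al_gt0 : 0 < al. Proof. by case/andP: al01. Qed.
Let al_lt1 : al < 1. Proof. by case/andP: al01. Qed.

(** The common profile of the kernels to the right of [b]: they depend on the two distances to [b]
    through [mker] of their ratio, up to a rational factor. *)
Definition mker z : R := z `^ (al - 1) / (1 + z).

Lemma mker_ge0 z : 0 <= z -> 0 <= mker z.
Proof. by move=> z0; rewrite divr_ge0 ?powR_ge0// addr_ge0. Qed.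

Lemma mker_gt0 z : 0 < z -> 0 < mker z.
Proof. by move=> z0; rewrite divr_gt0 ?powR_gt0// addr_gt0. Qed.

Lemma continuous_mker z : 0 < z -> {for z, continuous mker}.
Proof.
move=> z0; apply: cvgM; first exact: continuous_powRr.
apply: cvgV; first by rewrite gt_eqF// addr_gt0.
by apply: cvgD; [exact: cvg_cst|exact: cvg_id].
Qed.

Lemma measurable_mker : measurable_fun setT mker.
Proof.
apply: measurable_funM; first exact: measurable_powR.
by apply: measurable_fun_inv; exact: measurable_funD.
Qed.

Lemma mker_integrable : mu.-integrable `]0, +oo[ (EFin \o mker).
Proof.
apply/integrableP; split; first by apply/measurable_EFinP; apply: measurable_funTS; exact: measurable_mker.
have h : -1 < al - 1 < 0 by rewrite ltrBrDr addNr al_gt0 ltrBlDr add0r al_lt1.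
have := stieltjes_integral_le h (@ltr01 R).
move=> /le_lt_trans/(_ (ltry _)); apply: le_lt_trans.
apply: ge0_le_integral => //=.
- apply/measurable_EFinP; apply: measurable_funTS; apply: measurableT_comp => //; exact: measurable_mker.
- by apply/measurable_EFinP; apply: measurable_funTS; exact: measurable_mker.
- by move=> x; rewrite in_itv/= andbT => x0; rewrite ger0_norm// mker_ge0// ltW.
Qed.

Definition mint z : R := \int[mu]_(t in `[0, z]) mker t.
(* Equal to pi / sin (pi al); only its positivity is used. *)
Definition mtot : R := \int[mu]_(t in `]0, +oo[) mker t.

Lemma mker_integrable_cy : mu.-integrable `[0, +oo[ (EFin \o mker).
Proof.
apply/integrableP; split; first by apply/measurable_EFinP; apply: measurable_funTS; exact: measurable_mker.
rewrite -integral_itv_obnd_cbnd; last first.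
  by apply: measurable_funTS; apply: measurableT_comp => //; apply/measurable_EFinP; exact: measurable_mker.
by have /integrableP[] := mker_integrable.
Qed.

Let mker_integrable_cc z : mu.-integrable `[0, z] (EFin \o mker).
Proof.
apply: integrableS mker_integrable_cy => //.
by apply: subset_itvl; rewrite bnd_simp.
Qed.

Lemma is_derive_mint z : 0 < z -> is_derive z 1 mint (mker z).
Proof.
move=> z0; have [|||dz <-] := @continuous_FTC1_closed R mker 0 z (z + 1) _ (mker_integrable_cc _).
- by rewrite ltrDl.
- by [].
- exact: continuous_mker.
- by rewrite derive1E; exact/derivableP.
Qed.

Lemma mint_cvg0 : mint z @[z --> 0] --> (0 : R).
Proof. exact: parameterized_integral_cvg_left ltr01 (mker_integrable_cc 1). Qed.

Lemma mint_cvgy : mint z @[z --> +oo] --> mtot.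
Proof.
apply/cvg_pinftyP => u uoo; apply: fine_cvg.
rewrite fineK; last exact: (integrable_fin_num _ mker_integrable).
rewrite integral_itv_obnd_cbnd; last first.
  by apply: measurable_funTS; apply/measurable_EFinP; exact: measurable_mker.
have E n : (\int[mu]_(t in `[0%R, u n]) (mker t)%:E =
    \int[mu]_(t in `[0%R, +oo[) (mker t * (t <= u n)%R%:R)%:E)%E.
  rewrite integral_mkcond [RHS]integral_mkcond; apply: eq_integral => t _.
  rewrite !patchE !mem_setE !in_itv/= andbT.
  case: (0 <= t) => //=; case: (t <= u n); by rewrite ?mulr1 ?mulr0.
under eq_fun do rewrite E.
have [|||||_ _ H] := @dominated_convergence _ _ R mu `[0, +oo[%classic (measurable_itv _)
  (fun n t => (mker t * (t <= u n)%R%:R)%:E) (EFin \o mker) (EFin \o mker).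
- move=> n; apply/measurable_EFinP; apply: measurable_funTS.
  apply: measurable_funM; first exact: measurable_mker.
  have -> : (fun t => (t <= u n)%R%:R) = (fun t => 1 - (u n < t)%R%:R : R).
    by apply/funext => t; rewrite leNgt; case: (u n < t); rewrite /= ?subr0 ?subrr.
  by apply: measurable_funB => //; exact: measurable_fun_ltr_nat.
- by apply/measurable_EFinP; apply: measurable_funTS; exact: measurable_mker.
- apply: aeW => t /= _; apply: cvg_near_cst.
  have [N _ NH] : \forall n \near \oo, t <= u n by move/cvgryPge : uoo; exact.
  exists N => // n /= /NH /= tn.
  by rewrite tn mulr1.
- exact: mker_integrable_cy.
- apply: aeW => t n /=; rewrite in_itv/= andbT => t0; rewrite lee_fin.
  rewrite ger0_norm; last by apply: mulr_ge0 (mker_ge0 t0) _.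
  by case: (t <= u n); rewrite /= ?mulr1// mulr0 mker_ge0.
- exact: H.
Qed.

(** The mass on [[1, 2]] is already positive: by the mean value theorem it is a value of [mker] at a
    point beyond [1]. *)
Lemma mtot_gt0 : 0 < mtot.
Proof.
have le12 : mint 2 - mint 1 <= mtot.
  have nd z : 1 <= z -> mint z <= mtot.
    move=> z1; rewrite /mint /mtot Rintegral_itv_obnd_cbnd; last exact: mker_integrable.
    rewrite Rintegral_mkcond [leRHS]Rintegral_mkcond; apply: le_Rintegral => //.
    - by rewrite -restrict_EFin; apply/integrable_restrict => //=; rewrite setTI.
    - by rewrite -restrict_EFin; apply/integrable_restrict => //=; rewrite setTI; exact: mker_integrable_cy.
    - move=> t _; rewrite !patchE !mem_setE !in_itv/= andbT; case: (ltrP t 0) => //= t0.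
      by case: ifPn => // _; exact: mker_ge0.
  apply: (le_trans _ (nd 2 _)); last by rewrite ler1n.
  by rewrite lerBlDr lerDl; apply: Rintegral_ge0 => t /=; rewrite in_itv/= => /andP[t0 _]; exact: mker_ge0.
apply: lt_le_trans le12; rewrite subr_gt0.
have d1 x : 1 <= x -> is_derive x 1 mint (mker x).
  by move=> x1; apply: is_derive_mint; exact: lt_le_trans x1.
have [|||c c12 E] := @MVT _ mint mker 1 2.
- by rewrite ltr1n.
- by move=> x; rewrite in_itv/= => /andP[/ltW x1 _]; exact: d1.
- apply: continuous_within_cc => x /andP[x1 _].
  by apply: differentiable_continuous; apply/derivable1_diffP; have [] := d1 x x1.
move: c12; rewrite in_itv/= => /andP[c1 _].
rewrite -subr_gt0 E mulr_gt0 ?subr_gt0 ?ltr1n//; apply: mker_gt0.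
exact: lt_trans c1.
Qed.

End abel_kernels.

(** * Sweeping identities for Abel kernels *)

Section abel_identities.
Context {R : realType}.
Local Notation mu := (@lebesgue_measure R).
Variable al : R.
Hypothesis al01 : 0 < al < 1.
Implicit Types (t x y z r s b : R).

Local Notation mker := (mker al).
Local Notation mint := (mint al).
Local Notation mtot := (mtot al).

(** The factor cuts off negative arguments, where [powR] does not vanish. The kernel is thus causal
    and can be integrated over the whole line. *)
Definition abel z : R := (0 < z)%R%:R * z `^ (- al).

(** For [s < b < x] this is [((x - b) / (b - s)) ^ (1 - al) / (x - s)], the Poisson (balayage)
    kernel of the half-line below [b] for Abel potentials, up to its total mass [mtot]. *)
Definition sker b x s : R := mker ((b - s) / (x - b)) / (x - b).

(** Minus the derivative in [x] of [mint ((b - r) / (x - b))], the mass of [sker b x] on []r, b[];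
    [bkerE] gives the closed form. *)
Definition bker b x r : R := mker ((b - r) / (x - b)) * ((b - r) / (x - b) ^+ 2).

Lemma abel_ge0 z : 0 <= abel z.
Proof. by rewrite mulr_ge0// powR_ge0. Qed.

Lemma abelE z : 0 < z -> abel z = z `^ (- al).
Proof. by rewrite /abel => ->; rewrite mul1r. Qed.

Lemma abel_le0 z : z <= 0 -> abel z = 0.
Proof. by rewrite /abel leNgt => /negbTE ->; rewrite mul0r. Qed.

Lemma measurable_abel : measurable_fun setT abel.
Proof.
apply: measurable_funM; last exact: measurable_powR.
exact: measurable_fun_ltr_nat.
Qed.

Lemma powRV t e : 0 <= t -> t^-1 `^ e = t `^ (- e).
Proof. by move=> t0; rewrite -powR_inv1// -powRrM mulN1r. Qed.

Lemma bkerE b x r : r < b -> b < x ->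
  bker b x r = (b - r) `^ al * (x - b) `^ (- al) / (x - r).
Proof.
move=> rb bx; have r0 : 0 < b - r by rewrite subr_gt0.
have x0 : 0 < x - b by rewrite subr_gt0.
have z0 : 0 < (b - r) / (x - b) by rewrite divr_gt0.
rewrite /bker /mker -powRV ?(ltW x0)// -powRM ?invr_ge0 ?ltW//.
have -> : ((b - r) / (x - b)) `^ al = ((b - r) / (x - b)) `^ (al - 1) * ((b - r) / (x - b)).
  by rewrite -[X in _ = _ * X](powRr1 (ltW z0)) -powRD ?subrK// (gt_eqF z0) implybT.
have xr : 0 < x - r by rewrite subr_gt0 (lt_trans rb).
have -> : 1 + (b - r) / (x - b) = (x - r) / (x - b) by field; rewrite gt_eqF.
by field; rewrite !gt_eqF.
Qed.

Lemma sker_ge0 b x s : s <= b -> b < x -> 0 <= sker b x s.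
Proof.
move=> sb bx; rewrite divr_ge0 ?subr_ge0 ?(ltW bx)//; apply: mker_ge0 => //.
by rewrite divr_ge0 ?subr_ge0// ltW.
Qed.

Lemma bker_ge0 b x r : r <= b -> b < x -> 0 <= bker b x r.
Proof.
move=> rb bx; rewrite mulr_ge0//; last by rewrite divr_ge0 ?sqr_ge0// subr_ge0.
by apply: mker_ge0; rewrite // divr_ge0 ?subr_ge0// ltW.
Qed.

Lemma measurable_sker b : measurable_fun setT (fun z : R * R => sker b z.1 z.2).
Proof.
have m1 : measurable_fun setT (fun z : R * R => z.1 - b) by exact: measurable_funB.
apply: measurable_funM; last exact: measurable_fun_inv.
apply: measurableT_comp; first exact: measurable_mker.
apply: measurable_funM; last exact: measurable_fun_inv.
exact: measurable_funB.
Qed.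

Lemma measurable_bker b : measurable_fun setT (fun z : R * R => bker b z.1 z.2).
Proof.
have m1 : measurable_fun setT (fun z : R * R => z.1 - b) by exact: measurable_funB.
have m2 : measurable_fun setT (fun z : R * R => b - z.2) by exact: measurable_funB.
apply: measurable_funM.
  apply: measurableT_comp; first exact: measurable_mker.
  by apply: measurable_funM => //; exact: measurable_fun_inv.
apply: measurable_funM => //; apply: measurable_fun_inv; exact: measurable_funX.
Qed.

Let mint_seq0 (v : R^nat) : v n @[n --> \oo] --> 0 -> mint (v n) @[n --> \oo] --> 0.
Proof. by move=> cv; apply: (cvg_comp _ _ cv); exact: mint_cvg0. Qed.

Let mint_seqy (v : R^nat) : v n @[n --> \oo] --> +oo -> mint (v n) @[n --> \oo] --> mtot.
Proof. by move=> cv; have /cvg_pinftyP := mint_cvgy al01; apply. Qed.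

Lemma continuous_mint z : 0 < z -> {for z, continuous mint}.
Proof.
move=> z0; apply: differentiable_continuous; apply/derivable1_diffP.
by have [] := is_derive_mint al01 z0.
Qed.

(** Every antiderivative used below has the shape [- (c * mint (g s))], hence the [1 *] that appears
    where the constant is trivial. *)
Let dmint (g : R -> R) (c s dg : R) : 0 < g s -> is_derive s 1 g dg ->
  is_derive s 1 (fun s => - (c * mint (g s))) (- (c * (mker (g s) * dg))).
Proof.
move=> gs dgs; have D := is_derive1_comp (is_derive_mint al01 gs) dgs.
have -> : (fun s => - (c * mint (g s))) = - (c *: (mint \o g)) by [].
have : is_derive s 1 (- (c *: (mint \o g))) (- (c *: (mker (g s) * dg))).
  exact: is_deriveN.
by [].
Qed.

Let didB s b : is_derive s 1 (fun s : R => b - s) (-1).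
Proof.
have -> : (fun s : R => b - s) = cst b - id by [].
have : is_derive s (1 : R) (cst b - (@id R)) (0 - 1) by exact: is_deriveB.
by rewrite sub0r.
Qed.

Let didBr s b : is_derive s 1 (fun s : R => s - b) 1.
Proof.
have -> : (fun s : R => s - b) = id - cst b by [].
have : is_derive s (1 : R) ((@id R) - cst b) (1 - 0) by exact: is_deriveB.
by rewrite subr0.
Qed.

Let dfrac s b c : is_derive s 1 (fun s : R => (b - s) / c) (- c^-1).
Proof.
have -> : (fun s : R => (b - s) / c) = c^-1 *: (fun s : R => b - s).
  by apply/funext => z; rewrite fctE /GRing.scale/= mulrC.
have : is_derive s 1 (c^-1 *: (fun s : R => b - s)) (c^-1 *: -1) by exact: is_deriveZ.
by rewrite /GRing.scale/= mulrN1.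
Qed.

Let dinv s b c : s != b -> is_derive s 1 (fun s : R => c / (s - b)) (- (c / (s - b) ^+ 2)).
Proof.
move=> sb; have -> : (fun s : R => c / (s - b)) = c *: (fun s : R => (s - b)^-1) by [].
have D : is_derive s 1 (fun s : R => (s - b)^-1) (- (s - b) ^- 2 *: 1).
  by apply: (@is_deriveV _ (fun s : R => s - b)); rewrite ?subr_eq0.
have : is_derive s 1 (c *: (fun s : R => (s - b)^-1)) (c *: (- (s - b) ^- 2 *: 1)).
  exact: is_deriveZ.
by rewrite /GRing.scale/= mulr1 mulrN.
Qed.

Let cfrac (b c : R) (u : R^nat) (l : R) : u n @[n --> \oo] --> l ->
  (b - u n) / c @[n --> \oo] --> (b - l) / c.
Proof.
move=> ul; apply: cvgM; last exact: cvg_cst.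
by apply: cvgB => //; exact: cvg_cst.
Qed.

Lemma integral_sker b x r : r < b -> b < x ->
  (\int[mu]_(s in `]r, b[) (sker b x s)%:E)%E = (mint ((b - r) / (x - b)))%:E.
Proof.
move=> rb bx; have x0 : 0 < x - b by rewrite subr_gt0.
have pos s : s < b -> 0 < (b - s) / (x - b) by move=> sb; rewrite divr_gt0 ?subr_gt0.
have -> : mint ((b - r) / (x - b)) = 0 - - (1 * mint ((b - r) / (x - b))).
  by rewrite mul1r sub0r opprK.
apply: (@ge0_FTC_oo _ _ (fun s => - (1 * mint ((b - s) / (x - b))))) => //.
- by move=> s /andP[_ sb]; rewrite sker_ge0// ltW.
- move=> s /andP[_ sb]; apply: cvgM; last exact: cvg_cst.
  apply: (@continuous_comp _ _ _ (fun s => (b - s) / (x - b)) mker).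
    by apply: cvgM; [apply: cvgB; [exact: cvg_cst|exact: cvg_id]|exact: cvg_cst].
  by apply: continuous_mker => //; exact: pos.
- move=> s /andP[_ sb].
  have := @dmint (fun s => (b - s) / (x - b)) 1 s _ (pos s sb) (dfrac s b (x - b)).
  by rewrite !mul1r mulrN opprK.
- apply/cvg_at_rightP => u [ru cu]; apply: cvgN; apply: cvgM; first exact: cvg_cst.
  apply: (@cvg_comp _ _ _ (fun n => (b - u n) / (x - b)) mint); first exact: cfrac cu.
  by apply: continuous_mint; exact: pos.
- apply/cvg_at_leftP => u [ub cu]; have -> : (0 : R) = - (1 * 0) by rewrite mulr0 oppr0.
  apply: cvgN; apply: cvgM; first exact: cvg_cst.
  apply: mint_seq0.
  by have := @cfrac b (x - b) _ _ cu; rewrite subrr mul0r.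
Qed.

Let cinv (b c : R) (u : R^nat) (l : R) : l != b -> u n @[n --> \oo] --> l ->
  c / (u n - b) @[n --> \oo] --> c / (l - b).
Proof.
move=> lb ul; apply: cvgM; first exact: cvg_cst.
apply: cvgV; first by rewrite subr_eq0.
by apply: cvgB => //; exact: cvg_cst.
Qed.

Let continuous_bker b x r : r < b -> b < x -> {for x, continuous (fun x => bker b x r)}.
Proof.
move=> rb bx; have x0 : x - b != 0 by rewrite subr_eq0 gt_eqF.
have cx : (fun z => z - b) @ x --> x - b by apply: cvgB; [exact: cvg_id|exact: cvg_cst].
apply: cvgM.
  apply: (@continuous_comp _ _ _ (fun x => (b - r) / (x - b)) mker).
    by apply: cvgM; [exact: cvg_cst|exact: cvgV].
  by apply: continuous_mker => //; rewrite divr_gt0// subr_gt0.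
apply: cvgM; first exact: cvg_cst.
apply: cvgV; first by rewrite expf_neq0.
by rewrite expr2; under eq_fun do rewrite expr2; exact: cvgM.
Qed.

Let dbker b x r : r < b -> b < x ->
  is_derive x 1 (fun x => - (1 * mint ((b - r) / (x - b)))) (bker b x r).
Proof.
move=> rb bx; have pos : 0 < (b - r) / (x - b) by rewrite divr_gt0// subr_gt0.
have xb : x != b by rewrite gt_eqF.
have := @dmint (fun x => (b - r) / (x - b)) 1 x _ pos (dinv (b - r) xb).
by rewrite !mul1r mulrN opprK.
Qed.

Let bker_cvgy b r : - (1 * mint ((b - r) / (x - b))) @[x --> +oo] --> (0 : R).
Proof.
apply/cvg_pinftyP => u uoo; have -> : (0 : R) = - (1 * 0) by rewrite mulr0 oppr0.
apply: cvgN; apply: cvgM; first exact: cvg_cst.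
apply: mint_seq0; rewrite -[X in _ --> X](mulr0 (b - r)).
apply: cvgM; first exact: cvg_cst.
have ub : (fun n => u n - b) @ \oo --> +oo.
  apply/cvgryPge => A; have [N _ NH] : \forall n \near \oo, A + b <= u n by move/cvgryPge : uoo; exact.
  by exists N => // n /= /NH /=; rewrite lerBrDr.
apply: (gtr0_cvgV0 _).2 ub.
have [N _ NH] : \forall n \near \oo, b + 1 <= u n by move/cvgryPge : uoo; exact.
by exists N => // n /= /NH /=; rewrite subr_gt0; apply: lt_le_trans; rewrite ltrDl.
Qed.

Lemma integral_bker b x r : r < b -> b < x ->
  (\int[mu]_(t in `]x, +oo[) (bker b t r)%:E)%E = (mint ((b - r) / (x - b)))%:E.
Proof.
move=> rb bx.
have -> : mint ((b - r) / (x - b)) = 0 - - (1 * mint ((b - r) / (x - b))).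
  by rewrite mul1r sub0r opprK.
apply: (@ge0_FTC_oy _ _ (fun t => - (1 * mint ((b - r) / (t - b))))).
- by move=> t xt; rewrite bker_ge0// ?ltW// (lt_trans bx).
- by move=> t xt; apply: continuous_bker => //; exact: lt_trans xt.
- by move=> t xt; apply: dbker => //; exact: lt_trans xt.
- apply/cvg_at_rightP => u [ru cu]; apply: cvgN; apply: cvgM; first exact: cvg_cst.
  have xb : x != b by rewrite gt_eqF.
  have pos : 0 < (b - r) / (x - b) by rewrite divr_gt0// subr_gt0.
  by apply: continuous_cvg; [exact: continuous_mint|exact: cinv].
- exact: bker_cvgy.
Qed.

(** As [t] decreases to [b] the ratio [(b - r) / (t - b)] blows up, so [mint] of it tends to [mtot].
    That this mass does not depend on [r] is what cancels the boundary terms at [b] in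
    [extension_identity]. *)
Lemma integral_bker_total b r : r < b ->
  (\int[mu]_(t in `]b, +oo[) (bker b t r)%:E)%E = mtot%:E.
Proof.
move=> rb; have -> : mtot = 0 - - (1 * mtot) by rewrite mul1r sub0r opprK.
apply: (@ge0_FTC_oy _ _ (fun t => - (1 * mint ((b - r) / (t - b))))).
- by move=> t xt; rewrite bker_ge0// ltW.
- by move=> t xt; exact: continuous_bker.
- by move=> t xt; exact: dbker.
- apply/cvg_at_rightP => u [ru cu]; apply: cvgN; apply: cvgM; first exact: cvg_cst.
  apply: mint_seqy.
  have pos n : 0 < (b - r) / (u n - b) by rewrite divr_gt0// subr_gt0.
  apply/gtr0_cvgV0; first exact: nearW.
  suff : (u n - b) / (b - r) @[n --> \oo] --> 0.
    by apply: cvg_trans; apply: near_eq_cvg; apply: nearW => n; rewrite /unstable.inv_fun/= invf_div.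
  rewrite -[X in _ --> X](mul0r (b - r)^-1); apply: cvgM; last exact: cvg_cst.
  by rewrite -(subrr b); apply: cvgB => //; exact: cvg_cst.
- exact: bker_cvgy.
Qed.

(* Sweeping: the value of an Abel integral at [x > b] is the [sker b x]-average of
   its values below [b].  The integrand has the antiderivative
   [- (x - y) ^ (- al) * mint ((x - y) (b - s) / ((x - b) (s - y)))]. *)
Lemma integral_abel_sker b x y : y < b -> b < x ->
  (\int[mu]_(s in `]y, b[) (abel (s - y) * sker b x s)%:E)%E = (mtot * abel (x - y))%:E.
Proof.
move=> yb bx.
have x0 : 0 < x - b by rewrite subr_gt0.
have b0 : 0 < b - y by rewrite subr_gt0.
have xy0 : 0 < x - y by rewrite subr_gt0 (lt_trans yb).
pose c := (x - y) `^ (- al).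
pose g s := (x - y) * ((b - s) / (x - b)) / (s - y).
have pos s : y < s -> s < b -> 0 < g s.
  by move=> ys sb; rewrite /g divr_gt0 ?subr_gt0// mulr_gt0// divr_gt0// subr_gt0.
rewrite abelE//.
(* [g] tends to [+oo] at [y] and to [0] at [b], so these are the two limits of the
   antiderivative. *)
have -> : mtot * (x - y) `^ (- al) = - (c * 0) - - (c * mtot) by rewrite mulr0 oppr0 sub0r opprK mulrC.
have dg s : y < s -> s < b -> is_derive s 1 g (- ((x - y) * (b - y) / ((x - b) * (s - y) ^+ 2))).
  move=> ys sb; have sy : s != y by rewrite gt_eqF.
  have D1 : is_derive s 1 (fun s : R => (x - y) * ((b - s) / (x - b))) ((x - y) *: (- (x - b)^-1)).
    exact: (@is_deriveZ _ _ _ (fun s : R => (b - s) / (x - b))).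
  have := @is_deriveM _ _ (fun s : R => (x - y) * ((b - s) / (x - b))) (fun s => 1 / (s - y)) _ _ _ _ D1 (dinv 1 sy).
  rewrite /GRing.scale/=.
  have -> : (fun s : R => (x - y) * ((b - s) / (x - b))) * (fun s => 1 / (s - y)) = g.
    by apply/funext => z; rewrite fctE /g div1r.
  have sy0 : s - y != 0 by rewrite subr_eq0.
  have xb0 : x - b != 0 by rewrite gt_eqF.
  congr (is_derive _ _ _ _).
  by field; rewrite sy0 xb0.
apply: (@ge0_FTC_oo _ _ (fun s => - (c * mint (g s)))) => //.
- by move=> s /andP[ys sb]; rewrite mulr_ge0 ?abel_ge0// sker_ge0// ltW.
- move=> s /andP[ys sb].
  have near_E : \forall z \near s, (z - y) `^ (- al) * sker b x z = abel (z - y) * sker b x z.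
    near=> z; rewrite abelE// subr_gt0; near: z; exact: lt_nbhsr.
  have E := nbhs_singleton near_E.
  change (abel (z - y) * sker b x z @[z --> s] --> abel (s - y) * sker b x s).
  rewrite -E; apply: cvg_trans; first exact: (near_eq_cvg near_E).
  apply: cvgM.
    apply: (@cvg_comp _ _ _ (fun z => z - y) (fun z => z `^ (- al))).
      by apply: cvgB; [exact: cvg_id|exact: cvg_cst].
    by apply: continuous_powRr; rewrite subr_gt0.
  apply: cvgM; last exact: cvg_cst.
  apply: (@cvg_comp _ _ _ (fun s => (b - s) / (x - b)) mker).
    by apply: cvgM; [apply: cvgB; [exact: cvg_cst|exact: cvg_id]|exact: cvg_cst].
  by apply: continuous_mker => //; rewrite divr_gt0// subr_gt0.
- move=> s /andP[ys sb].
  have := @dmint g c s _ (pos _ ys sb) (dg _ ys sb).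
  have s0 : 0 < s - y by rewrite subr_gt0.
  have bs0 : 0 < b - s by rewrite subr_gt0.
  have xs0 : 0 < x - s by rewrite subr_gt0 (lt_trans sb).
  have bsx : 0 < (b - s) / (x - b) by rewrite divr_gt0.
  congr (is_derive _ _ _ _).
  rewrite abelE// /sker /mker /g.
  (* This factorization makes the substitution work: its factor [b - y] cancels the one in the
     derivative of [g]. *)
  have -> : 1 + (x - y) * ((b - s) / (x - b)) / (s - y) = (x - s) * (b - y) / ((x - b) * (s - y)).
    by field; rewrite !gt_eqF.
  have -> : 1 + (b - s) / (x - b) = (x - s) / (x - b) by field; rewrite gt_eqF.
  rewrite powRM ?invr_ge0 ?(ltW s0) ?(mulr_ge0 (ltW xy0) (ltW bsx))// powRM ?(ltW bsx) ?(ltW xy0)//.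
  rewrite powRV ?(ltW s0)// opprB.
  have -> : (s - y) `^ (1 - al) = (s - y) * (s - y) `^ (- al).
    by rewrite -[X in _ = X * _](powRr1 (ltW s0)) -powRD// (gt_eqF s0) implybT.
  have C1 : c * (x - y) `^ (al - 1) * (x - y) = 1.
    rewrite /c -[X in _ * X](powRr1 (ltW xy0)) -!powRD ?(gt_eqF xy0) ?implybT//.
    by rewrite addrA addNr sub0r addNr powRr0.
  rewrite -[RHS]mul1r -[X in _ = X * _]C1.
  by field; rewrite !gt_eqF.
- apply/cvg_at_rightP => u [ru cu]; apply: cvgN; apply: cvgM; first exact: cvg_cst.
  have u2 : \forall n \near \oo, u n < b by apply: (cvgr_lt _ cu).
  apply: mint_seqy; rewrite /g.
  apply/gtr0_cvgV0.
    by apply: filterS u2 => n unb; apply: pos.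
  suff : (u n - y) * ((x - y) * ((b - u n) / (x - b)))^-1 @[n --> \oo] --> 0.
    by apply: cvg_trans; apply: near_eq_cvg; apply: nearW => n; rewrite /unstable.inv_fun/= invf_div.
  rewrite -[X in _ --> X](mul0r ((x - y) * ((b - y) / (x - b)))^-1).
  apply: cvgM; first by rewrite -(subrr y); apply: cvgB => //; exact: cvg_cst.
  apply: cvgV; first by rewrite gt_eqF// mulr_gt0// divr_gt0.
  by apply: cvgM; [exact: cvg_cst|exact: cfrac].
- apply/cvg_at_leftP => u [ub cu]; apply: cvgN; apply: cvgM; first exact: cvg_cst.
  apply: mint_seq0; rewrite /g.
  have -> : 0 = (x - y) * ((b - b) / (x - b)) / (b - y) by rewrite subrr mul0r mulr0 mul0r.
  apply: cvgM; first by apply: cvgM; [exact: cvg_cst|exact: cfrac].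
  apply: cvgV; first by rewrite gt_eqF.
  by apply: cvgB => //; exact: cvg_cst.
Unshelve. all: by end_near. Qed.

End abel_identities.

(** * Exchange and [L^1] bounds for kernels on subsets of the line *)

Section lebesgue_kernels.
Context {R : realType}.
Local Notation mu := (@lebesgue_measure R).
Implicit Types (D E : set R) (f g u v : R -> R) (h : R -> R -> R).

Lemma lebesgue_RintegralZl D f (k : R) : measurable D -> mu.-integrable D (EFin \o f) ->
  \int[mu]_(x in D) (k * f x) = k * \int[mu]_(x in D) f x.
Proof. by move=> mD iF; rewrite RintegralZl. Qed.

Lemma lebesgue_integrableS D E f : measurable D -> measurable E -> D `<=` E ->
  mu.-integrable E (EFin \o f) -> mu.-integrable D (EFin \o f).
Proof. by move=> mD mE DE; exact: integrableS. Qed.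

Lemma patchMl D f g x : (f \_ D) x * g x = ((fun x => f x * g x) \_ D) x.
Proof. by rewrite !patchE; case: ifPn => // _; rewrite mul0r. Qed.

Lemma integrable_patch D f : measurable D ->
  mu.-integrable setT (EFin \o (f \_ D)) <-> mu.-integrable D (EFin \o f).
Proof.
move=> mD; rewrite -restrict_EFin; split.
  by move=> /(@integrable_restrict _ _ _ mu D mD setT measurableT); rewrite setTI.
by move=> iF; apply/(@integrable_restrict _ _ _ mu D mD setT measurableT); rewrite setTI.
Qed.

Lemma normr_Rintegral_le D f : measurable D -> measurable_fun D f ->
  (`|\int[mu]_(x in D) f x|%:E <= \int[mu]_(x in D) `|f x|%:E)%E.
Proof.
move=> mD mf; have mf' : measurable_fun D (EFin \o f) by exact/measurable_EFinP.
apply: le_trans (le_abse_integral mu mD mf'); rewrite /Rintegral.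
by case: (\int[mu]_(x in D) _)%E => [r| |] //=; rewrite normr0 leey.
Qed.

Lemma kernel_swap_integrable D E v g h (C : R) : measurable D -> measurable E ->
  mu.-integrable E (EFin \o v) -> measurable_fun D g ->
  measurable_fun setT (fun z : R * R => h z.1 z.2) ->
  (forall r, E r -> (\int[mu]_(x in D) `|g x * h x r|%:E <= C%:E)%E) ->
  mu.-integrable E (fun r => (v r * \int[mu]_(x in D) (g x * h x r))%:E).
Proof.
move=> mD mE iv mg mh hC.
have mg0 : measurable_fun setT (g \_ D) by exact/(measurable_restrictT _ mD).
have mk : measurable_fun setT (fun z : R * R => (g \_ D) z.2 * h z.2 z.1).
  apply: measurable_funM; first exact: measurableT_comp.
  have ms : measurable_fun setT (fun z : R * R => (z.2, z.1)) by exact: measurable_fun_pair.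
  exact: (measurableT_comp mh ms).
have mI := @measurable_Rintegral_kernel _ _ _ _ R mu (fun r x : R => (g \_ D) x * h x r) mk.
apply: (integrable_boundedM (C := C) mE iv).
  apply: measurable_funTS; move: mI; congr (measurable_fun _ _); apply/funext => r.
  by rewrite [RHS]Rintegral_mkcond; apply: eq_Rintegral => x _; rewrite (patchMl D g (fun x => h x r)).
move=> r /hC; rewrite -lee_fin; apply: le_trans; apply: normr_Rintegral_le => //.
apply: measurable_funM => //; apply: measurable_funTS.
exact: (measurableT_comp mh (pair2_measurable r)).
Qed.

(** Obtained from the whole line by patching [g] and [v] with zero outside [D] and [E]. *)
Lemma kernel_swap_in D E v g h (C : R) : measurable D -> measurable E ->
  mu.-integrable E (EFin \o v) -> measurable_fun D g ->
  measurable_fun setT (fun z : R * R => h z.1 z.2) ->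
  (forall r, E r -> (\int[mu]_(x in D) `|g x * h x r|%:E <= C%:E)%E) ->
  mu.-integrable D (fun x => (g x * \int[mu]_(r in E) (v r * h x r))%:E) /\
  \int[mu]_(x in D) (g x * \int[mu]_(r in E) (v r * h x r)) =
  \int[mu]_(r in E) (v r * \int[mu]_(x in D) (g x * h x r)).
Proof.
move=> mD mE iv mg mh hC.
have iv0 : mu.-integrable setT (EFin \o (v \_ E)) by exact/integrable_patch.
have mg0 : measurable_fun setT (g \_ D) by exact/(measurable_restrictT _ mD).
have hC0 r : (v \_ E) r != 0 -> (\int[mu]_x `|(g \_ D) x * h x r|%:E <= C%:E)%E.
  rewrite patchE; case: ifPn => [/[!inE] Er _|]; last by rewrite eqxx.
  have := hC r Er; rewrite integral_mkcond; congr (_ <= _)%E; apply: eq_integral => x _.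
  by rewrite !patchE; case: ifPn => // _; rewrite mul0r normr0.
have [i1 E1] := @kernel_swap _ _ _ _ R mu mu (v \_ E) (g \_ D) h C iv0 mg0 mh hC0.
have inE' x : \int[mu]_r ((v \_ E) r * h x r) = \int[mu]_(r in E) (v r * h x r).
  by rewrite [RHS]Rintegral_mkcond; apply: eq_Rintegral => r _; rewrite patchMl.
split.
  apply/(integrable_patch _ mD); move: i1; apply: eq_integrable => // x _.
  by congr EFin; rewrite inE' (patchMl D g (fun x => \int[mu]_(r in E) (v r * h x r))).
rewrite Rintegral_mkcond [RHS]Rintegral_mkcond.
transitivity (\int[mu]_x ((g \_ D) x * \int[mu]_r ((v \_ E) r * h x r))).
  by apply: eq_Rintegral => x _; rewrite inE' (patchMl D g (fun x => \int[mu]_(r in E) (v r * h x r))).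
rewrite E1; apply: eq_Rintegral => r _; rewrite -(patchMl E v (fun r => \int[mu]_(x in D) (g x * h x r))); congr (_ * _).
by rewrite [RHS]Rintegral_mkcond; apply: eq_Rintegral => x _; rewrite (patchMl D g (fun x => h x r)).
Qed.

Lemma measurable_kernel_in E v h : measurable E -> measurable_fun E v ->
  measurable_fun setT (fun z : R * R => h z.1 z.2) ->
  measurable_fun setT (fun x => \int[mu]_(r in E) (v r * h x r)).
Proof.
move=> mE mv mh; have mv0 : measurable_fun setT (v \_ E) by exact/(measurable_restrictT _ mE).
have mvh : measurable_fun setT (fun z : R * R => (v \_ E) z.2 * h z.1 z.2).
  by apply: measurable_funM => //; exact: measurableT_comp.
have := @measurable_Rintegral_kernel _ _ _ _ R mu (fun x r : R => (v \_ E) r * h x r) mvh.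
congr (measurable_fun _ _); apply/funext => x; rewrite [RHS]Rintegral_mkcond.
by apply: eq_Rintegral => r _; rewrite patchMl.
Qed.

(** The column half of a Schur test: by Tonelli, a uniform bound on the integrals of [h] in [x]
    bounds the operator on [L^1]. *)
Lemma integral_kernel_le D E v h (C : R) : measurable D -> measurable E ->
  measurable_fun E v -> measurable_fun setT (fun z : R * R => h z.1 z.2) ->
  (forall r, E r -> (\int[mu]_(x in D) `|h x r|%:E <= C%:E)%E) -> 0 <= C ->
  (\int[mu]_(x in D) `|\int[mu]_(r in E) (v r * h x r)|%:E <=
   C%:E * \int[mu]_(r in E) `|v r|%:E)%E.
Proof.
move=> mD mE mv mh hC C0.
pose H x r := (\1_D x * `|(v \_ E) r * h x r|) : R.
have mv0 : measurable_fun setT (v \_ E) by exact/(measurable_restrictT _ mE).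
have mvh : measurable_fun setT (fun z : R * R => (v \_ E) z.2 * h z.1 z.2).
  by apply: measurable_funM => //; exact: measurableT_comp.
have mH : measurable_fun setT (fun z : R * R => (H z.1 z.2)%:E).
  apply/measurable_EFinP; apply: measurable_funM.
    by apply: measurableT_comp => //; exact: measurable_indic.
  exact: measurableT_comp.
have H0 z : (0 <= (H z.1 z.2)%:E)%E by rewrite lee_fin mulr_ge0.
have inner x : (`|\int[mu]_(r in E) (v r * h x r)|%:E <= \int[mu]_r `|(v \_ E) r * h x r|%:E)%E.
  rewrite Rintegral_mkcond.
  have -> : (fun r => v r * h x r) \_ E = (fun r => (v \_ E) r * h x r).
    by apply/funext => r; rewrite patchMl.
  apply: normr_Rintegral_le => //.
  exact: (measurableT_comp mvh (pair1_measurable x)).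
have mI := measurable_kernel_in mE mv mh.
apply: (@le_trans _ _ (\int[mu]_x \int[mu]_r (H x r)%:E)%E).
  rewrite integral_mkcond; apply: ge0_le_integral => //.
  - by move=> x _; rewrite patchE; case: ifPn.
  - apply/(measurable_restrictT _ mD); apply/measurable_EFinP.
    by apply: measurable_funTS; exact: measurableT_comp.
  - exact: (@measurable_fun_fubini_tonelli_F _ _ _ _ R mu (fun z => (H z.1 z.2)%:E) mH H0).
  - move=> x _; rewrite patchE; case: ifPn => [xD|_]; last by apply: integral_ge0 => r _; exact: (H0 (x, r)).
    apply: (le_trans (inner x)); rewrite le_eqVlt; apply/orP; left; apply/eqP.
    by apply: eq_integral => r _; rewrite /H indicE xD mul1r.
have -> : (\int[mu]_x \int[mu]_r (H x r)%:E)%E = (\int[mu]_r \int[mu]_x (H x r)%:E)%E.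
  exact: (@fubini_tonelli _ _ _ _ R mu mu (fun z => (H z.1 z.2)%:E) mH H0).
rewrite [X in (_ <= _ * X)%E]integral_mkcond -ge0_integralZl//; last 2 first.
- by apply/(measurable_restrictT _ mE); apply/measurable_EFinP; exact: measurableT_comp.
- by move=> r _; rewrite patchE; case: ifPn.
apply: ge0_le_integral => //.
- by move=> r _; apply: integral_ge0 => x _; exact: (H0 (x, r)).
- exact: (@measurable_fun_fubini_tonelli_G _ _ _ _ R mu (fun z => (H z.1 z.2)%:E) mH H0).
- apply: measurable_funeM; apply/(measurable_restrictT _ mE); apply/measurable_EFinP.
  exact: measurableT_comp.
- move=> r _; rewrite patchE; case: ifPn => rE; last first.
    rewrite mule0 integral0_eq// => x _.
    by rewrite /H patchE (negbTE rE) mul0r normr0 mulr0.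
  rewrite (_ : (\int[mu]_x _)%E = (`|v r|%:E * \int[mu]_(x in D) `|h x r|%:E)%E).
    by rewrite muleC lee_wpmul2r//; apply: hC; exact/set_mem.
  rewrite -ge0_integralZl//=; last first.
    apply/measurable_EFinP; apply: measurable_funTS; apply: measurableT_comp => //.
    exact: (measurableT_comp mh (pair2_measurable r)).
  rewrite [RHS]integral_mkcond; apply: eq_integral => x _.
  rewrite /H !patchE rE indicE; case: ifPn => xD; rewrite ?mul0r// mul1r normrM//.
Qed.

Lemma integrable_kernel D E v h (C : R) : measurable D -> measurable E ->
  mu.-integrable E (EFin \o v) -> measurable_fun setT (fun z : R * R => h z.1 z.2) ->
  (forall r, E r -> (\int[mu]_(x in D) `|h x r|%:E <= C%:E)%E) -> 0 <= C ->
  mu.-integrable D (fun x => (\int[mu]_(r in E) (v r * h x r))%:E).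
Proof.
move=> mD mE /integrableP[/measurable_EFinP mv iv] mh hC C0; apply/integrableP; split.
  by apply/measurable_EFinP; apply: measurable_funTS; exact: measurable_kernel_in.
apply: le_lt_trans (integral_kernel_le mD mE mv mh hC C0) _.
by apply: lte_mul_pinfty => //; rewrite lee_fin.
Qed.

End lebesgue_kernels.

(** * The weak equation inside the interval *)

Section fractional_derivative.
Context {R : realType}.
Local Notation mu := (@lebesgue_measure R).
Variable al : R.
Hypothesis al01 : 0 < al < 1.
Implicit Types (phi u v : R -> R).

Local Notation abel := (abel al).

Lemma integral_abel (L : R) : 0 < L ->
  (\int[mu]_x (abel x * (x < L)%R%:R)%:E = (L `^ (1 - al) / (1 - al))%:E)%E.
Proof.
move=> L0; have /andP[al0 al1] := al01.
have := @integral_powR_0o R (- al) L; rewrite ltrN2 al1 => /(_ isT L0).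
rewrite (addrC (- al)) => <-; rewrite [RHS]integral_mkcond.
apply: eq_integral => x _; rewrite patchE mem_setE in_itv/=; case: ifPn.
  by move=> /andP[x0 ->]; rewrite mulr1 abelE.
rewrite negb_and -!leNgt => /orP[x0|Lx]; first by rewrite abel_le0// mul0r.
by rewrite ltNge Lx mulr0.
Qed.

Lemma integral_abel_le (D : set R) (y L : R) : measurable D -> 0 < L ->
  (forall x, D x -> x < y + L) ->
  (\int[mu]_(x in D) (abel (x - y))%:E <= (L `^ (1 - al) / (1 - al))%:E)%E.
Proof.
move=> mD L0 DL; rewrite -integral_abel//.
have mA : measurable_fun setT (fun x : R => (abel x * (x < L)%R%:R)%:E).
  apply/measurable_EFinP; apply: measurable_funM; first exact: measurable_abel.
  exact: measurable_fun_ltr_nat.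
have A0 (x : R) : (0 <= (abel x * (x < L)%R%:R)%:E)%E by rewrite lee_fin mulr_ge0 ?abel_ge0.
(* The translation by [y] is again performed as two successive reflections. *)
rewrite -(ge0_integral_subl 0 mA A0).
have mB : measurable_fun setT (fun x : R => (abel (0 - x) * (0 - x < L)%R%:R)%:E).
  by apply: (measurableT_comp mA); exact: measurable_subl.
rewrite -(ge0_integral_subl y mB (fun x => A0 (0 - x))) integral_mkcond.
apply: ge0_le_integral => //.
- by move=> x _; rewrite patchE; case: ifPn => // _; rewrite lee_fin abel_ge0.
- apply/(measurable_restrictT _ mD); apply/measurable_EFinP; apply: measurable_funTS.
  by apply: measurableT_comp; [exact: measurable_abel|exact: measurable_funB].
- by apply: (measurableT_comp mB); exact: measurable_subl.
- move=> x _; rewrite sub0r opprB patchE; case: ifPn => [|_]; last exact: A0.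
  by rewrite inE => /DL xL; rewrite ltrBlDl xL mulr1.
Qed.

Lemma integrable_abel (L : R) : mu.-integrable setT (fun x => (abel x * (x < L)%R%:R)%:E).
Proof.
have mA M : measurable_fun setT (fun x : R => abel x * (x < M)%R%:R).
  apply: measurable_funM; first exact: measurable_abel.
  exact: measurable_fun_ltr_nat.
have A0 M (x : R) : 0 <= abel x * (x < M)%R%:R by rewrite mulr_ge0 ?abel_ge0.
have i1 (M : R) : 0 < M -> mu.-integrable setT (fun x : R => (abel x * (x < M)%R%:R)%:E).
  move=> M0; apply/integrableP; split; first by apply/measurable_EFinP; exact: mA.
  under eq_integral do rewrite abse_EFin (ger0_norm (A0 _ _)).
  by rewrite integral_abel// ltry.
have [L0|L0] := ltP 0 L; first exact: i1.
apply: (@le_integrable _ _ R mu setT measurableT _ _ _ _ (i1 1 ltr01)); first by apply/measurable_EFinP; exact: mA.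
move=> x _; rewrite lee_fin !ger0_norm// ler_wpM2l ?abel_ge0//.
by case: (ltP x L) => // xL; rewrite (lt_le_trans xL)// (le_trans L0).
Qed.

(** Substituting [z + t] for [t] moves the parameter from the singular kernel to the smooth [phi].
    One can then differentiate under the integral sign, dominated by a multiple of [abel] cut off at
    [L]. *)
Lemma is_derive_abel_tail phi (y : R) : test_function setT phi ->
  is_derive y 1 (fun z : R => \int[mu]_(t in `]z, +oo[) (phi t / (t - z) `^ al))
    (\int[mu]_x (phi^`()%classic x * abel (x - y))).
Proof.
move=> tphi; have [M [B [M0 B0 phiB phiM]]] := test_function_bounded tphi.
have [sphi _] := tphi.
have mphi := measurable_test tphi.
have mdphi := measurable_test_derive1 tphi.
have mk (f : R -> R) (z : R) : measurable_fun setT f -> measurable_fun setT (fun t : R => f t * abel (t - z)).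
  move=> mf; apply: measurable_funM => //.
  by apply: measurableT_comp; [exact: measurable_abel|exact: measurable_funB].
have shiftE (f : R -> R) (z : R) : measurable_fun setT f -> \int[mu]_t (f t * abel (t - z)) = \int[mu]_t (f (z + t) * abel t).
  move=> mf; rewrite -(Rintegral_addl z (mk f z mf)); apply: eq_Rintegral => t _.
  by rewrite addrAC subrr add0r.
have -> : (fun z : R => \int[mu]_(t in `]z, +oo[) (phi t / (t - z) `^ al)) =
          (fun z : R => \int[mu]_t (phi (z + t) * abel t)).
  apply/funext => z; rewrite -shiftE// Rintegral_mkcond; apply: eq_Rintegral => t _.
  rewrite patchE mem_setE in_itv/= andbT; case: ifPn.
    by move=> zt; rewrite abelE ?subr_gt0// powRN.
  by rewrite -leNgt => tz; rewrite abel_le0 ?mulr0// subr_le0.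
rewrite shiftE//.
(* For [x] within [1] of [y] and [t >= L] one has [x + t > M], outside the support of [phi]; one
   bound thus serves all nearby [x]. *)
pose L := M + `|y| + 1.
have outL (x t : R) : y - 1 < x < y + 1 -> L <= t -> phi (x + t) = 0 /\ phi^`()%classic (x + t) = 0.
  move=> /andP[x1 x2] Lt; apply: phiM; apply: lt_le_trans (ler_norm _).
  have := lerNnormlW (lexx `|y|); rewrite /L in Lt; lra.
have bnd (f : R -> R) (x t : R) : (forall x, `|f x| <= B) -> (L <= t -> f (x + t) = 0) ->
    `|f (x + t) * abel t| <= B * (abel t * (t < L)%R%:R).
  move=> fB f0; have [tL|Lt] := ltP t L; last by rewrite f0// mul0r normr0 !mulr0.
  by rewrite normrM mulr1 (ger0_norm (abel_ge0 _ _)) ler_wpM2r ?abel_ge0.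
have d1 (x t : R) : is_derive x 1 (fun x => phi (x + t) * abel t) (phi^`()%classic (x + t) * abel t).
  have D : is_derive (x + t) 1 phi (phi^`()%classic (x + t)) by exact: smooth_is_derive.
  have D2 : is_derive x 1 (fun x : R => x + t) 1.
    have : is_derive x 1 ((@id R) + cst t) (1 + 0) by exact: is_deriveD.
    by rewrite addr0.
  have D3 := @is_derive1_comp R phi (fun x : R => x + t) x _ _ D D2; rewrite mulr1 in D3.
  have -> : (fun x => phi (x + t) * abel t) = abel t *: (phi \o (fun x : R => x + t)).
    by apply/funext => z; rewrite /GRing.scale/= mulrC.
  by rewrite mulrC; exact: is_deriveZ.
have G0 (t : R) : 0 <= B * (abel t * (t < L)%R%:R) by apply: mulr_ge0; [exact: ltW|rewrite mulr_ge0 ?abel_ge0].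
have iG : mu.-integrable setT (fun t => (B * (abel t * (t < L)%R%:R))%:E).
  exact: (lebesgue_integrableZl _ measurableT (integrable_abel L)).
have mf (x : R) (f : R -> R) : measurable_fun setT f -> measurable_fun setT (fun t : R => f (x + t) * abel t).
  move=> mf; apply: measurable_funM; last exact: measurable_abel.
  by apply: measurableT_comp => //; exact: measurable_funD.
suff H : h^-1 *: (((fun z : R => \int[mu]_t (phi (z + t) * abel t)) \o shift y) (h *: 1) -
    \int[mu]_t (phi (y + t) * abel t)) @[h --> (0 : R)^'] -->
    \int[mu]_t (phi^`()%classic (y + t) * abel t).
  by apply: DeriveDef; [apply/cvg_ex; eexists; exact: H|exact: cvg_lim H].
have yI : `]y - 1, y + 1[%classic y by rewrite /= in_itv/= ltrDl ltrBlDr ltrDl ltr01.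
have intf (x : R) : `]y - 1, y + 1[%classic x -> mu.-integrable setT (EFin \o (fun t => phi (x + t) * abel t)).
  rewrite /= in_itv/= => xI.
  apply: (@le_integrable _ _ R mu setT measurableT _ _ _ _ iG); first by apply/measurable_EFinP; exact: mf.
  move=> t _; rewrite lee_fin (ger0_norm (G0 t)).
  by apply: bnd => [z|Lt]; [have [] := phiB z|have [] := outL x t xI Lt].
have derf (x t : R) : `]y - 1, y + 1[%classic x -> setT t -> derivable ((fun x t => phi (x + t) * abel t) ^~ t) x 1.
  by move=> _ _; have [] := d1 x t.
have pE (x t : R) : partial1of2 (fun x t => phi (x + t) * abel t) x t = phi^`()%classic (x + t) * abel t.
  by rewrite partial1of2E; have [_ ->] := d1 x t.
have <- : \int[mu]_t partial1of2 (fun x t => phi (x + t) * abel t) y t =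
    \int[mu]_t (phi^`()%classic (y + t) * abel t).
  by apply: eq_Rintegral => t _; exact: pE.
have := @cvg_differentiation_under_integral R _ _ mu (fun x t => phi (x + t) * abel t) setT measurableT y _ _ yI intf derf
  (fun t => B * (abel t * (t < L)%R%:R)) _ iG _.
under [X in _ -> X @ _ --> _]eq_fun => h do rewrite /= /GRing.scale/= mulr1.
apply.
- exact: G0.
- move=> x t; rewrite /= in_itv/= => xI _; rewrite pE.
  by apply: bnd => [z|Lt]; [have [] := phiB z|have [] := outL x t xI Lt].
Qed.

Lemma frac_der_plusE phi (y : R) : test_function setT phi ->
  frac_der plus al phi y =
  - (Gamma (1 - al))^-1 * \int[mu]_x (phi^`()%classic x * abel (x - y)).
Proof.
move=> tphi; rewrite /frac_der derive1E; congr (_ * _).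
by have [_] := is_derive_abel_tail y tphi.
Qed.

End fractional_derivative.

Section weak_derivative.
Context {R : realType}.
Local Notation mu := (@lebesgue_measure R).
Variables (al a b : R).
Hypotheses (al01 : 0 < al < 1) (ab : a < b).
Implicit Types (phi u v : R -> R).

Local Notation abel := (abel al).

Let al_lt1 : 0 < 1 - al. Proof. by case/andP: al01 => _; rewrite subr_gt0. Qed.

(** The Abel integral of the zero extension of [u], without the factor [1 / Gamma (1 - al)]; the
    point [x] may lie beyond [b]. *)
Definition frac_int u (x : R) : R := \int[mu]_(y in `]a, b[) (u y * abel (x - y)).

(** The indicator plays the role of a kernel, so the same exchange and [L^1] lemmas cover [frac_int]
    and [primitive]. *)
Definition primitive v (x : R) : R := \int[mu]_(r in `]a, b[) (v r * (r < x)%R%:R).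

Lemma measurable_abelB : measurable_fun setT (fun z : R * R => abel (z.1 - z.2)).
Proof. by apply: measurableT_comp; [exact: measurable_abel|exact: measurable_funB]. Qed.

Lemma measurable_ltr_nat : measurable_fun setT (fun z : R * R => (z.2 < z.1)%R%:R : R).
Proof. exact: measurable_fun_ltr_nat. Qed.

(** The right derivative of [phi] is an Abel integral of its ordinary derivative; Fubini moves that
    integral onto [u], where it runs in the other direction. *)
Lemma frac_der_swap u phi : mu.-integrable `]a, b[ (EFin \o u) -> test_function setT phi ->
  mu.-integrable setT (fun x => (phi^`()%classic x * frac_int u x)%:E) /\
  \int[mu]_(y in `]a, b[) (u y * frac_der plus al phi y) =
  - (Gamma (1 - al))^-1 * \int[mu]_x (phi^`()%classic x * frac_int u x).
Proof.
move=> iu tphi; have [M [B [M0 B0 phiB phiM]]] := test_function_bounded tphi.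
have mdphi := measurable_test_derive1 tphi.
(* For [r > a] and [x >= r + L] one has [x > M], so the derivative of [phi] vanishes there and the
   column integral is that of [abel] over a range of length [L]. *)
pose L := M + 1 + `|a|; pose K := L `^ (1 - al) / (1 - al).
have L0 : 0 < L by rewrite ltr_pwDl// addr_gt0.
have bnd (r : R) : `]a, b[%classic r ->
    (\int[mu]_(x in setT) `|phi^`()%classic x * abel (x - r)|%:E <= (B * K)%:E)%E.
  rewrite /= in_itv/= => /andP[ar rb].
  have mk : measurable_fun setT (fun x : R => abel (x - r)).
    exact: (measurableT_comp measurable_abelB (pair2_measurable r)).
  pose D := [set x : R | x < r + L].
  have mD : measurable D by rewrite /D -set_itvNyo.
  apply: (@le_trans _ _ (B%:E * \int[mu]_(x in D) (abel (x - r)%R)%:E)%E); last first.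
    by rewrite EFinM lee_wpmul2l ?lee_fin ?(ltW B0)//; exact: (integral_abel_le al01 mD L0).
  rewrite -ge0_integralZl//; last 3 first.
  - by apply/measurable_EFinP; exact: measurable_funTS.
  - by move=> x _; rewrite lee_fin abel_ge0.
  - by rewrite lee_fin ltW.
  rewrite [leRHS]integral_mkcond; apply: ge0_le_integral => //.
  - by apply/measurable_EFinP; apply: measurableT_comp => //; exact: measurable_funM.
  - by apply/(measurable_restrictT _ mD); apply/measurable_EFinP; apply: measurable_funTS; exact: measurable_funM.
  - move=> x _; rewrite patchE; have [xr|rx] := ltP x (r + L).
      rewrite mem_set// lee_fin normrM (ger0_norm (abel_ge0 _ _)).
      by rewrite ler_wpM2r ?abel_ge0//; have [] := phiB x.
    have [_ ->] : phi x = 0 /\ phi^`()%classic x = 0.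
      apply: phiM; apply: lt_le_trans (ler_norm _).
      have := lerNnormlW (lexx `|a|); rewrite /L in rx; lra.
    rewrite mul0r normr0; case: ifPn => // _.
    by rewrite lee_fin mulr_ge0 ?abel_ge0// ltW.
have [i1 E1] := kernel_swap_in measurableT (measurable_itv _) iu mdphi measurable_abelB bnd.
split; first exact: i1.
have iE := kernel_swap_integrable measurableT (measurable_itv _) iu mdphi measurable_abelB bnd.
transitivity (\int[mu]_(r in `]a, b[)
    (- (Gamma (1 - al))^-1 * (u r * \int[mu]_x (phi^`()%classic x * abel (x - r))))).
  by apply: eq_Rintegral => y _; rewrite (frac_der_plusE al01 _ tphi); ring.
transitivity (- (Gamma (1 - al))^-1 * \int[mu]_(r in `]a, b[) (u r * \int[mu]_x (phi^`()%classic x * abel (x - r)))).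
  exact: (lebesgue_RintegralZl _ (measurable_itv _) iE).
exact: (congr1 (fun z => - (Gamma (1 - al))^-1 * z) (esym E1)).
Qed.

End weak_derivative.

Section interpolation.
Context {R : realType}.
Local Notation mu := (@lebesgue_measure R).
Implicit Types (f u v : R -> R).

Lemma gt0_powRD (x r s : R) : 0 < x -> x `^ (r + s) = x `^ r * x `^ s.
Proof. by move=> x0; rewrite powRD// (gt_eqF x0) implybT. Qed.

(* Replaces the Young and Hoelder inequalities: one optimizes over the level [l]. *)
Lemma normr_le_level (q l t : R) : 1 <= q -> 0 < l -> 0 <= t ->
  t <= l + l `^ (1 - q) * t `^ q.
Proof.
move=> q1 l0 t0; have [tl|lt_] := leP t l.
  by rewrite (le_trans tl)// lerDl mulr_ge0 ?powR_ge0.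
rewrite -[leLHS]add0r lerD ?(ltW l0)//.
have t1 : 0 < t := lt_trans l0 lt_.
have -> : t = t `^ (1 - q) * t `^ q by rewrite -gt0_powRD// subrK powRr1.
rewrite [X in _ <= _ * X `^ q](_ : _ = t); last by rewrite -gt0_powRD// subrK powRr1.
rewrite ler_wpM2r ?powR_ge0//.
rewrite -[1 - q]opprK opprB !(powRN _ (q - 1)) lef_pV2 ?posrE ?powR_gt0//.
by apply: ge0_ler_powR; rewrite ?subr_ge0// ?nnegrE ltW.
Qed.

Lemma cvg_powR0 (d : R) : 0 < d -> (e `^ d @[e --> 0^'+]) --> (0 : R).
Proof.
move=> d0; apply/cvgrPdist_lt => eps eps0; near=> e.
have e0 : 0 < e by [].
rewrite sub0r normrN ger0_norm ?powR_ge0//.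
have -> : eps = (eps `^ d^-1) `^ d by rewrite -powRrM mulVf ?gt_eqF// powRr1// ltW.
apply: gt0_ltr_powR => //; rewrite ?nnegrE ?powR_ge0 ?(ltW e0)//.
by near: e; apply: nbhs_right_lt; rewrite powR_gt0.
Unshelve. all: end_near. Qed.

(** A coarse form of Hoelder on a short interval, with [1 + N] in the place of [N ^ (1 / q)]: what
    matters is only the power of the length. *)
Lemma integral_small_itv (a e q : R) u : 1 < q -> a < e ->
  measurable_fun `]a, e[ u ->
  (\int[mu]_(x in `]a, e[) `|u x|%:E <=
   ((e - a) `^ (1 - q^-1))%:E *
     (1 + \int[mu]_(x in `]a, e[) (`|u x| `^ q)%:E))%E.
Proof.
move=> q1 ae mu_; have q0 : 0 < q by rewrite (lt_trans _ q1).
have ea : 0 < e - a by rewrite subr_gt0.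
(* This level gives both terms, [l * (e - a)] and [l ^ (1 - q)], the same power [1 - q^-1] of the
   length. *)
pose l := (e - a) `^ (- q^-1).
have l0 : 0 < l by rewrite powR_gt0.
have mq : measurable_fun `]a, e[ (fun x => (`|u x| `^ q)%:E).
  apply/measurable_EFinP; apply: (measurableT_comp (measurable_powR q)).
  exact: measurableT_comp.
apply: (@le_trans _ _ (\int[mu]_(x in `]a, e[) (l%:E + (l `^ (1 - q))%:E * (`|u x| `^ q)%:E))%E).
  apply: ge0_le_integral => //.
  - by apply/measurable_EFinP; exact: measurableT_comp.
  - by apply: emeasurable_funD; [exact: measurable_cst|exact: measurable_funeM].
  - by move=> x _; rewrite -EFinM -EFinD lee_fin normr_le_level// ltW.
rewrite ge0_integralD//; last 3 first.
- by move=> x _; rewrite lee_fin ltW.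
- by move=> x _; rewrite -EFinM lee_fin mulr_ge0 ?powR_ge0.
- exact: measurable_funeM.
rewrite integral_cst//= ge0_integralZl//; last by rewrite lee_fin powR_ge0.
rewrite lebesgue_measure_itv/= lte_fin ae -EFinB -EFinM.
have : (0 <= \int[mu]_(x in `]a, e[) (`|u x| `^ q)%:E)%E.
  by apply: integral_ge0 => x _; rewrite lee_fin powR_ge0.
move: (\int[mu]_(x in `]a, e[) (`|u x| `^ q)%:E)%E => N N0.
rewrite ge0_muleDr//.
rewrite mule1 (_ : l * (e - a) = (e - a) `^ (1 - q^-1)); last first.
  by rewrite /l mulrC -[X in X * _](powRr1 (ltW ea)) -gt0_powRD.
rewrite (_ : l `^ (1 - q) = (e - a) `^ (1 - q^-1))//.
by rewrite /l -powRrM mulNr mulrBr mulr1 mulVf ?gt_eqF// opprB.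
Qed.

End interpolation.

Section abel_equation.
Context {R : realType}.
Local Notation mu := (@lebesgue_measure R).
Variables (al a b : R).
Hypotheses (al01 : 0 < al < 1) (ab : a < b).
Implicit Types (phi u v : R -> R).

Local Notation abel := (abel al).
Local Notation frac_int := (frac_int al a b).
Local Notation primitive := (primitive a b).

Let al_lt1 : 0 < 1 - al. Proof. by case/andP: al01 => _; rewrite subr_gt0. Qed.

(** Since [h x r] vanishes for [r >= x], only the values of [v] before [e] are seen from []a, e[].
    The right-hand side therefore involves the short interval alone, and shrinks with it. *)
Lemma causal_kernel_le v (h : R -> R -> R) (e C : R) : e <= b ->
  measurable_fun `]a, b[ v -> measurable_fun setT (fun z : R * R => h z.1 z.2) ->
  (forall x r, x <= r -> h x r = 0) ->
  (forall r, a < r < e -> (\int[mu]_(x in `]a, e[) `|h x r|%:E <= C%:E)%E) -> 0 <= C ->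
  (\int[mu]_(x in `]a, e[) `|\int[mu]_(r in `]a, b[) (v r * h x r)|%:E <=
   C%:E * \int[mu]_(r in `]a, e[) `|v r|%:E)%E.
Proof.
move=> eb mv mh h0 hC C0.
have sub : `]a, e[ `<=` `]a, b[ by apply: subset_itvl; rewrite bnd_simp.
have hC' r : `]a, e[%classic r -> (\int[mu]_(x in `]a, e[) `|h x r|%:E <= C%:E)%E.
  by rewrite /= in_itv/=; exact: hC.
have mv' : measurable_fun `]a, e[ v by exact: measurable_funS mv.
apply: le_trans (integral_kernel_le (measurable_itv _) (measurable_itv _) mv' mh hC' C0).
rewrite le_eqVlt; apply/orP; left; apply/eqP; apply: eq_integral => x.
rewrite inE/= in_itv/= => /andP[_ xe]; congr (`| _ |%:E).
rewrite Rintegral_mkcond [RHS]Rintegral_mkcond; apply: eq_Rintegral => r _.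
rewrite !patchE !mem_setE !in_itv/=; case: (ltP r e) => re.
  by rewrite (lt_le_trans re eb).
rewrite andbF; case: ifPn => // _.
by rewrite h0 ?mulr0// (le_trans (ltW xe)).
Qed.

Lemma abelB_le0 (x r : R) : x <= r -> abel (x - r) = 0.
Proof. by move=> xr; rewrite abel_le0// subr_le0. Qed.

Lemma abelB_le (x y : R) : b < x -> y < b -> abel (x - y) <= (x - b) `^ (- al).
Proof.
move=> bx yb; have /andP[al0 _] := al01; have yx := lt_trans yb bx.
rewrite abelE ?subr_gt0// !powRN lef_pV2 ?posrE ?powR_gt0 ?subr_gt0//.
by apply: ge0_ler_powR; rewrite ?nnegrE ?subr_ge0 ?(ltW al0) ?(ltW bx) ?(ltW yx)// lerD2l lerN2 ltW.
Qed.

Lemma integral_abelB_le (e r : R) : a < r < e ->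
  (\int[mu]_(x in `]a, e[) `|abel (x - r)|%:E <=
   ((e - a) `^ (1 - al) / (1 - al))%:E)%E.
Proof.
move=> /andP[ar re].
under eq_integral do rewrite (ger0_norm (abel_ge0 _ _)).
apply: integral_abel_le => //; first by rewrite subr_gt0 (lt_trans ar).
move=> x /=; rewrite in_itv/= => /andP[ax xe].
lra.
Qed.

Lemma integral_frac_int_le u (e : R) : e <= b -> a < e -> measurable_fun `]a, b[ u ->
  (\int[mu]_(x in `]a, e[) `|frac_int u x|%:E <=
   ((e - a) `^ (1 - al) / (1 - al))%:E * \int[mu]_(r in `]a, e[) `|u r|%:E)%E.
Proof.
move=> eb ae mu_; apply: causal_kernel_le => //.
- exact: measurable_abelB.
- exact: abelB_le0.
- exact: integral_abelB_le.
- by rewrite divr_ge0 ?powR_ge0// ltW.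
Qed.

Lemma integral_ltr_nat_le (e r : R) : a < e ->
  (\int[mu]_(x in `]a, e[) `|(r < x)%R%:R : R|%:E <= (e - a)%:E)%E.
Proof.
move=> ae; apply: (@le_trans _ _ (\int[mu]_(x in `]a, e[) (cst 1%:E x))%E).
  apply: ge0_le_integral => //.
  - apply/measurable_EFinP; apply: measurableT_comp => //.
    by apply: measurable_funTS; exact: measurable_fun_ltr_nat.
  - by move=> x _; case: (r < x); rewrite ?normr1 ?normr0 lee_fin.
by rewrite integral_cst//= lebesgue_measure_itv/= lte_fin ae -EFinB mul1e.
Qed.

Lemma integral_primitive_le v (e : R) : e <= b -> a < e -> measurable_fun `]a, b[ v ->
  (\int[mu]_(x in `]a, e[) `|primitive v x|%:E <=
   (e - a)%:E * \int[mu]_(r in `]a, e[) `|v r|%:E)%E.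
Proof.
move=> eb ae mv; apply: causal_kernel_le => //.
- exact: measurable_ltr_nat.
- by move=> x r xr; rewrite ltNge xr.
- by move=> r _; exact: integral_ltr_nat_le.
- by rewrite subr_ge0 ltW.
Qed.

Lemma integrable_frac_int u : mu.-integrable `]a, b[ (EFin \o u) ->
  mu.-integrable `]a, b[ (EFin \o frac_int u).
Proof.
move=> iu; apply: (@integrable_kernel _ _ _ u (fun x r => abel (x - r)) ((b - a) `^ (1 - al) / (1 - al)) _ _ iu (measurable_abelB al)) => //.
  by move=> r; rewrite /= in_itv/=; exact: integral_abelB_le.
by rewrite divr_ge0 ?powR_ge0// ltW.
Qed.

Lemma integrable_primitive v : mu.-integrable `]a, b[ (EFin \o v) ->
  mu.-integrable `]a, b[ (EFin \o primitive v).
Proof.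
move=> iv; apply: (@integrable_kernel _ _ _ v (fun x r => (r < x)%R%:R) (b - a) _ _ iv measurable_ltr_nat) => //.
  by move=> r _; exact: integral_ltr_nat_le.
by rewrite subr_ge0 ltW.
Qed.

Lemma Rintegral_derive1 phi (c d : R) : smooth phi -> c <= d ->
  \int[mu]_(x in `]c, d[) phi^`()%classic x = phi d - phi c.
Proof.
move=> sphi cd; have cd' := smooth_continuous (smooth_derive1 sphi).
have iphi : mu.-integrable `[c, d] (EFin \o phi^`()%classic).
  apply: continuous_compact_integrable; first exact: segment_compact.
  exact: continuous_subspaceT.
rewrite Rintegral_itv_obnd_cbnd; last first.
  by apply: integrableS iphi => //; exact: subset_itv_oo_cc.
rewrite Rintegral_itv_bndo_bndc; last by apply: integrableS iphi => //; apply: subset_itvl; rewrite bnd_simp.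
rewrite /Rintegral (@has_derivative_FTC2 _ _ phi)// => x _; last exact: cd'.
exact: smooth_is_derive.
Qed.

Lemma primitive_swap v phi : mu.-integrable `]a, b[ (EFin \o v) -> test_function setT phi ->
  mu.-integrable `]a, b[ (fun x => (phi^`()%classic x * primitive v x)%:E) /\
  \int[mu]_(x in `]a, b[) (phi^`()%classic x * primitive v x) =
  \int[mu]_(r in `]a, b[) (v r * (phi b - phi r)).
Proof.
move=> iv tphi; have [M [B [M0 B0 phiB phiM]]] := test_function_bounded tphi.
have [sphi _] := tphi.
have mdphi := measurable_test_derive1 tphi.
have bnd (r : R) : `]a, b[%classic r ->
    (\int[mu]_(x in `]a, b[) `|phi^`()%classic x * (r < x)%R%:R|%:E <= (B * (b - a))%:E)%E.
  move=> _; apply: (@le_trans _ _ (\int[mu]_(x in `]a, b[) (cst B%:E x))%E); last first.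
    by rewrite integral_cst//= lebesgue_measure_itv/= lte_fin ab -EFinB -EFinM.
  apply: ge0_le_integral => //.
  - apply/measurable_EFinP; apply: measurableT_comp => //; apply: measurable_funTS.
    by apply: measurable_funM => //; exact: measurable_fun_ltr_nat.
  - move=> x _; rewrite lee_fin normrM; have [_ Bx] := phiB x.
    by case: (r < x); rewrite ?normr1 ?normr0 ?mulr1 ?mulr0// ltW.
have inner (r : R) : a < r -> r < b ->
    \int[mu]_(x in `]a, b[) (phi^`()%classic x * (r < x)%R%:R) = phi b - phi r.
  move=> ar rb; rewrite -(Rintegral_derive1 sphi (ltW rb)).
  rewrite Rintegral_mkcond [RHS]Rintegral_mkcond; apply: eq_Rintegral => x _.
  rewrite !patchE !mem_setE !in_itv/=; case: (ltP r x) => rx; rewrite ?mulr1 ?mulr0 ?if_same//.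
  by rewrite (lt_trans ar rx).
have [i1 E1] := kernel_swap_in (measurable_itv _) (measurable_itv _) iv (measurable_funTS mdphi) measurable_ltr_nat bnd.
split; first exact: i1.
apply: (etrans E1); apply: eq_Rintegral => r; rewrite inE/= in_itv/= => /andP[ar rb].
by congr (_ * _); exact: inner.
Qed.

End abel_equation.

(** * Vanishing of the integration constant *)

Section abel_equation_solution.
Context {R : realType}.
Local Notation mu := (@lebesgue_measure R).
Variables (al a b : R).
Hypotheses (al01 : 0 < al < 1) (ab : a < b).
Implicit Types (phi u v : R -> R).

Local Notation frac_int := (frac_int al a b).
Local Notation primitive := (primitive a b).

Let al_lt1 : 0 < 1 - al. Proof. by case/andP: al01 => _; rewrite subr_gt0. Qed.

(** Absolute continuity of the integral, read off from the continuity at the left end of the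
    indefinite integral of [v] patched by zero. *)
Lemma integral_normr_cvg0 v : mu.-integrable `]a, b[ (EFin \o v) ->
  (\int[mu]_(x in `]a, a + e[) `|v x| @[e --> 0^'+]) --> (0 : R).
Proof.
move=> iv; have iv0 : mu.-integrable `[a, b] (EFin \o ((fun x => `|v x|) \_ `]a, b[)).
  apply: (@integrableS _ _ R mu setT) => //; apply/integrable_patch => //.
  exact: (integrable_norm iv).
have := parameterized_integral_cvg_left ab iv0.
move=> /cvg_at_right_filter H.
have H2 : (\int[mu]_(t in `[a, x]) ((fun x => `|v x|) \_ `]a, b[) t @[x --> a^'+]) --> (0 : R) by exact: H.
have H3 : (\int[mu]_(t in `[a, a + e]) ((fun x => `|v x|) \_ `]a, b[) t @[e --> 0^'+]) --> (0 : R).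
  apply/cvg_at_rightP => s [s0 scv].
  move/cvg_at_rightP : H2 => /(_ (fun n => a + s n)); apply; split.
    by move=> n; rewrite ltrDl.
  by rewrite -[X in _ --> X]addr0; apply: cvgD => //; exact: cvg_cst.
apply: cvg_trans H3; apply: near_eq_cvg; near=> e.
have e0 : 0 < e by [].
have eb : a + e < b by rewrite -ltrBrDl; near: e; apply: nbhs_right_lt; rewrite subr_gt0.
have iv1 : mu.-integrable `[a, a + e] (EFin \o ((fun x => `|v x|) \_ `]a, b[)).
  by apply: lebesgue_integrableS iv0 => //; apply: subset_itvl; rewrite bnd_simp ltW.
rewrite -Rintegral_itv_bndo_bndc; last first.
  by apply: lebesgue_integrableS iv1 => //; apply: subset_itvl; rewrite bnd_simp.
rewrite -Rintegral_itv_obnd_cbnd; last first.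
  by apply: lebesgue_integrableS iv1 => //; exact: subset_itv_oo_cc.
apply: eq_Rintegral => x; rewrite inE patchE mem_setE /= !in_itv/= => /andP[ax xe].
by rewrite ax (lt_trans xe).
Unshelve. all: end_near. Qed.

(* Only here is the integrability of [`|u| `^ q] used: with [al + q^-1 < 1], the
   right-hand side tends to [0] with [e], so the constant [C] vanishes. *)
Lemma abel_equation_bound u v (q g C : R) :
  mu.-integrable `]a, b[ (EFin \o u) -> mu.-integrable `]a, b[ (EFin \o v) ->
  1 < q -> (\int[mu]_(x in `]a, b[) (`|u x| `^ q)%:E < +oo)%E ->
  {ae mu, forall x, a < x < b -> g * frac_int u x - primitive v x = C} ->
  exists K, forall e, 0 < e -> e < b - a ->
    `|C| <= K * e `^ (1 - al - q^-1) + \int[mu]_(x in `]a, a + e[) `|v x|.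
Proof.
move=> iu iv q1 uq hC.
have N0 : (0 <= \int[mu]_(x in `]a, b[) (`|u x| `^ q)%:E)%E.
  by apply: integral_ge0 => x _; rewrite lee_fin powR_ge0.
pose N := fine (\int[mu]_(x in `]a, b[) (`|u x| `^ q)%:E).
have NE : (\int[mu]_(x in `]a, b[) (`|u x| `^ q)%:E)%E = N%:E by rewrite fineK// ge0_fin_numE.
exists (`|g| * ((1 + N) / (1 - al))) => e e0 eb.
have mu_ : measurable_fun `]a, b[ u by have /integrableP[/measurable_EFinP] := iu.
have mv_ : measurable_fun `]a, b[ v by have /integrableP[/measurable_EFinP] := iv.
have ae' : a < a + e by rewrite ltrDl.
have aeb : a + e <= b by lra.
have sub : `]a, a + e[ `<=` `]a, b[ by apply: subset_itvl; rewrite bnd_simp.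
have mw : measurable_fun `]a, a + e[ (frac_int u).
  by have /integrableP[/measurable_EFinP mw _] := integrable_frac_int al01 iu; exact: measurable_funS mw.
have mF : measurable_fun `]a, a + e[ (primitive v).
  by have /integrableP[/measurable_EFinP mF _] := integrable_primitive ab iv; exact: measurable_funS mF.
have iV : mu.-integrable `]a, a + e[ (EFin \o v) by exact: lebesgue_integrableS iv.
have VE : (\int[mu]_(x in `]a, (a + e)%R[) `|v x|%:E)%E = (\int[mu]_(x in `]a, a + e[) `|v x|)%:E.
  by rewrite /Rintegral fineK//; apply: integrable_fin_num => //; exact: (integrable_norm iV).
(* The constant is integrated over []a, a + e[] because [frac_int] and [primitive] are controlled
   only in the mean near [a]. *)
have Cle : ((`|C| * e)%:E <= `|g|%:E * \int[mu]_(x in `]a, (a + e)%R[) `|frac_int u x|%:E +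
    \int[mu]_(x in `]a, (a + e)%R[) `|primitive v x|%:E)%E.
  rewrite -ge0_integralZl//; last by apply/measurable_EFinP; exact: measurableT_comp.
  rewrite -ge0_integralD//; last 2 first.
  - by apply: measurable_funeM; apply/measurable_EFinP; exact: measurableT_comp.
  - by apply/measurable_EFinP; exact: measurableT_comp.
  have -> : (`|C| * e)%:E = (\int[mu]_(x in `]a, (a + e)%R[) `|C|%:E)%E.
    by rewrite integral_cst//= lebesgue_measure_itv/= lte_fin ae' -EFinB -EFinM addrAC subrr add0r.
  apply: ae_ge0_le_integral => //.
  - by move=> x _; rewrite adde_ge0// mule_ge0.
  - apply: emeasurable_funD; first apply: measurable_funeM; apply/measurable_EFinP; exact: measurableT_comp.
  - apply: ae_lebesgueS hC => x hC; rewrite /= in_itv/= => /andP[ax xe].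
    rewrite -hC ?ax ?(lt_le_trans xe)// -EFinM -EFinD lee_fin.
    by rewrite (le_trans (ler_normB _ _))// normrM.
have Ule : (\int[mu]_(r in `]a, (a + e)%R[) `|u r|%:E <= (e `^ (1 - q^-1) * (1 + N))%:E)%E.
  apply: (le_trans (integral_small_itv q1 ae' (measurable_funS _ sub mu_))) => //.
  rewrite (addrAC a) subrr add0r EFinM lee_wpmul2l ?lee_fin ?powR_ge0//.
  rewrite EFinD leeD2l// -NE; apply: ge0_subset_integral => //.
  by apply/measurable_EFinP; apply: (measurableT_comp (measurable_powR q)); exact: measurableT_comp.
have := integral_frac_int_le al01 aeb ae' mu_; have := integral_primitive_le aeb ae' mv_.
rewrite VE (addrAC a) subrr add0r => Fle wle.
(* The exponents add up to [(1 - al) + (1 - q^-1) = 1 + (1 - al - q^-1)]: one factor [e] cancels the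
   length of the interval, and a positive power remains when [al + q^-1 < 1]. *)
have key : ((`|C| * e)%:E <= (e * (`|g| * ((1 + N) / (1 - al)) * e `^ (1 - al - q^-1) + \int[mu]_(x in `]a, a + e[) `|v x|))%:E)%E.
  apply: (le_trans Cle); rewrite mulrDr EFinD; apply: leeD => //.
  have -> : e * (`|g| * ((1 + N) / (1 - al)) * e `^ (1 - al - q^-1)) =
      `|g| * (e `^ (1 - al) / (1 - al) * (e `^ (1 - q^-1) * (1 + N))).
    have -> : e `^ (1 - al) / (1 - al) * (e `^ (1 - q^-1) * (1 + N)) =
      (e `^ (1 - al) * e `^ (1 - q^-1)) * ((1 + N) / (1 - al)) by ring.
    rewrite -gt0_powRD// (_ : 1 - al + (1 - q^-1) = 1 + (1 - al - q^-1)); last by ring.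
    by rewrite (gt0_powRD 1 (1 - al - q^-1) e0) powRr1 ?ltW//; ring.
  rewrite [leRHS]EFinM lee_wpmul2l//; apply: (le_trans wle).
  by rewrite [leRHS]EFinM lee_wpmul2l// lee_fin divr_ge0 ?powR_ge0// ltW.
by move: key; rewrite lee_fin mulrC ler_pM2l.
Qed.

Lemma abel_equation u v (q : R) :
  mu.-integrable `]a, b[ (EFin \o u) -> mu.-integrable `]a, b[ (EFin \o v) ->
  1 < q -> al + q^-1 < 1 -> (\int[mu]_(x in `]a, b[) (`|u x| `^ q)%:E < +oo)%E ->
  (forall phi, test_function `]a, b[ phi ->
    \int[mu]_(x in `]a, b[) (v x * phi x) =
    \int[mu]_(x in `]a, b[) (u x * frac_der plus al phi x)) ->
  {ae mu, forall x, a < x < b -> (Gamma (1 - al))^-1 * frac_int u x = primitive v x}.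
Proof.
move=> iu iv q1 alq uq uv; set g := (Gamma (1 - al))^-1.
have iw := integrable_frac_int al01 iu; have iF := integrable_primitive ab iv.
have igw := lebesgue_integrableZl g (measurable_itv _) iw.
have ih : mu.-integrable `]a, b[ (fun x => (g * frac_int u x - primitive v x)%:E).
  exact: lebesgue_integrableB igw iF.
have [C hC] : exists C, {ae mu, forall x, a < x < b -> g * frac_int u x - primitive v x = C}.
  apply: du_Bois_Reymond => // phi tphi.
  have tphiT : test_function setT phi by exact: test_function_sub tphi.
  have [i1 E1] := frac_der_swap al01 iu tphiT.
  have [i2 E2] := primitive_swap ab iv tphiT.
  have E3 : \int[mu]_x (phi^`()%classic x * frac_int u x) =
      \int[mu]_(x in `]a, b[) (phi^`()%classic x * frac_int u x).
    rewrite [RHS]Rintegral_mkcond; apply: eq_Rintegral => x _; rewrite patchE.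
    case: ifPn => //; rewrite notin_setE => /(test_function_out tphi)[_ ->].
    by rewrite mul0r.
  have i1' : mu.-integrable `]a, b[ (fun x => (phi^`()%classic x * frac_int u x)%:E).
    exact: lebesgue_integrableS i1.
  (* The factor [phi b - phi r] left by [primitive_swap] becomes [- phi r], which restores the weak
     equation. *)
  have phib : phi b = 0.
    by have [] := test_function_out tphi (_ : ~ `]a, b[%classic b) => //; rewrite /= in_itv/= ltxx andbF.
  transitivity (\int[mu]_(x in `]a, b[)
     (g * (phi^`()%classic x * frac_int u x) + -1 * (phi^`()%classic x * primitive v x))).
    by apply: eq_Rintegral => x _; ring.
  rewrite Rintegral_lin2//.
  have -> : \int[mu]_(x in `]a, b[) (phi^`()%classic x * primitive v x) =
    \int[mu]_(r in `]a, b[) (-1 * (v r * phi r)).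
    by rewrite E2; apply: eq_Rintegral => r _; rewrite phib; ring.
  have ivphi : mu.-integrable `]a, b[ (fun x => (v x * phi x)%:E).
    have [M [B [_ _ phiB _]]] := test_function_bounded tphi.
    apply: (integrable_boundedM (C := B) _ iv) => //; last by move=> x _; have [] := phiB x.
    exact: measurable_funTS (measurable_test tphi).
  rewrite lebesgue_RintegralZl// uv// E1 E3 -/g.
  by move: (\int[mu]_(x in _) _) => X; ring.
have [K KC] := abel_equation_bound iu iv q1 uq hC.
have C0 : C = 0.
  apply/eqP; rewrite -normr_le0; apply/ler_addgt0Pr => eps eps0; rewrite add0r.
  have cv : (K * e `^ (1 - al - q^-1) + \int[mu]_(x in `]a, a + e[) `|v x|) @[e --> 0^'+] --> (0 : R).
    rewrite -[X in _ --> X](addr0 0) -[X in _ --> X + _](mulr0 K); apply: cvgD; last exact: integral_normr_cvg0.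
    by apply: cvgM; [exact: cvg_cst|apply: cvg_powR0; lra].
  near (0%R : R)^'+ => e.
  apply: (@le_trans _ _ (K * e `^ (1 - al - q^-1) + \int[mu]_(x in `]a, a + e[) `|v x|)).
    by apply: KC => //; near: e; apply: nbhs_right_lt; rewrite subr_gt0.
  apply: ltW; near: e; exact: (cvgr_lt 0 cv).
apply: ae_lebesgueS hC => x hC xab; apply/eqP; rewrite -subr_eq0 hC// C0//.
Unshelve. all: end_near. Qed.

End abel_equation_solution.

(** * The weak derivative to the right of the interval *)

Section extension_identity.
Context {R : realType}.
Local Notation mu := (@lebesgue_measure R).
Variable al : R.
Hypothesis al01 : 0 < al < 1.
Implicit Types (phi u v : R -> R).

Local Notation mker := (mker al).
Local Notation mint := (mint al).
Local Notation mtot := (mtot al).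
Local Notation abel := (abel al).
Local Notation sker := (sker al).
Local Notation bker := (bker al).

(** With a fixed domain and an indicator kernel, measurability in [z] and the bound by [mtot] become
    instances of general facts. *)
Lemma mintE (z : R) : mint z = \int[mu]_(t in `]0, +oo[) (mker t * (t < z)%R%:R).
Proof.
have i0 := mker_integrable al01.
have i1 : mu.-integrable `]0, z[ (EFin \o mker).
  by apply: lebesgue_integrableS i0 => //; apply: subset_itvl; rewrite bnd_simp.
change (\int[mu]_(t in `[0, z]) mker t = \int[mu]_(t in `]0, +oo[) (mker t * (t < z)%R%:R)).
rewrite -Rintegral_itv_bndo_bndc; last first.
  apply: lebesgue_integrableS (mker_integrable_cy al01) => //.
  by apply: subset_itvl; rewrite bnd_simp.
rewrite -Rintegral_itv_obnd_cbnd// Rintegral_mkcond [RHS]Rintegral_mkcond.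
apply: eq_Rintegral => t _; rewrite !patchE !mem_setE !in_itv/= andbT.
by case: (ltP t z) => tz; rewrite ?andbT ?andbF ?mulr1 ?mulr0 ?if_same.
Qed.

Lemma measurable_mint : measurable_fun setT mint.
Proof.
have -> : mint = fun z => \int[mu]_(t in `]0, +oo[) (mker t * (t < z)%R%:R).
  by apply/funext => z; exact: mintE.
apply: (measurable_kernel_in (h := fun z t => (t < z)%R%:R)) => //.
  by apply: measurable_funTS; exact: measurable_mker.
exact: measurable_ltr_nat.
Qed.

Lemma mint_ge0 (z : R) : 0 <= mint z.
Proof.
apply: Rintegral_ge0 => t /=; rewrite in_itv/= => /andP[t0 _].
exact: mker_ge0.
Qed.

Lemma mint_le (z : R) : mint z <= mtot.
Proof.
have i0 := mker_integrable al01.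
rewrite mintE; apply: le_Rintegral => //.
  apply: (integrable_boundedM (C := 1) _ i0) => //; last by move=> t _; case: (t < z); rewrite ?normr1 ?normr0.
  by apply: measurable_funTS; exact: measurable_fun_ltr_nat.
move=> t /=; rewrite in_itv/= andbT => t0.
by case: (t < z); rewrite ?mulr1 ?mulr0// ltW// mker_gt0.
Qed.

Lemma integrable_test phi : test_function setT phi ->
  mu.-integrable setT (EFin \o phi) /\ mu.-integrable setT (EFin \o phi^`()%classic).
Proof.
move=> tphi; have [M [B [M0 B0 phiB phiM]]] := test_function_bounded tphi.
have [sphi _] := tphi.
have H (f : R -> R) : continuous f -> (forall x, M < `|x| -> f x = 0) ->
    mu.-integrable setT (EFin \o f).
  move=> cf fM; have -> : f = f \_ `[- M, M].
    apply/funext => x; rewrite patchE mem_setE in_itv/= -ler_norml.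
    by case: (leP `|x| M) => // /fM.
  apply/integrable_patch => //; apply: continuous_compact_integrable; first exact: segment_compact.
  exact: continuous_subspaceT.
split; apply: H.
- exact: smooth_continuous.
- by move=> x /phiM[].
- exact: smooth_continuous (smooth_derive1 sphi).
- by move=> x /phiM[].
Qed.

Lemma integrable_normr_bound (D : set R) f : measurable D -> mu.-integrable setT (EFin \o f) ->
  exists2 C, 0 <= C & (\int[mu]_(x in D) `|f x|%:E <= C%:E)%E.
Proof.
move=> mD iF; have iD : mu.-integrable D (EFin \o f) by exact: lebesgue_integrableS iF.
exists (\int[mu]_(x in D) `|f x|); first by apply: Rintegral_ge0 => x _.
by rewrite /Rintegral fineK//; apply: integrable_fin_num => //; exact: (integrable_norm iD).
Qed.

(** Integration by parts carried out by Fubini, as [k] is merely integrable: the inner integral of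
    the derivative of [phi] over []b, t[] is [phi t - phi b]. *)
Lemma integral_tail_test phi (k : R -> R) (b : R) : test_function setT phi ->
  mu.-integrable `]b, +oo[ (EFin \o k) ->
  \int[mu]_(x in `]b, +oo[) (phi^`()%classic x * \int[mu]_(t in `]x, +oo[) k t) =
  \int[mu]_(t in `]b, +oo[) (phi t * k t) - (\int[mu]_(t in `]b, +oo[) k t) * phi b.
Proof.
move=> tphi ik; have [iphi idphi] := integrable_test tphi.
have [sphi _] := tphi.
have mphi := measurable_test tphi.
have mdphi := measurable_test_derive1 tphi.
have ib2 : mu.-integrable `]b, +oo[ (EFin \o (fun t => phi t * k t)).
  have [M [B [M0 B0 phiB phiM]]] := test_function_bounded tphi.
  rewrite (_ : EFin \o _ = fun t => (k t * phi t)%:E); last first.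
    by apply/funext => t; rewrite /= mulrC.
  apply: (integrable_boundedM (C := B) _ ik) => //; first exact: measurable_funTS.
  by move=> t _; have [] := phiB t.
have inner (t : R) : b < t -> \int[mu]_(x in `]b, +oo[) (phi^`()%classic x * (x < t)%R%:R) = phi t - phi b.
  move=> bt; rewrite -(Rintegral_derive1 sphi (ltW bt)).
  rewrite Rintegral_mkcond [RHS]Rintegral_mkcond; apply: eq_Rintegral => x _.
  rewrite !patchE !mem_setE !in_itv/= andbT.
  by case: (ltP x t) => xt; rewrite ?andbT ?andbF ?mulr1 ?mulr0 ?if_same.
have final : \int[mu]_(t in `]b, +oo[) (k t * (phi t - phi b)) =
    \int[mu]_(t in `]b, +oo[) (phi t * k t) - (\int[mu]_(t in `]b, +oo[) k t) * phi b.
  transitivity (\int[mu]_(t in `]b, +oo[) (1 * (phi t * k t) + - phi b * k t)).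
    by apply: eq_Rintegral => t _; ring.
  by rewrite Rintegral_lin2// mul1r mulNr mulrC.
have inner2 (x : R) : b < x -> \int[mu]_(t in `]x, +oo[) k t =
    \int[mu]_(t in `]b, +oo[) (k t * (x < t)%R%:R).
  move=> bx; rewrite Rintegral_mkcond [RHS]Rintegral_mkcond; apply: eq_Rintegral => t _.
  rewrite !patchE !mem_setE !in_itv/= !andbT; case: (ltP x t) => xt; rewrite ?mulr1 ?mulr0 ?if_same//.
  by rewrite (lt_trans bx xt).
have [C C0 HC] := integrable_normr_bound (measurable_itv `]b, +oo[) idphi.
have mh : measurable_fun setT (fun z : R * R => (z.1 < z.2)%R%:R : R).
  exact: measurable_fun_ltr_nat.
have bnd t : `]b, +oo[%classic t ->
    (\int[mu]_(x in `]b, +oo[) `|phi^`()%classic x * (x < t)%R%:R|%:E <= C%:E)%E.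
  move=> _; apply: le_trans HC; apply: ge0_le_integral => //.
  - apply/measurable_EFinP; apply: measurableT_comp => //; apply: measurable_funTS.
    by apply: measurable_funM => //; exact: measurable_fun_ltr_nat.
  - by apply/measurable_EFinP; apply: measurableT_comp => //; exact: measurable_funTS.
  - by move=> x _; rewrite lee_fin normrM; case: (x < t); rewrite ?normr1 ?normr0 ?mulr1 ?mulr0.
have [i1 E1] := kernel_swap_in (measurable_itv _) (measurable_itv _) ik (measurable_funTS mdphi) mh bnd.
transitivity (\int[mu]_(x in `]b, +oo[) (phi^`()%classic x *
    \int[mu]_(t in `]b, +oo[) (k t * (x < t)%R%:R))).
  apply: eq_Rintegral => x; rewrite inE/= in_itv/= andbT => bx.
  by rewrite (inner2 _ bx).
apply: (etrans E1); rewrite -final; apply: eq_Rintegral => t.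
by rewrite inE/= in_itv/= andbT => /inner ->.
Qed.

Lemma integrable_bker (b r : R) : r < b ->
  mu.-integrable `]b, +oo[ (EFin \o (fun t => bker b t r)).
Proof.
move=> rb; apply/integrableP; split.
  apply/measurable_EFinP; apply: measurable_funTS.
  exact: (measurableT_comp (measurable_bker al b) (pair2_measurable r)).
have -> : (\int[mu]_(t in `]b, +oo[) `|bker b t r|%:E)%E = mtot%:E.
  rewrite -(integral_bker_total al01 rb); apply: eq_integral => t /set_mem/=.
  by rewrite in_itv/= andbT => bt; rewrite ger0_norm// bker_ge0// ltW.
exact: ltry.
Qed.

Lemma integral_mint_test phi (b r : R) : test_function setT phi -> r < b ->
  \int[mu]_(x in `]b, +oo[) (phi^`()%classic x * mint ((b - r) / (x - b))) =
  \int[mu]_(t in `]b, +oo[) (phi t * bker b t r) - mtot * phi b.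
Proof.
move=> tphi rb.
have E : \int[mu]_(t in `]b, +oo[) bker b t r = mtot.
  exact: (congr1 fine (integral_bker_total al01 rb)).
rewrite -{1}E -(integral_tail_test tphi (integrable_bker rb)).
apply: eq_Rintegral => x; rewrite inE/= in_itv/= andbT => bx; congr (_ * _).
exact: (congr1 fine (esym (integral_bker al01 rb bx))).
Qed.

End extension_identity.

(** * The Abel integral beyond the right endpoint *)

Section right_of_interval.
Context {R : realType}.
Local Notation mu := (@lebesgue_measure R).
Variables (al a b : R).
Hypotheses (al01 : 0 < al < 1) (ab : a < b).
Implicit Types (phi u v : R -> R).

Local Notation mint := (mint al).
Local Notation mtot := (mtot al).
Local Notation abel := (abel al).
Local Notation sker := (sker al).
Local Notation frac_int := (frac_int al a b).
Local Notation primitive := (primitive a b).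

Lemma integral_causal (f : R -> \bar R) (r : R) : a <= r ->
  (forall s, s <= r -> f s = 0%E) ->
  (\int[mu]_(s in `]a, b[) f s = \int[mu]_(s in `]r, b[) f s)%E.
Proof.
move=> ar f0; rewrite integral_mkcond [RHS]integral_mkcond; apply: eq_integral => s _.
rewrite !patchE !mem_setE !in_itv/=; case: (ltP r s) => rs; first by rewrite (le_lt_trans ar rs).
by rewrite f0// if_same.
Qed.

Lemma measurable_skerl (x : R) : measurable_fun setT (sker b x).
Proof. exact: (measurableT_comp (measurable_sker al b) (pair1_measurable x)). Qed.

(** By Fubini it is enough to sweep each single kernel: [abel (s - y)] vanishes for [s <= y], so the
    integral over []a, b[] is the one over []y, b[] computed in [integral_abel_sker]. The columns
    are bounded because [x] is at distance [x - b] from the interval. *)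
Lemma frac_int_right u (x : R) : b < x -> mu.-integrable `]a, b[ (EFin \o u) ->
  mu.-integrable `]a, b[ (fun s => (sker b x s * frac_int u s)%:E) /\
  \int[mu]_(s in `]a, b[) (sker b x s * frac_int u s) = mtot * frac_int u x.
Proof.
move=> bx iu; have /andP[al0 al1] := al01.
have Ei (y : R) : a < y -> y < b ->
    (\int[mu]_(s in `]a, b[) (sker b x s * abel (s - y))%:E)%E = (mtot * abel (x - y))%:E.
  move=> ay yb; rewrite -(integral_abel_sker al01 yb bx) (@integral_causal _ y) ?(ltW ay)//.
    by apply: eq_integral => s _; rewrite mulrC.
  by move=> s sy; rewrite abelB_le0// mulr0.
have bnd (y : R) : `]a, b[%classic y ->
    (\int[mu]_(s in `]a, b[) `|sker b x s * abel (s - y)|%:E <= (mtot * (x - b) `^ (- al))%:E)%E.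
  rewrite /= in_itv/= => /andP[ay yb].
  rewrite (_ : (\int[mu]_(s in _) _)%E = (mtot * abel (x - y))%:E).
    by rewrite lee_fin ler_wpM2l ?(ltW (mtot_gt0 al01))// abelB_le.
  rewrite -Ei//; apply: eq_integral => s /set_mem/=; rewrite in_itv/= => /andP[_ sb].
  by rewrite ger0_norm// mulr_ge0 ?abel_ge0// sker_ge0// ltW.
have msk := measurable_skerl x.
have E2 : \int[mu]_(y in `]a, b[) (u y * \int[mu]_(s in `]a, b[) (sker b x s * abel (s - y))) =
    mtot * frac_int u x.
  have iux : mu.-integrable `]a, b[ (fun y => (u y * abel (x - y))%:E).
    apply: (integrable_boundedM (C := (x - b) `^ (- al)) _ iu) => //.
      by apply: measurable_funTS; exact: (measurableT_comp (measurable_abelB al) (pair1_measurable x)).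
    move=> y /=; rewrite in_itv/= => /andP[ay yb].
    by rewrite ger0_norm ?abel_ge0// abelB_le.
  rewrite -lebesgue_RintegralZl//; apply: eq_Rintegral => y; rewrite inE/= in_itv/= => /andP[ay yb].
  by rewrite mulrCA; congr (_ * _); exact: (congr1 fine (Ei _ ay yb)).
have [i1 E1] := kernel_swap_in (measurable_itv _) (measurable_itv _) iu (measurable_funTS msk) (measurable_abelB al) bnd.
by split; [exact: i1|exact: (etrans E1 E2)].
Qed.

(** The same averaging applied to an indicator: [sker b x] has mass [mint ((b - r) / (x - b))] on
    []r, b[]. *)
Lemma primitive_right v (x : R) : b < x -> mu.-integrable `]a, b[ (EFin \o v) ->
  \int[mu]_(s in `]a, b[) (sker b x s * primitive v s) =
  \int[mu]_(r in `]a, b[) (v r * mint ((b - r) / (x - b))).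
Proof.
move=> bx iv.
have Ei (r : R) : a < r -> r < b ->
    (\int[mu]_(s in `]a, b[) (sker b x s * (r < s)%R%:R)%:E)%E = (mint ((b - r) / (x - b)))%:E.
  move=> ar rb; rewrite -(integral_sker al01 rb bx) (@integral_causal _ r) ?(ltW ar)//.
    by apply: eq_integral => s /set_mem/=; rewrite in_itv/= => /andP[-> _]; rewrite mulr1.
  by move=> s sr; rewrite ltNge sr mulr0.
have bnd (r : R) : `]a, b[%classic r ->
    (\int[mu]_(s in `]a, b[) `|sker b x s * (r < s)%R%:R|%:E <= mtot%:E)%E.
  rewrite /= in_itv/= => /andP[ar rb].
  rewrite (_ : (\int[mu]_(s in _) _)%E = (mint ((b - r) / (x - b)))%:E).
    by rewrite lee_fin mint_le.
  rewrite -Ei//; apply: eq_integral => s /set_mem/=; rewrite in_itv/= => /andP[_ sb].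
  by rewrite ger0_norm// mulr_ge0// sker_ge0// ltW.
have msk := measurable_skerl x.
have [_ E1] := kernel_swap_in (measurable_itv _) (measurable_itv _) iv (measurable_funTS msk) measurable_ltr_nat bnd.
apply: (etrans E1); apply: eq_Rintegral => r; rewrite inE/= in_itv/= => /andP[ar rb].
by congr (_ * _); exact: (congr1 fine (Ei _ ar rb)).
Qed.

End right_of_interval.

Section extension_identity.
Context {R : realType}.
Local Notation mu := (@lebesgue_measure R).
Variables (al a b : R).
Hypotheses (al01 : 0 < al < 1) (ab : a < b).
Implicit Types (phi u v f : R -> R).

Local Notation mint := (mint al).
Local Notation mtot := (mtot al).
Local Notation abel := (abel al).
Local Notation sker := (sker al).
Local Notation bker := (bker al).
Local Notation frac_int := (frac_int al a b).
Local Notation primitive := (primitive a b).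

(* The weak derivative of the zero extension, to the right of [b]. *)
Definition right_part v (x : R) : R :=
  - mtot^-1 * ((b < x)%R%:R * \int[mu]_(r in `]a, b[) (v r * bker b x r)).

Lemma Rintegral_split f : mu.-integrable setT (EFin \o f) -> (forall x, x <= a -> f x = 0) ->
  \int[mu]_x f x = \int[mu]_(x in `]a, b[) f x + \int[mu]_(x in `]b, +oo[) f x.
Proof.
move=> iF f0.
have i1 : mu.-integrable `]a, +oo[ (EFin \o f) by exact: lebesgue_integrableS iF.
have i2 : mu.-integrable `]a, b[ (EFin \o f) by exact: lebesgue_integrableS iF.
have E : \int[mu]_x f x = \int[mu]_(x in `]a, +oo[) f x.
  rewrite [RHS]Rintegral_mkcond; apply: eq_Rintegral => x _.
  by rewrite patchE mem_setE in_itv/= andbT; case: (ltP a x) => // /f0.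
have := Rintegral_itvB (x := b) i1; rewrite !bnd_simp => /(_ (ltW ab) isT) <-.
by rewrite (Rintegral_itv_bndo_bndc i2) E addrC subrK.
Qed.

Lemma ae_eq_Rintegral (D : set R) f g : measurable D -> measurable_fun D f -> measurable_fun D g ->
  {ae mu, forall x, D x -> f x = g x} -> \int[mu]_(x in D) f x = \int[mu]_(x in D) g x.
Proof.
move=> mD mf mg fg; rewrite /Rintegral; congr fine.
by apply: ae_eq_integral => //; [exact/measurable_EFinP|exact/measurable_EFinP|apply: ae_lebesgueS fg => x fg /fg ->].
Qed.

Lemma measurable_mint_frac : measurable_fun setT (fun z : R * R => mint ((b - z.2) / (z.1 - b))).
Proof.
apply: (measurableT_comp (measurable_mint al01)); apply: measurable_funM.
  exact: measurable_funB.
by apply: measurable_fun_inv; exact: measurable_funB.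
Qed.

(** The columns of [bker] all have mass [mtot], so a bounded [phi] can be paired with the kernel and
    the order of integration exchanged. *)
Lemma right_part_swap v phi : mu.-integrable `]a, b[ (EFin \o v) -> test_function setT phi ->
  [/\ mu.-integrable setT (fun x => (phi x * right_part v x)%:E),
  mu.-integrable `]a, b[ (fun r => (v r * \int[mu]_(t in `]b, +oo[) (phi t * bker b t r))%:E) &
  \int[mu]_(r in `]a, b[) (v r * \int[mu]_(t in `]b, +oo[) (phi t * bker b t r)) =
  - mtot * \int[mu]_x (phi x * right_part v x)].
Proof.
move=> iv tphi; have [M [B [M0 B0 phiB _]]] := test_function_bounded tphi.
have mphi := measurable_test tphi.
have bnd (r : R) : `]a, b[%classic r ->
    (\int[mu]_(t in `]b, +oo[) `|phi t * bker b t r|%:E <= (B * mtot)%:E)%E.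
  rewrite /= in_itv/= => /andP[ar rb].
  have mbk : measurable_fun setT (fun t : R => bker b t r).
    exact: (measurableT_comp (measurable_bker al b) (pair2_measurable r)).
  rewrite EFinM -(integral_bker_total al01 rb) -ge0_integralZl//; last 3 first.
  - by apply/measurable_EFinP; exact: measurable_funTS.
  - by move=> t; rewrite /= in_itv/= andbT => bt; rewrite lee_fin bker_ge0// ltW.
  - by rewrite lee_fin ltW.
  apply: ge0_le_integral => //.
  - by apply/measurable_EFinP; apply: measurable_funTS; apply: measurableT_comp => //; exact: measurable_funM.
  - by apply/measurable_EFinP; apply: measurable_funTS; exact: measurable_funM.
  - move=> t; rewrite /= in_itv/= andbT => bt; rewrite -EFinM lee_fin normrM.
    by rewrite (ger0_norm (bker_ge0 _ _ _)) ?ler_wpM2r ?bker_ge0 ?(ltW rb)//; have [] := phiB t.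
have mt := mtot_gt0 al01.
pose H x := \int[mu]_(r in `]a, b[) (v r * bker b x r).
have E (x : R) : phi x * right_part v x = - mtot^-1 * ((fun x => phi x * H x) \_ `]b, +oo[) x.
  rewrite patchE mem_setE in_itv/= andbT /right_part -/(H x).
  by case: (ltP b x) => bx; rewrite ?mul1r ?mul0r ?mulr0// mulrCA.
have key : mu.-integrable `]b, +oo[ (EFin \o (fun x => phi x * H x)) ->
    mu.-integrable setT (fun x => (phi x * right_part v x)%:E) /\
    \int[mu]_(x in `]b, +oo[) (phi x * H x) = - mtot * \int[mu]_x (phi x * right_part v x).
  move=> iH.
  have i2 : mu.-integrable setT (EFin \o ((fun x => phi x * H x) \_ `]b, +oo[)) by apply/integrable_patch.
  split.
    have := lebesgue_integrableZl (- mtot^-1) measurableT i2.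
    by apply: eq_integrable => // x _; rewrite E.
  have -> : \int[mu]_x (phi x * right_part v x) = - mtot^-1 * \int[mu]_(x in `]b, +oo[) (phi x * H x).
    rewrite [X in _ * X]Rintegral_mkcond -(lebesgue_RintegralZl _ measurableT i2).
    by apply: eq_Rintegral => x _; rewrite E.
  by rewrite mulrA mulrNN mulfV ?gt_eqF// mul1r.
have [i1 E1] := kernel_swap_in (measurable_itv _) (measurable_itv _) iv (measurable_funTS mphi) (measurable_bker al b) bnd.
have [i2 E2] := key i1.
split; [exact: i2| |exact: (etrans (esym E1) E2)].
exact: kernel_swap_integrable (measurable_itv _) (measurable_itv _) iv (measurable_funTS mphi) (measurable_bker al b) bnd.
Qed.

(** The integral of the derivative of [phi] against [frac_int u] is split at [a] and [b]. Inside,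
    [g * frac_int u] is the primitive of [v]; beyond [b] it is an average of that primitive. Either
    integration by parts leaves [phi b] times the integral of [v], with opposite signs. *)
Lemma extension_identity u v phi :
  mu.-integrable `]a, b[ (EFin \o u) -> mu.-integrable `]a, b[ (EFin \o v) ->
  {ae mu, forall x, a < x < b -> (Gamma (1 - al))^-1 * frac_int u x = primitive v x} ->
  test_function setT phi ->
  \int[mu]_(x in `]a, b[) (u x * frac_der plus al phi x) =
  \int[mu]_(x in `]a, b[) (v x * phi x) + \int[mu]_x (phi x * right_part v x).
Proof.
move=> iu iv uv tphi; have mt := mtot_gt0 al01.
have [_ iR ER] := right_part_swap iv tphi.
have [i1 E1] := frac_der_swap al01 iu tphi.
have [i2 E2] := primitive_swap ab iv tphi.
move: uv E1; set g := (Gamma (1 - al))^-1 => uv E1.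
have iw := integrable_frac_int al01 iu; have iF := integrable_primitive ab iv.
have mw : measurable_fun `]a, b[ (frac_int u) by have /integrableP[/measurable_EFinP] := iw.
have mF : measurable_fun `]a, b[ (primitive v) by have /integrableP[/measurable_EFinP] := iF.
have [iphi idphi] := integrable_test tphi.
have mdphi : measurable_fun setT phi^`()%classic by have /integrableP[/measurable_EFinP] := idphi.
have mphi : measurable_fun setT phi by have /integrableP[/measurable_EFinP] := iphi.
pose V := \int[mu]_(r in `]a, b[) v r.
have ivphi : mu.-integrable `]a, b[ (EFin \o (fun x => v x * phi x)).
  have [M [B [_ _ phiB _]]] := test_function_bounded tphi.
  apply: (integrable_boundedM (C := B) _ iv) => //; last by move=> x _; have [] := phiB x.
  exact: measurable_funTS.
have EV (f : R -> R) (c : R) : mu.-integrable `]a, b[ (EFin \o (fun r => v r * f r)) ->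
    \int[mu]_(r in `]a, b[) (v r * (f r - c)) = \int[mu]_(r in `]a, b[) (v r * f r) - c * V.
  move=> iF'; transitivity (\int[mu]_(r in `]a, b[) (1 * (v r * f r) + - c * v r)).
    by apply: eq_Rintegral => r _; ring.
  by rewrite Rintegral_lin2// mul1r mulNr.
(* The inner part, with boundary term [phi b * V] at the right end. *)
have A1 : g * \int[mu]_(x in `]a, b[) (phi^`()%classic x * frac_int u x) =
    phi b * V - \int[mu]_(x in `]a, b[) (v x * phi x).
  have i3 : mu.-integrable `]a, b[ (EFin \o (fun x => phi^`()%classic x * frac_int u x)).
    exact: lebesgue_integrableS i1.
  have EF : \int[mu]_(r in `]a, b[) (v r * (phi b - phi r)) = - \int[mu]_(r in `]a, b[) (v r * (phi r - phi b)).
    transitivity (\int[mu]_(r in `]a, b[) (-1 * (v r * (phi r - phi b)))).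
      by apply: eq_Rintegral => r _; ring.
    rewrite lebesgue_RintegralZl ?mulN1r//.
    have := lebesgue_integrableB (measurable_itv _) ivphi (lebesgue_integrableZl (phi b) (measurable_itv _) iv).
    by apply: eq_integrable => // r _ /=; congr EFin; ring.
  rewrite -(lebesgue_RintegralZl g _ i3)//.
  transitivity (\int[mu]_(x in `]a, b[) (phi^`()%classic x * primitive v x)).
    apply: ae_eq_Rintegral => //.
    - by do 2 apply: measurable_funM => //; exact: measurable_funTS.
    - by apply: measurable_funM => //; exact: measurable_funTS.
    - by apply: ae_lebesgueS uv => x h; rewrite /= in_itv/= => /h <-; rewrite mulrCA.
  by rewrite E2 EF EV// opprB.
have A2 (x : R) : b < x -> mtot * (g * frac_int u x) =
    \int[mu]_(r in `]a, b[) (v r * mint ((b - r) / (x - b))).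
  move=> bx; have msk := measurable_skerl al b x.
  have [i3 E3] := frac_int_right al01 bx iu.
  rewrite mulrCA -E3 -(primitive_right al01 bx iv) -(lebesgue_RintegralZl g _ i3)//.
  apply: ae_eq_Rintegral => //.
  - by do 2 apply: measurable_funM => //; exact: measurable_funTS.
  - by apply: measurable_funM => //; exact: measurable_funTS.
  - by apply: ae_lebesgueS uv => y h; rewrite /= in_itv/= => /h <-; rewrite mulrCA.
(* The outer part, scaled by [mtot]; the term [- (mtot * phi b) * V] cancels the boundary term of
   the inner part. *)
have A3 : mtot * (g * \int[mu]_(x in `]b, +oo[) (phi^`()%classic x * frac_int u x)) =
    - mtot * \int[mu]_x (phi x * right_part v x) - (mtot * phi b) * V.
  have i3 : mu.-integrable `]b, +oo[ (EFin \o (fun x => phi^`()%classic x * frac_int u x)).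
    exact: lebesgue_integrableS i1.
  rewrite -ER -(EV _ _ iR) mulrA -(lebesgue_RintegralZl (mtot * g) _ i3)//.
  have [C C0 HC] := integrable_normr_bound (measurable_itv `]b, +oo[) idphi.
  have bnd (r : R) : `]a, b[%classic r ->
      (\int[mu]_(x in `]b, +oo[) `|phi^`()%classic x * mint ((b - r) / (x - b))|%:E <= (mtot * C)%:E)%E.
    move=> _; apply: (@le_trans _ _ (mtot%:E * \int[mu]_(x in `]b, +oo[) `|phi^`()%classic x|%:E)%E).
      rewrite -ge0_integralZl//; last 2 first.
      - by apply/measurable_EFinP; apply: measurableT_comp => //; exact: measurable_funTS.
      - by rewrite lee_fin ltW.
      apply: ge0_le_integral => //.
      - apply/measurable_EFinP; apply: measurable_funTS; apply: measurableT_comp => //.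
        apply: measurable_funM => //.
        exact: (measurableT_comp measurable_mint_frac (pair2_measurable r)).
      - apply: measurable_funeM; apply/measurable_EFinP; apply: measurableT_comp => //.
        exact: measurable_funTS.
      - move=> x _; rewrite -EFinM lee_fin normrM mulrC ler_wpM2r//.
        by rewrite ger0_norm ?mint_ge0 ?mint_le.
    by rewrite EFinM lee_wpmul2l// lee_fin ltW.
  have [_ E3] := kernel_swap_in (measurable_itv _) (measurable_itv _) iv (measurable_funTS mdphi) measurable_mint_frac bnd.
  transitivity (\int[mu]_(x in `]b, +oo[) (phi^`()%classic x *
      \int[mu]_(r in `]a, b[) (v r * mint ((b - r) / (x - b))))).
    apply: eq_Rintegral => x; rewrite inE/= in_itv/= andbT => /A2 <-.
    by ring.
  apply: (etrans E3); apply: eq_Rintegral => r; rewrite inE/= in_itv/= => /andP[ar rb].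
  by rewrite integral_mint_test.
(* Causality: before [a] the Abel integral vanishes, so no third piece occurs. *)
have w0 (x : R) : x <= a -> phi^`()%classic x * frac_int u x = 0.
  move=> xa; rewrite [frac_int u x](_ : _ = 0) ?mulr0//.
  rewrite [LHS]/(Rintegral _ _ _) /Rintegral integral0_eq// => y; rewrite /= in_itv/= => /andP[ay _].
  by rewrite abelB_le0 ?mulr0// (le_trans xa)// ltW.
rewrite E1 (Rintegral_split i1 w0) mulNr mulrDr A1.
apply: (mulfI (lt0r_neq0 mt)); rewrite !mulrDr mulrN mulrDr A3.
move: (\int[mu]_(x in _) _) (\int[mu]_x _) => X Y; ring.
Qed.

End extension_identity.

(** * The Schur test *)

Section schur.
Context {R : realType}.
Local Notation mu := (@lebesgue_measure R).
Implicit Types (D E : set R) (v : R -> R).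

(** [H] has a sign only on [D] times [E], so Tonelli is applied to the product of both indicators
    with its absolute value. *)
Lemma tonelli_in D E (H : R -> R -> R) : measurable D -> measurable E ->
  measurable_fun setT (fun z : R * R => H z.1 z.2) ->
  (forall x r, D x -> E r -> 0 <= H x r) ->
  [/\ measurable_fun D (fun x => \int[mu]_(r in E) (H x r)%:E)%E,
      measurable_fun E (fun r => \int[mu]_(x in D) (H x r)%:E)%E &
  (\int[mu]_(x in D) \int[mu]_(r in E) (H x r)%:E =
   \int[mu]_(r in E) \int[mu]_(x in D) (H x r)%:E)%E].
Proof.
move=> mD mE mH H0.
pose K (z : R * R) : \bar R := (\1_D z.1 * (\1_E z.2 * `|H z.1 z.2|))%:E.
have mK : measurable_fun setT K.
  apply/measurable_EFinP; apply: measurable_funM.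
    by apply: measurableT_comp => //; exact: measurable_indic.
  apply: measurable_funM; first by apply: measurableT_comp => //; exact: measurable_indic.
  exact: measurableT_comp.
have K0 z : (0 <= K z)%E by rewrite lee_fin !mulr_ge0.
have KE (x r : R) : D x -> E r -> K (x, r) = (H x r)%:E.
  by move=> Dx Er; rewrite /K /= !indicE !mem_set// !mul1r ger0_norm// H0.
have KD (x r : R) : x \notin D -> K (x, r) = 0%E.
  by move=> Dx; rewrite /K /= !indicE (negbTE Dx) mul0r.
have KF (x r : R) : r \notin E -> K (x, r) = 0%E.
  by move=> Er; rewrite /K /= !indicE (negbTE Er) mul0r mulr0.
have E1 (x : R) : D x -> (\int[mu]_r K (x, r) = \int[mu]_(r in E) (H x r)%:E)%E.
  move=> Dx; rewrite [RHS]integral_mkcond; apply: eq_integral => r _; rewrite patchE.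
  by case: ifPn => [/set_mem Er|Er]; [rewrite KE|rewrite KF].
have E2 (r : R) : E r -> (\int[mu]_x K (x, r) = \int[mu]_(x in D) (H x r)%:E)%E.
  move=> Er; rewrite [RHS]integral_mkcond; apply: eq_integral => x _; rewrite patchE.
  by case: ifPn => [/set_mem Dx|Dx]; [rewrite KE|rewrite KD].
split.
- apply: (eq_measurable_fun (fun x => \int[mu]_r K (x, r))%E) => [x /set_mem/E1//|].
  by apply: measurable_funTS; exact: (@measurable_fun_fubini_tonelli_F _ _ _ _ R mu K mK K0).
- apply: (eq_measurable_fun (fun r => \int[mu]_x K (x, r))%E) => [r /set_mem/E2//|].
  by apply: measurable_funTS; exact: (@measurable_fun_fubini_tonelli_G _ _ _ _ R mu K mK K0).
transitivity (\int[mu]_x \int[mu]_r K (x, r))%E.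
  rewrite integral_mkcond; apply: eq_integral => x _; rewrite patchE.
  case: ifPn => [/set_mem/E1//|Dx].
  by rewrite integral0_eq// => r _; rewrite KD.
rewrite (@fubini_tonelli _ _ _ _ R mu mu K mK K0) [RHS]integral_mkcond.
apply: eq_integral => r _; rewrite patchE.
case: ifPn => [/set_mem/E2//|Er].
by rewrite integral0_eq// => x _; rewrite KF.
Qed.

Lemma stieltjes_patch (e t : R) : -1 < e < 0 -> 0 < t ->
  [/\ measurable_fun setT (fun s : R => ((fun s => s `^ e / (t + s)) \_ `]0, +oo[ s)%:E),
      (forall s, 0 <= ((fun s => s `^ e / (t + s)) \_ `]0, +oo[ s)%:E)%E &
      (\int[mu]_s ((fun s => s `^ e / (t + s)) \_ `]0%R, +oo[ s)%:E <=
        (stieltjes_bound e * t `^ e)%:E)%E].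
Proof.
move=> e01 t0; split.
- apply/measurable_EFinP; apply/(measurable_restrictT _ (measurable_itv _)).
  exact: measurable_stieltjes_kernel.
- move=> s; rewrite lee_fin patchE mem_setE in_itv/= andbT; case: ifPn => // s0.
  by rewrite divr_ge0 ?powR_ge0// addr_ge0// ltW.
- rewrite (le_trans _ (stieltjes_integral_le e01 t0))// [leRHS]integral_mkcond.
  by rewrite le_eqVlt; apply/orP; left; apply/eqP; apply: eq_integral => s _; rewrite !patchE; case: ifPn.
Qed.

Lemma stieltjes_left D (e b t : R) : -1 < e < 0 -> 0 < t -> measurable D ->
  (forall r, D r -> r < b) ->
  (\int[mu]_(r in D) ((b - r) `^ e / (t + (b - r)))%:E <= (stieltjes_bound e * t `^ e)%:E)%E.
Proof.
move=> e01 t0 mD Db; have [mf f0 fle] := stieltjes_patch e01 t0.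
apply: le_trans fle; rewrite -(ge0_integral_subl b mf f0).
have mg := measurableT_comp mf (measurable_subl b).
apply: (@le_trans _ _ (\int[mu]_(r in D) ((fun s => s `^ e / (t + s)) \_ `]0%R, +oo[ (b - r)%R)%:E)%E); last first.
  exact: ge0_subset_integral.
rewrite le_eqVlt; apply/orP; left; apply/eqP; apply: eq_integral => r /set_mem/Db rb.
by rewrite patchE mem_setE in_itv/= andbT subr_gt0 rb.
Qed.

Lemma stieltjes_right D (e b t : R) : -1 < e < 0 -> 0 < t -> measurable D ->
  (forall r, D r -> b < r) ->
  (\int[mu]_(r in D) ((r - b) `^ e / (t + (r - b)))%:E <= (stieltjes_bound e * t `^ e)%:E)%E.
Proof.
move=> e01 t0 mD Db; have [mf f0 fle] := stieltjes_patch e01 t0.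
apply: le_trans fle; rewrite -(ge0_integral_subl 0 mf f0).
have mg := measurableT_comp mf (measurable_subl 0).
rewrite -(ge0_integral_subl b mg (fun s => f0 (0 - s))).
have mh := measurableT_comp mg (measurable_subl b).
apply: (@le_trans _ _ (\int[mu]_(r in D) ((fun s => s `^ e / (t + s)) \_ `]0%R, +oo[ (0 - (b - r))%R)%:E)%E); last first.
  exact: ge0_subset_integral.
rewrite le_eqVlt; apply/orP; left; apply/eqP; apply: eq_integral => r /set_mem/Db br.
by rewrite sub0r opprB patchE mem_setE in_itv/= andbT subr_gt0 br.
Qed.

(* The optimal level satisfies [l `^ p = S / X]. *)
Lemma powR_level_le (p t X : R) (S : \bar R) : 1 <= p -> 0 < X -> 0 <= t -> (0 <= S)%E ->
  (forall l, 0 < l -> (t%:E <= (l * X)%:E + (l `^ (1 - p))%:E * S)%E) ->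
  ((t `^ p)%:E <= (2 `^ p * X `^ (p - 1))%:E * S)%E.
Proof.
move=> p1 X0 t0 S0 H; have p0 : 0 < p by rewrite (lt_le_trans _ p1).
have c0 : 0 < 2 `^ p * X `^ (p - 1) :> R by rewrite mulr_gt0 ?powR_gt0.
case: S S0 H => [s| |//]; last by move=> _ _; rewrite gt0_muley ?lte_fin// leey.
(* For [S = 0] the optimal level degenerates to [0]; the levels [e / X] with arbitrarily small [e]
   force [t = 0]. *)
rewrite lee_fin le_eqVlt => /predU1P[<- H|s0 H].
  rewrite mule0 lee_fin; suff -> : t = 0 by rewrite powR0 ?gt_eqF.
  apply/eqP; rewrite eq_le t0 andbT; apply/ler_addgt0Pr => e e0; rewrite add0r.
  by have := H (e / X) (divr_gt0 e0 X0); rewrite mule0 adde0 divfK ?gt_eqF.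
pose l := (s / X) `^ p^-1.
have l0 : 0 < l by apply: powR_gt0; exact: divr_gt0.
have lp : l `^ p = s / X by rewrite -powRrM mulVf ?gt_eqF// powRr1// ltW// divr_gt0.
have := H l l0; rewrite -EFinM -EFinD !lee_fin.
have -> : l `^ (1 - p) * s = l * X.
  by rewrite gt0_powRD// powRr1 ?(ltW l0)// powRN lp invf_div -!mulrA mulVf ?gt_eqF ?mulr1.
rewrite -mulr2n => tl; apply: (@le_trans _ _ ((l * X *+ 2) `^ p)).
  by apply: ge0_ler_powR => //; rewrite ?nnegrE ?(ltW p0)//; exact: (le_trans t0 tl).
rewrite -mulr_natl powRM//; last by rewrite mulr_ge0// ltW.
rewrite (powRM _ (ltW l0) (ltW X0)) lp.
rewrite -(mulr_powRB1 (ltW X0) p0) (mulrA (s / X)) divfK ?gt_eqF//.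
by rewrite -mulrA (mulrC s).
Qed.

End schur.

(** * The [L^p] bound for the derivative to the right of the interval *)

Section right_part_bound.
Context {R : realType}.
Local Notation mu := (@lebesgue_measure R).
Variables (al p : R).
Hypotheses (al01 : 0 < al < 1) (p1 : 1 <= p) (alp : al * p < 1).
Implicit Types (a b : R) (v : R -> R).

Local Notation bker := (bker al).
Local Notation mtot := (mtot al).

Let al0 : 0 < al. Proof. by case/andP: al01. Qed.
Let p0 : 0 < p. Proof. by rewrite (lt_le_trans _ p1). Qed.
Let pV0 : 0 < p^-1. Proof. by rewrite invr_gt0. Qed.
Let pV1 : p^-1 <= 1. Proof. by rewrite invf_le1. Qed.
Let alpV : al < p^-1. Proof. by rewrite -[p^-1]mul1r ltr_pdivlMr. Qed.

(** With [exp2], the exponents of the two Stieltjes integrals. The bound [al < p^-1] yields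
    convergence at infinity for the first and at [0] for the second; the opposite ends use [0 < al]
    and [p^-1 <= 1]. *)
Let exp1 : -1 < al - p^-1 < 0.
Proof. by move: al0 pV1 alpV; move: (p^-1) => q a0 q1 aq; apply/andP; split; lra. Qed.

Let exp2 : -1 < p^-1 - 1 - al < 0.
Proof. by move: al0 pV1 alpV; move: (p^-1) => q a0 q1 aq; apply/andP; split; lra. Qed.

Let bker_sum b x r e f : r < b -> b < x ->
  (b - r) `^ e * (x - b) `^ f * bker b x r =
  (b - r) `^ (al + e) * (x - b) `^ (f - al) / ((x - b) + (b - r)).
Proof.
move=> rb bx; rewrite bkerE// (_ : x - b + (b - r) = x - r); last by ring.
by rewrite !gt0_powRD ?subr_gt0//; ring.
Qed.

(** The Schur weight turns the kernel into a Stieltjes kernel in [b - r]; extending the integral to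
    all [r < b] makes the bound independent of [a]. *)
Lemma integral_bker_left a b x : b < x ->
  (\int[mu]_(r in `]a, b[) ((b - r) `^ (- p^-1) * bker b x r)%:E <=
   (stieltjes_bound (al - p^-1) * (x - b) `^ (- p^-1))%:E)%E.
Proof.
move=> bx; have x0 : 0 < x - b by rewrite subr_gt0.
have H : (\int[mu]_(r in `]a, b[) ((b - r) `^ (- p^-1) * bker b x r)%:E =
  ((x - b) `^ (- al))%:E * \int[mu]_(r in `]a, b[) ((b - r) `^ (al - p^-1) / ((x - b) + (b - r)))%:E)%E.
  rewrite -ge0_integralZl//; last 3 first.
  - apply/measurable_EFinP; apply: measurable_funTS.
    have mb : measurable_fun setT (fun r : R => b - r) by exact: measurable_subl.
    apply: measurable_funM; first exact: measurable_fun_powR.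
    by apply: measurable_fun_inv; exact: measurable_funD.
  - move=> r /=; rewrite in_itv/= => /andP[_ rb].
    by rewrite lee_fin divr_ge0 ?powR_ge0// addr_ge0 ?subr_ge0 ?(ltW rb) ?(ltW bx).
  - by rewrite lee_fin powR_ge0.
  apply: eq_integral => r /set_mem/=; rewrite in_itv/= => /andP[_ rb].
  rewrite -EFinM; congr EFin; have := bker_sum (- p^-1) 0 rb bx.
  by rewrite powRr0 mulr1 add0r => ->; ring.
rewrite H (_ : stieltjes_bound _ * _ = (x - b) `^ (- al) *
  (stieltjes_bound (al - p^-1) * (x - b) `^ (al - p^-1))); last first.
  by rewrite mulrCA -gt0_powRD// addKr.
rewrite [leRHS]EFinM lee_wpmul2l ?lee_fin ?powR_ge0//.
apply: stieltjes_left => // r /=; rewrite in_itv/= => /andP[_ rb]; exact: rb.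
Qed.

(** The dual integral. Its weight [(x - b) ^ (p^-1 - 1)] is the output [(x - b) ^ (- p^-1)] of the
    first one raised to the power [p - 1]. *)
Lemma integral_bker_right b r : r < b ->
  (\int[mu]_(x in `]b, +oo[) ((x - b) `^ (p^-1 - 1) * bker b x r)%:E <=
   (stieltjes_bound (p^-1 - 1 - al) * (b - r) `^ (p^-1 - 1))%:E)%E.
Proof.
move=> rb; have r0 : 0 < b - r by rewrite subr_gt0.
have H : (\int[mu]_(x in `]b, +oo[) ((x - b) `^ (p^-1 - 1) * bker b x r)%:E =
  ((b - r) `^ al)%:E * \int[mu]_(x in `]b, +oo[) ((x - b) `^ (p^-1 - 1 - al) / ((b - r) + (x - b)))%:E)%E.
  rewrite -ge0_integralZl//; last 3 first.
  - apply/measurable_EFinP; apply: measurable_funTS.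
    have mb : measurable_fun setT (fun x : R => x - b) by exact: measurable_funB.
    apply: measurable_funM; first exact: measurable_fun_powR.
    by apply: measurable_fun_inv; exact: measurable_funD.
  - move=> x /=; rewrite in_itv/= andbT => bx.
    by rewrite lee_fin divr_ge0 ?powR_ge0// addr_ge0 ?subr_ge0 ?(ltW rb) ?(ltW bx).
  - by rewrite lee_fin powR_ge0.
  apply: eq_integral => x /set_mem/=; rewrite in_itv/= andbT => bx.
  rewrite -EFinM; congr EFin; have := bker_sum 0 (p^-1 - 1) rb bx.
  by rewrite powRr0 mul1r addr0 => ->; rewrite (addrC (x - b)); ring.
rewrite H (_ : stieltjes_bound _ * _ = (b - r) `^ al *
  (stieltjes_bound (p^-1 - 1 - al) * (b - r) `^ (p^-1 - 1 - al))); last first.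
  by rewrite mulrCA -gt0_powRD// subrKC.
rewrite [leRHS]EFinM lee_wpmul2l ?lee_fin ?powR_ge0//.
apply: stieltjes_right => // x /=; rewrite in_itv/= andbT; exact.
Qed.

(** The factor [mtot^-1] normalizes [right_part], [2 ^ p] is lost in [powR_level_le], and the two
    [stieltjes_bound] come from integrating in [r] and in [x]. *)
Definition schur_const : R := mtot^-1 `^ p * (2 `^ p *
  stieltjes_bound (al - p^-1) `^ (p - 1) * stieltjes_bound (p^-1 - 1 - al)).

Lemma schur_const_ge0 : 0 <= schur_const.
Proof.
by rewrite !mulr_ge0 ?powR_ge0 ?(ltW (stieltjes_bound_gt0 _)).
Qed.

(* [normr_le_level] at the level [l * (b - r) `^ (- p^-1)], the Schur weight. *)
Lemma bker_integral_le a b v x : b < x -> measurable_fun `]a, b[ v ->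
  ((`|\int[mu]_(r in `]a, b[) (v r * bker b x r)| `^ p)%:E <=
   (2 `^ p * (stieltjes_bound (al - p^-1) * (x - b) `^ (- p^-1)) `^ (p - 1))%:E *
   \int[mu]_(r in `]a, b[) (((b - r) `^ (1 - p^-1) * `|v r| `^ p) * bker b x r)%:E)%E.
Proof.
move=> bx mv; have x0 : 0 < x - b by rewrite subr_gt0.
have mb : measurable_fun setT (fun r : R => b - r) by exact: measurable_subl.
have mk : measurable_fun `]a, b[ (fun r : R => bker b x r).
  by apply: measurable_funTS; exact: (measurableT_comp (measurable_bker al b) (pair1_measurable x)).
have mp e : measurable_fun `]a, b[ (fun r : R => (b - r) `^ e).
  by apply: measurable_funTS; exact: measurable_fun_powR.
have mvp : measurable_fun `]a, b[ (fun r : R => `|v r| `^ p).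
  by apply: (measurableT_comp (measurable_powR p)); exact: measurableT_comp.
have k0 r : `]a, b[%classic r -> 0 <= bker b x r.
  by rewrite /= in_itv/= => /andP[_ rb]; rewrite bker_ge0// ltW.
apply: powR_level_le => //.
- by rewrite mulr_gt0 ?powR_gt0 ?stieltjes_bound_gt0.
- by apply: integral_ge0 => r /k0 kr; rewrite lee_fin mulr_ge0// mulr_ge0 ?powR_ge0.
move=> l l0; apply: le_trans (normr_Rintegral_le _ _) _ => //; first exact: measurable_funM.
apply: (@le_trans _ _ (\int[mu]_(r in `]a, b[) (l%:E * ((b - r) `^ (- p^-1) * bker b x r)%:E +
   (l `^ (1 - p))%:E * (((b - r) `^ (1 - p^-1) * `|v r| `^ p) * bker b x r)%:E))%E).
  apply: ge0_le_integral => //.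
  - by apply/measurable_EFinP; apply: measurableT_comp => //; exact: measurable_funM.
  - apply: emeasurable_funD.
      by apply: measurable_funeM; apply/measurable_EFinP; apply: measurable_funM => //; exact: mp.
    apply: measurable_funeM; apply/measurable_EFinP; apply: measurable_funM => //.
    by apply: measurable_funM => //; exact: mp.
  - move=> r Dr; have kr := k0 _ Dr; move: Dr; rewrite /= in_itv/= => /andP[_ rb].
    have r0 : 0 < b - r by rewrite subr_gt0.
    rewrite -!EFinM -EFinD lee_fin normrM (ger0_norm kr).
    move: (bker b x r) kr => k kr.
    rewrite (_ : _ + _ = (l * (b - r) `^ (- p^-1) +
      l `^ (1 - p) * ((b - r) `^ (1 - p^-1) * `|v r| `^ p)) * k); last by ring.
    rewrite ler_wpM2r//; apply: le_trans (normr_le_level p1 (_ : 0 < l * (b - r) `^ (- p^-1)) _) _ => //.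
      by rewrite mulr_gt0 ?powR_gt0.
    rewrite lerD2l powRM ?powR_ge0 ?(ltW l0)// -powRrM -mulrA.
    rewrite (_ : - p^-1 * (1 - p) = 1 - p^-1)//.
    by rewrite mulrBr mulr1 mulNr mulVf ?gt_eqF// opprK addrC.
rewrite ge0_integralD//; last 4 first.
- by move=> r /k0 kr; rewrite -EFinM lee_fin mulr_ge0 ?(ltW l0)// mulr_ge0 ?powR_ge0.
- by apply: measurable_funeM; apply/measurable_EFinP; apply: measurable_funM => //; exact: mp.
- by move=> r /k0 kr; rewrite -EFinM lee_fin mulr_ge0 ?powR_ge0// mulr_ge0// mulr_ge0 ?powR_ge0.
- by apply: measurable_funeM; apply/measurable_EFinP; apply: measurable_funM => //; apply: measurable_funM => //; exact: mp.
rewrite !ge0_integralZl//; last 6 first.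
- by apply/measurable_EFinP; apply: measurable_funM => //; apply: measurable_funM => //; exact: mp.
- by move=> r /k0 kr; rewrite lee_fin mulr_ge0// mulr_ge0 ?powR_ge0.
- by rewrite lee_fin powR_ge0.
- by apply/measurable_EFinP; apply: measurable_funM => //; exact: mp.
- by move=> r /k0 kr; rewrite lee_fin mulr_ge0 ?powR_ge0.
- by rewrite lee_fin ltW.
apply: leeD => //; rewrite EFinM lee_wpmul2l ?lee_fin ?(ltW l0)//.
exact: integral_bker_left.
Qed.

Let A := stieltjes_bound (al - p^-1).
Let A' := stieltjes_bound (p^-1 - 1 - al).
Let A_gt0 : 0 < A. Proof. exact: stieltjes_bound_gt0. Qed.

(** The integrand left after the first half of the test, with all powers of [x - b] and [b - r]
    displayed, ready for Tonelli. *)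
Let S b v x r := (x - b) `^ (p^-1 - 1) * (((b - r) `^ (1 - p^-1) * `|v r| `^ p) * bker b x r).

Let measurable_S b v : measurable_fun setT v ->
  measurable_fun setT (fun z : R * R => S b v z.1 z.2).
Proof.
move=> mv; apply: measurable_funM; first by apply: measurable_fun_powR; exact: measurable_funB.
apply: measurable_funM; last exact: measurable_bker.
apply: measurable_funM; first by apply: measurable_fun_powR; exact: measurable_funB.
by apply: measurable_fun_powR; do 2 apply: measurableT_comp => //.
Qed.

Let S_ge0 b v x r : b < x -> r < b -> 0 <= S b v x r.
Proof.
by move=> bx rb; rewrite mulr_ge0 ?powR_ge0// mulr_ge0 ?(bker_ge0 _ (ltW rb))// mulr_ge0 ?powR_ge0.
Qed.

Let schur_pointwise a b v x : b < x -> measurable_fun setT v ->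
  ((`|\int[mu]_(r in `]a, b[) (v r * bker b x r)| `^ p)%:E <=
   (2 `^ p * A `^ (p - 1))%:E * \int[mu]_(r in `]a, b[) (S b v x r)%:E)%E.
Proof.
move=> bx mv; apply: (le_trans (bker_integral_le bx (measurable_funTS mv))); rewrite -/A.
rewrite (powRM _ (ltW A_gt0) (powR_ge0 _ _)) -powRrM mulrA [in leLHS]EFinM -muleA.
rewrite lee_wpmul2l ?lee_fin ?mulr_ge0 ?powR_ge0//.
rewrite -ge0_integralZl//; last 3 first.
- apply/measurable_EFinP; apply: measurable_funTS; apply: measurable_funM.
    apply: measurable_funM; first by apply: measurable_fun_powR; exact: measurable_subl.
    by apply: measurable_fun_powR; exact: measurableT_comp.
  exact: (measurableT_comp (measurable_bker al b) (pair1_measurable x)).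
- move=> r /=; rewrite in_itv/= => /andP[_ rb].
  by rewrite lee_fin mulr_ge0 ?(bker_ge0 _ (ltW rb))// mulr_ge0 ?powR_ge0.
- by rewrite lee_fin powR_ge0.
rewrite le_eqVlt; apply/orP; left; apply/eqP; apply: eq_integral => r _.
rewrite -EFinM (_ : - p^-1 * (p - 1) = p^-1 - 1)//.
by rewrite mulrBr mulr1 mulNr mulVf ?gt_eqF// opprK addrC.
Qed.

(** The powers [1 - p^-1] and [p^-1 - 1] of [b - r] cancel, which is the reason for this choice of
    weight. *)
Let schur_inner b v r : r < b ->
  (\int[mu]_(x in `]b, +oo[) (S b v x r)%:E <= (A' * `|v r| `^ p)%:E)%E.
Proof.
move=> rb; have r0 : 0 < b - r by rewrite subr_gt0.
have -> : (\int[mu]_(x in `]b, +oo[) (S b v x r)%:E = ((b - r) `^ (1 - p^-1) * `|v r| `^ p)%:E *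
    \int[mu]_(x in `]b, +oo[) ((x - b) `^ (p^-1 - 1) * bker b x r)%:E)%E.
  rewrite -ge0_integralZl//; last 3 first.
  - apply/measurable_EFinP; apply: measurable_funTS; apply: measurable_funM.
      by apply: measurable_fun_powR; exact: measurable_funB.
    exact: (measurableT_comp (measurable_bker al b) (pair2_measurable r)).
  - move=> x /=; rewrite in_itv/= andbT => bx.
    by rewrite lee_fin mulr_ge0 ?powR_ge0 ?(bker_ge0 _ (ltW rb)).
  - by rewrite lee_fin mulr_ge0 ?powR_ge0.
  by apply: eq_integral => x _; rewrite -EFinM mulrCA.
apply: (@le_trans _ _ (((b - r) `^ (1 - p^-1) * `|v r| `^ p)%:E * (A' * (b - r) `^ (p^-1 - 1))%:E)%E).
  by rewrite lee_wpmul2l ?lee_fin ?mulr_ge0 ?powR_ge0//; exact: integral_bker_right.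
rewrite -!EFinM lee_fin.
have -> : (b - r) `^ (1 - p^-1) * `|v r| `^ p * (A' * (b - r) `^ (p^-1 - 1)) =
  ((b - r) `^ (1 - p^-1) * (b - r) `^ (p^-1 - 1)) * (A' * `|v r| `^ p) by ring.
by rewrite -gt0_powRD// (_ : 1 - p^-1 + (p^-1 - 1) = 0) ?powRr0 ?mul1r//; ring.
Qed.

Let schur_double a b v : measurable_fun setT v ->
  (\int[mu]_(x in `]b, +oo[) \int[mu]_(r in `]a, b[) (S b v x r)%:E <=
   A'%:E * \int[mu]_(r in `]a, b[) (`|v r| `^ p)%:E)%E.
Proof.
move=> mv.
have S0 x r : `]b, +oo[%classic x -> `]a, b[%classic r -> 0 <= S b v x r.
  by rewrite /= !in_itv/= andbT => bx /andP[_ rb]; exact: S_ge0.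
have [_ mG ->] := tonelli_in (measurable_itv _) (measurable_itv _) (measurable_S b mv) S0.
have mvp : measurable_fun `]a, b[ (fun r => (`|v r| `^ p)%:E).
  apply/measurable_EFinP; apply: measurable_funTS.
  by apply: measurable_fun_powR; exact: measurableT_comp.
rewrite -ge0_integralZl//; last by rewrite lee_fin ltW// stieltjes_bound_gt0.
apply: ge0_le_integral => //.
- by move=> r ar; apply: integral_ge0 => x bx; rewrite lee_fin S0.
- exact: measurable_funeM.
move=> r /=; rewrite in_itv/= => /andP[_ rb]; rewrite -EFinM; exact: schur_inner.
Qed.

Lemma right_part_Lp a b v : measurable_fun setT v ->
  (\int[mu]_x (`|right_part al a b v x| `^ p)%:E <=
   schur_const%:E * \int[mu]_(r in `]a, b[) (`|v r| `^ p)%:E)%E.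
Proof.
move=> mv; have mt := mtot_gt0 al01.
pose I x := \int[mu]_(r in `]a, b[) (v r * bker b x r).
have mI : measurable_fun `]b, +oo[ (fun x => `|I x| `^ p).
  apply: measurable_funTS; apply: measurable_fun_powR; apply: measurableT_comp => //.
  by apply: (measurable_kernel_in _ _ (measurable_bker al b)) => //; exact: measurable_funTS.
have -> : (\int[mu]_x (`|right_part al a b v x| `^ p)%:E =
    (mtot^-1 `^ p)%:E * \int[mu]_(x in `]b, +oo[) (`|I x| `^ p)%:E)%E.
  rewrite -ge0_integralZl//; last 2 first.
  - exact/measurable_EFinP.
  - by rewrite lee_fin powR_ge0.
  rewrite [RHS]integral_mkcond; apply: eq_integral => x _; rewrite patchE mem_setE in_itv/= andbT.
  rewrite /right_part -/(I x) -EFinM; case: (ltP b x) => bx.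
    by rewrite mul1r normrM normrN (@ger0_norm _ mtot^-1) ?powRM ?invr_ge0 ?(ltW mt).
  by rewrite mul0r mulr0 normr0 powR0 ?gt_eqF.
rewrite /schur_const EFinM -muleA lee_wpmul2l ?lee_fin ?powR_ge0//.
rewrite EFinM -muleA.
apply: (@le_trans _ _ ((2 `^ p * A `^ (p - 1))%:E *
    \int[mu]_(x in `]b, +oo[) \int[mu]_(r in `]a, b[) (S b v x r)%:E)%E); last first.
  by rewrite lee_wpmul2l ?lee_fin ?mulr_ge0 ?powR_ge0//; exact: schur_double.
have S0 x r : `]b, +oo[%classic x -> `]a, b[%classic r -> 0 <= S b v x r.
  by rewrite /= !in_itv/= andbT => bx /andP[_ rb]; exact: S_ge0.
have [mF _ _] := tonelli_in (measurable_itv _) (measurable_itv _) (measurable_S b mv) S0.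
rewrite -ge0_integralZl//; last 2 first.
- by move=> x bx; apply: integral_ge0 => r ar; rewrite lee_fin S0.
- by rewrite lee_fin mulr_ge0 ?powR_ge0.
apply: ge0_le_integral => //.
- exact/measurable_EFinP.
- exact: measurable_funeM.
by move=> x /=; rewrite in_itv/= andbT => bx; exact: schur_pointwise.
Qed.

End right_part_bound.

(** * Reflection *)

Section reflected.
Context {R : realType}.
Local Notation mu := (@lebesgue_measure R).
Variable al : R.
Hypothesis al01 : 0 < al < 1.
Implicit Types (phi u v : R -> R).

Local Notation abel := (abel al).

Definition mirror (f : R -> R) (x : R) : R := f (- x).

Lemma mirrorK f : mirror (mirror f) = f.
Proof. by apply/funext => x; rewrite /mirror opprK. Qed.

Lemma is_derive_mirror f (x df : R) : is_derive (- x) 1 f df -> is_derive x 1 (mirror f) (- df).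
Proof.
move=> D; have D2 : is_derive x 1 (fun x : R => - x) (-1).
  by have : is_derive x 1 (- (@id R)) (- 1) by exact: is_deriveN.
by have := @is_derive1_comp R f (fun x : R => - x) x _ _ D D2; rewrite mulrN1.
Qed.

Lemma derive1_mirror f (x df : R) : is_derive (- x) 1 f df ->
  (mirror f)^`()%classic x = - f^`()%classic (- x).
Proof. by move=> D; have [_ E] := is_derive_mirror D; have [_ E'] := D; rewrite !derive1E E E'. Qed.

Lemma derive1n_mirror phi (n : nat) : smooth phi ->
  derive1n n (mirror phi) = (fun x => (-1) ^+ n * mirror (derive1n n phi) x).
Proof.
move=> sphi; elim: n => [|n IH]; first by apply/funext => x; rewrite /derive1n/= mul1r.
rewrite derive1nS IH; apply/funext => x; rewrite derive1E.
have D1 : is_derive (- x) 1 (derive1n n phi) ((derive1n n phi)^`()%classic (- x)).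
  rewrite derive1E; exact/derivableP/sphi.
have D2 : is_derive x 1 ((-1) ^+ n *: mirror (derive1n n phi)) ((-1) ^+ n *: - (derive1n n phi)^`()%classic (- x)).
  apply: is_deriveZ; exact: is_derive_mirror.
have [_ E] := D2; rewrite [LHS]E /mirror derive1nS exprS.
by rewrite /GRing.scale/=; ring.
Qed.

Lemma smooth_mirror phi : smooth phi -> smooth (mirror phi).
Proof.
move=> sphi n x; rewrite derive1n_mirror//.
have D1 : is_derive (- x) 1 (derive1n n phi) ((derive1n n phi)^`()%classic (- x)).
  rewrite derive1E; exact/derivableP/sphi.
have D2 : is_derive x 1 ((-1) ^+ n *: mirror (derive1n n phi)) ((-1) ^+ n *: - (derive1n n phi)^`()%classic (- x)).
  apply: is_deriveZ; exact: is_derive_mirror.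
by have [D _] := D2.
Qed.

Lemma test_function_mirror (U : set R) phi :
  test_function U phi -> test_function [set x | U (- x)] (mirror phi).
Proof.
move=> [sphi [cphi sub]]; split; first exact: smooth_mirror.
have E : closure [set x | mirror phi x != 0] `<=` (fun x => - x) @^-1` closure [set x | phi x != 0].
  move=> x cx A /= nA.
  have nA' : nbhs x ((fun x : R => - x) @^-1` A) by have /(_ A nA) := @opp_continuous R x.
  have [y [/= y0 yA]] := cx _ nA'; by exists (- y).
split; last by move=> x /E /sub.
have cE : compact ((fun x => - x) @` closure [set x | phi x != 0]).
  by apply: continuous_compact => //; apply: continuous_subspaceT; exact: opp_continuous.
apply: (subclosed_compact _ cE); first exact: closed_closure.
by move=> x /E /= h; exists (- x); rewrite ?opprK.
Qed.

Lemma Rintegral_mirror (f : R -> R) (a b : R) : measurable_fun `]a, b[ f ->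
  \int[mu]_(x in `]- b, - a[) mirror f x = \int[mu]_(x in `]a, b[) f x.
Proof.
move=> mf; rewrite Rintegral_mkcond [RHS]Rintegral_mkcond.
have mf0 : measurable_fun setT (f \_ `]a, b[) by apply/(measurable_restrictT _ (measurable_itv _)).
rewrite -(Rintegral_subl 0 mf0); apply: eq_Rintegral => x _.
by rewrite sub0r !patchE !mem_setE !in_itv/= ltrNr ltrNl andbC.
Qed.

(** The opposite signs in front of the two derivatives absorb the sign produced by differentiating a
    reflected function. *)
Lemma frac_der_mirror phi (x : R) : test_function setT phi ->
  frac_der minus al phi x = frac_der plus al (mirror phi) (- x).
Proof.
move=> tphi; rewrite /frac_der mulNr -mulrN; congr (_ * _).
have tphi' : test_function setT (mirror phi).
  by have := test_function_mirror tphi; congr (test_function _ _); apply/funext.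
have mphi := measurable_test tphi.
have D := is_derive_abel_tail al01 (- x) tphi'.
have EA : (fun z : R => \int[mu]_(y in `]-oo, z[) (phi y / (z - y) `^ al)) =
    mirror (fun z : R => \int[mu]_(y in `]z, +oo[) (mirror phi y / (y - z) `^ al)).
  apply/funext => z; rewrite {2}/mirror Rintegral_mkcond [RHS]Rintegral_mkcond.
  have mg : measurable_fun setT ((fun y => phi y / (z - y) `^ al) \_ `]-oo, z[).
    apply/(measurable_restrictT _ (measurable_itv _)); apply: measurable_funTS.
    apply: measurable_funM => //; apply: measurable_fun_inv; apply: measurable_fun_powR.
    exact: measurable_funB.
  rewrite -(Rintegral_subl 0 mg); apply: eq_Rintegral => y _.
  by rewrite sub0r !patchE !mem_setE !in_itv/= andbT ltrNl !opprK (addrC z).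
exact: (etrans (congr1 (fun f : R -> R => f^`()%classic x) EA) (derive1_mirror D)).
Qed.

Lemma measurable_frac_der_plus phi : test_function setT phi ->
  measurable_fun setT (frac_der plus al phi).
Proof.
move=> tphi; have -> : frac_der plus al phi =
    fun y => - (Gamma (1 - al))^-1 * \int[mu]_x (phi^`()%classic x * abel (x - y)).
  by apply/funext => y; exact: frac_der_plusE.
apply: measurable_funM => //.
have mdphi := measurable_test_derive1 tphi.
have mk : measurable_fun setT (fun z : R * R => phi^`()%classic z.2 * abel (z.2 - z.1)).
  apply: measurable_funM; first exact: measurableT_comp.
  by apply: measurableT_comp; [exact: measurable_abel|exact: measurable_funB].
exact: (@measurable_Rintegral_kernel _ _ _ _ R mu (fun y x : R => phi^`()%classic x * abel (x - y)) mk).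
Qed.

End reflected.

(** * The weak derivative of the zero extension *)

Section weak_extension.
Context {R : realType}.
Local Notation mu := (@lebesgue_measure R).
Variables (al p q : R).
Hypotheses (al01 : 0 < al < 1) (p1 : 1 <= p) (alp : al * p < 1).
Hypotheses (q1 : 1 < q) (alq : al + q^-1 < 1).
Implicit Types (a b : R) (phi u v : R -> R).

Lemma ge0_integral_mirror (f : R -> \bar R) a b : measurable_fun `]a, b[ f ->
  (forall x, 0 <= f x)%E ->
  (\int[mu]_(x in `](- b)%R, (- a)%R[) f (- x)%R = \int[mu]_(x in `]a, b[) f x)%E.
Proof.
move=> mf f0; rewrite integral_mkcond [RHS]integral_mkcond.
have mf0 : measurable_fun setT (f \_ `]a, b[) by apply/(measurable_restrictT _ (measurable_itv _)).
have f00 x : (0 <= (f \_ `]a, b[) x)%E by rewrite patchE; case: ifPn.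
rewrite -(ge0_integral_subl 0 mf0 f00); apply: eq_integral => x _.
by rewrite sub0r !patchE !mem_setE !in_itv/= ltrNr ltrNl andbC.
Qed.

Lemma integrable_mirror u a b : mu.-integrable `]a, b[ (EFin \o u) ->
  mu.-integrable `]- b, - a[ (EFin \o mirror u).
Proof.
move=> iu; have /integrableP[mu_ iu'] := iu.
have iu0 : mu.-integrable setT (EFin \o (u \_ `]a, b[)) by exact/integrable_patch.
apply/(integrable_patch _ (measurable_itv _)); have := integrable_subl 0 iu0.
apply: eq_integrable => // x _; rewrite /= sub0r /mirror; congr EFin.
by rewrite !patchE !mem_setE !in_itv/= ltrNr ltrNl andbC.
Qed.

Lemma weak_extension_minus a b u v : a < b ->
  mu.-integrable `]a, b[ (EFin \o u) -> mu.-integrable `]a, b[ (EFin \o v) ->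
  (\int[mu]_(x in `]a, b[) (`|u x| `^ q)%:E < +oo)%E ->
  (forall phi, test_function `]a, b[ phi ->
    \int[mu]_(x in `]a, b[) (v x * phi x) =
    \int[mu]_(x in `]a, b[) (u x * frac_der plus al phi x)) ->
  exists V : R -> R, [/\ measurable_fun setT V,
    forall phi, test_function setT phi ->
      \int[mu]_x (V x * phi x) = \int[mu]_(x in `]a, b[) (u x * frac_der plus al phi x) &
    (\int[mu]_x (`|V x| `^ p)%:E <=
      (1 + schur_const al p)%:E * \int[mu]_(x in `]a, b[) (`|v x| `^ p)%:E)%E].
Proof.
move=> ab iu iv uq uv; have p0 : 0 < p by rewrite (lt_le_trans _ p1).
have mv : measurable_fun `]a, b[ v by have /integrableP[/measurable_EFinP] := iv.
(* [v] is known to be measurable only on the interval, whereas the [L^p] bound for [right_part] asks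
   for measurability on the line. *)
pose v0 := v \_ `]a, b[.
have v0E x : `]a, b[%classic x -> v0 x = v x by move=> xab; rewrite /v0 patchE mem_set.
have v0out x : ~ (`]a, b[%classic x) -> v0 x = 0 by move=> xab; rewrite /v0 patchE memNset.
have mv0 : measurable_fun setT v0 by apply/(measurable_restrictT _ (measurable_itv _)).
have iv0 : mu.-integrable setT (EFin \o v0) by exact/integrable_patch.
have iv0' : mu.-integrable `]a, b[ (EFin \o v0) by exact: lebesgue_integrableS iv0.
have Iv0 (f : R -> R) : \int[mu]_(x in `]a, b[) (v0 x * f x) = \int[mu]_(x in `]a, b[) (v x * f x).
  by apply: eq_Rintegral => x /set_mem xab; rewrite v0E.
have Iv0T (f : R -> R) : \int[mu]_x (v0 x * f x) = \int[mu]_(x in `]a, b[) (v0 x * f x).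
  rewrite [RHS]Rintegral_mkcond; apply: eq_Rintegral => x _; rewrite patchE.
  by case: ifPn => // /negP xab; rewrite v0out ?mul0r// => /mem_set.
have uv0 phi : test_function `]a, b[ phi ->
    \int[mu]_(x in `]a, b[) (v0 x * phi x) = \int[mu]_(x in `]a, b[) (u x * frac_der plus al phi x).
  by move=> tphi; rewrite Iv0 uv.
have sol := abel_equation al01 ab iu iv0' q1 alq uq uv0.
exists (fun x => v0 x + right_part al a b v0 x).
have mG : measurable_fun setT (right_part al a b v0).
  apply: measurable_funM => //; apply: measurable_funM; first exact: measurable_fun_ltr_nat.
  by apply: (measurable_kernel_in _ _ (measurable_bker al b)) => //; exact: measurable_funTS.
split; first exact: measurable_funD.
  move=> phi tphi; rewrite (extension_identity al01 ab iu iv0' sol tphi) -Iv0T.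
  have [iG _ _] := right_part_swap al01 iv0' tphi.
  have ivphi : mu.-integrable setT (EFin \o (fun x => v0 x * phi x)).
    have [M [B [_ _ phiB _]]] := test_function_bounded tphi.
    apply: (integrable_boundedM (C := B) _ iv0) => //; last by move=> x _; have [] := phiB x.
    exact: measurable_test tphi.
  transitivity (\int[mu]_x (1 * (v0 x * phi x) + 1 * (phi x * right_part al a b v0 x))).
    by apply: eq_Rintegral => x _; ring.
  by rewrite Rintegral_lin2// !mul1r.
move=> {uv uv0 sol Iv0 Iv0T}; have mvp (f : R -> R) : measurable_fun setT f -> measurable_fun setT (fun x => (`|f x| `^ p)%:E).
  by move=> mf; apply/measurable_EFinP; apply: measurable_fun_powR; exact: measurableT_comp.
(* [v0] lives before [b] and [right_part] after it, so the [p]-th powers add exactly; hence the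
   constant [1 + schur_const]. *)
have -> : (\int[mu]_x (`|(v0 x + right_part al a b v0 x)%R| `^ p)%:E =
    \int[mu]_x ((`|v0 x| `^ p)%:E + (`|right_part al a b v0 x| `^ p)%:E))%E.
  apply: eq_integral => x _; rewrite -EFinD; congr EFin; case: (ltP b x) => bx.
    rewrite v0out ?add0r ?normr0 ?powR0 ?gt_eqF ?add0r//.
    by rewrite /= in_itv/= (ltNge x) (ltW bx) andbF.
  by rewrite /right_part (ltNge b) bx mul0r mulr0 normr0 powR0 ?gt_eqF// !addr0.
rewrite ge0_integralD//; [|exact: mvp|exact: mvp].
have N0 : (0 <= \int[mu]_(x in `]a, b[) (`|v x| `^ p)%:E)%E.
  by apply: integral_ge0 => x _; rewrite lee_fin powR_ge0.
have E1 : (\int[mu]_(x in `]a, b[) (`|v0 x| `^ p)%:E = \int[mu]_(x in `]a, b[) (`|v x| `^ p)%:E)%E.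
  by apply: eq_integral => x /set_mem xab; rewrite v0E.
have E2 : (\int[mu]_x (`|v0 x| `^ p)%:E = \int[mu]_(x in `]a, b[) (`|v x| `^ p)%:E)%E.
  rewrite -E1 [RHS]integral_mkcond; apply: eq_integral => {E1} x _; rewrite patchE.
  by case: ifPn => // /negP xab; rewrite v0out ?normr0 ?powR0 ?gt_eqF// => /mem_set.
have := right_part_Lp al01 p1 alp a b mv0; rewrite E1 E2 => {E1 E2} le1.
by rewrite EFinD ge0_muleDl ?lee_fin ?schur_const_ge0// mul1e leeD2l.
Qed.

Lemma weak_extension_plus a b u v : a < b ->
  mu.-integrable `]a, b[ (EFin \o u) -> mu.-integrable `]a, b[ (EFin \o v) ->
  (\int[mu]_(x in `]a, b[) (`|u x| `^ q)%:E < +oo)%E ->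
  (forall phi, test_function `]a, b[ phi ->
    \int[mu]_(x in `]a, b[) (v x * phi x) =
    \int[mu]_(x in `]a, b[) (u x * frac_der minus al phi x)) ->
  exists V : R -> R, [/\ measurable_fun setT V,
    forall phi, test_function setT phi ->
      \int[mu]_x (V x * phi x) = \int[mu]_(x in `]a, b[) (u x * frac_der minus al phi x) &
    (\int[mu]_x (`|V x| `^ p)%:E <=
      (1 + schur_const al p)%:E * \int[mu]_(x in `]a, b[) (`|v x| `^ p)%:E)%E].
Proof.
move=> ab iu iv uq.
have mu_ : measurable_fun `]a, b[ u by have /integrableP[/measurable_EFinP] := iu.
have mv : measurable_fun `]a, b[ v by have /integrableP[/measurable_EFinP] := iv.
have mpow (f : R -> R) e : measurable_fun `]a, b[ f -> measurable_fun `]a, b[ (fun x => (`|f x| `^ e)%:E).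
  by move=> mf; apply/measurable_EFinP; apply: (measurableT_comp (measurable_powR e)); exact: measurableT_comp.
have setTN : [set x : R | [set: R] (- x)] = setT by apply/funext.
have fd phi x : test_function setT phi ->
    frac_der plus al (mirror phi) (- x) = frac_der minus al phi x.
  by move=> tphi; rewrite frac_der_mirror.
have ab' : - b < - a by rewrite ltrN2.
have uq' : (\int[mu]_(x in `](- b)%R, (- a)%R[) (`|mirror u x| `^ q)%:E < +oo)%E.
  by rewrite (ge0_integral_mirror (mpow _ q mu_))// => x; rewrite lee_fin powR_ge0.
(* Used in both directions: to carry the weak equation to []- b, - a[], and to bring its extension
   back. *)
have mirror_int phi : test_function setT phi ->
    \int[mu]_(x in `]- b, - a[) (mirror u x * frac_der plus al (mirror phi) x) =
    \int[mu]_(x in `]a, b[) (u x * frac_der minus al phi x).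
  move=> tphi; have tphi' : test_function setT (mirror phi).
    by rewrite -setTN; exact: test_function_mirror.
  have mfd := measurable_frac_der_plus al01 tphi'.
  rewrite -(Rintegral_mirror (f := fun x => u x * frac_der minus al phi x)).
    apply: eq_Rintegral => x _.
    by rewrite -[RHS]/(u (- x) * frac_der minus al phi (- x)) -(fd _ _ tphi) opprK.
  apply: measurable_funM; [exact: mu_|apply: measurable_funTS].
  have -> : frac_der minus al phi = fun x => frac_der plus al (mirror phi) (- x).
    by apply/funext => x; rewrite fd.
  by apply: (measurableT_comp mfd); exact: oppr_measurable.
move=> uv.
have uv' phi : test_function `]- b, - a[ phi ->
    \int[mu]_(x in `]- b, - a[) (mirror v x * phi x) =
    \int[mu]_(x in `]- b, - a[) (mirror u x * frac_der plus al phi x).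
  move=> tphi; have tphi' : test_function `]a, b[ (mirror phi).
    rewrite (_ : `]a, b[%classic = [set x | `]- b, - a[%classic (- x)]); first exact: test_function_mirror.
    by apply/seteqP; split => x /=; rewrite !in_itv/= !ltrN2 => /andP[-> ->].
  have tphiT : test_function setT (mirror phi) by exact: test_function_sub tphi'.
  rewrite -{2}(mirrorK phi) mirror_int// -uv//.
  rewrite -(Rintegral_mirror (f := fun x => v x * mirror phi x)).
    by apply: eq_Rintegral => x _; rewrite /mirror opprK.
  by apply: measurable_funM => //; apply: measurable_funTS; exact: measurable_test tphi'.
have [V [mV VE Vle]] := weak_extension_minus ab' (integrable_mirror iu) (integrable_mirror iv) uq' uv'.
move=> {uv uv'}; exists (mirror V); have mVr : measurable_fun setT (mirror V).
  by apply: (measurableT_comp mV); exact: oppr_measurable.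
split; first exact: mVr.
  move=> phi tphi; rewrite -(mirror_int _ tphi) -VE; last by rewrite -setTN; exact: test_function_mirror.
  have mVphi : measurable_fun setT (fun x => mirror V x * phi x).
    by apply: measurable_funM; [exact: mVr|exact: measurable_test tphi].
  rewrite -(Rintegral_subl 0 mVphi); apply: eq_Rintegral => x _.
  by rewrite sub0r /mirror opprK.
move=> {VE mirror_int fd}; have mVp : measurable_fun setT (fun x => (`|V x| `^ p)%:E).
  by apply/measurable_EFinP; apply: measurable_fun_powR; exact: measurableT_comp.
have Vp0 x : (0 <= (`|V x| `^ p)%:E)%E by rewrite lee_fin powR_ge0.
rewrite -(ge0_integral_mirror (mpow _ p mv)); last by move=> x; rewrite lee_fin powR_ge0.
apply: le_trans Vle; rewrite -(ge0_integral_subl 0 mVp Vp0).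
by rewrite le_eqVlt; apply/orP; left; apply/eqP; apply: eq_integral => x _; rewrite sub0r.
Qed.

Lemma weak_extension (s : side) a b u v : a < b ->
  mu.-integrable `]a, b[ (EFin \o u) -> mu.-integrable `]a, b[ (EFin \o v) ->
  (\int[mu]_(x in `]a, b[) (`|u x| `^ q)%:E < +oo)%E ->
  (forall phi, test_function `]a, b[ phi ->
    \int[mu]_(x in `]a, b[) (v x * phi x) =
    \int[mu]_(x in `]a, b[) (u x * frac_der (opposite s) al phi x)) ->
  exists V : R -> R, [/\ measurable_fun setT V,
    forall phi, test_function setT phi ->
      \int[mu]_x (V x * phi x) = \int[mu]_(x in `]a, b[) (u x * frac_der (opposite s) al phi x) &
    (\int[mu]_x (`|V x| `^ p)%:E <=
      (1 + schur_const al p)%:E * \int[mu]_(x in `]a, b[) (`|v x| `^ p)%:E)%E].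
Proof.
case: s => ab iu iv uq; first exact: weak_extension_minus.
exact: weak_extension_plus.
Qed.

End weak_extension.

(** * Sobolev norms *)

Section Lp_facts.
Context {R : realType}.
Local Notation mu := (@lebesgue_measure R).
Implicit Types (p : R) (U D : set R) (f g u v phi : R -> R).

Lemma Lp_normE p U u : 0 < p -> measurable U ->
  (Lp_norm p U u `^ p)%E = (\int[mu]_(x in U) (`|u x| `^ p)%:E)%E.
Proof.
move=> p0 mU; apply: (etrans (powR_Lnorm _ _ (lt0r_neq0 p0))); rewrite [RHS]integral_mkcond.
apply: eq_integral => x _; rewrite /= !patchE; case: ifPn => // _.
by rewrite normr0 powR0// gt_eqF.
Qed.

Lemma in_LpP p U u : 0 < p -> measurable U ->
  in_Lp p U u <-> measurable_fun U u /\ (\int[mu]_(x in U) (`|u x| `^ p)%:E < +oo)%E.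
Proof.
move=> p0 mU; rewrite /in_Lp -Lp_normE//.
have finE : (Lp_norm p U u < +oo)%E <-> (Lp_norm p U u `^ p < +oo)%E.
  split; first by move=> h; rewrite poweR_lty.
  by case: (Lp_norm p U u) => [r _| |_]; rewrite ?ltry ?ltNyy// poweRyr// gt_eqF.
split.
  move=> /andP[/[!inE] /= mf ff]; split; first by apply/(measurable_restrictT _ mU).
  by apply/finE.
move=> [mf /finE ff]; apply/andP; split; rewrite inE//=.
exact/(measurable_restrictT _ mU).
Qed.

Lemma Lp_integrable p D f : 1 <= p -> measurable D -> (mu D < +oo)%E ->
  measurable_fun D f -> (\int[mu]_(x in D) (`|f x| `^ p)%:E < +oo)%E ->
  mu.-integrable D (EFin \o f).
Proof.
move=> p1 mD Dfin mf ffin; apply/integrableP; split; first exact/measurable_EFinP.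
have mp : measurable_fun D (fun x => (`|f x| `^ p)%:E).
  by apply/measurable_EFinP; apply: (measurableT_comp (measurable_powR p)); exact: measurableT_comp.
apply: (@le_lt_trans _ _ (\int[mu]_(x in D) (cst 1%:E x + (`|f x| `^ p)%:E))%E).
  apply: ge0_le_integral => //.
  - by apply/measurable_EFinP; exact: measurableT_comp.
  - exact: emeasurable_funD.
  - move=> x _; rewrite /= -EFinD lee_fin.
    (* At the level [1] the inequality reads [t <= 1 + t ^ p], integrable on a set of finite
       measure. *)
    by have := normr_le_level p1 ltr01 (normr_ge0 (f x)); rewrite powR1 mul1r.
by rewrite ge0_integralD// integral_cst// mul1e lte_add_pinfty.
Qed.

Lemma Lp_locally_integrable p U f : 1 <= p -> open U -> measurable_fun U f ->
  (\int[mu]_(x in U) (`|f x| `^ p)%:E < +oo)%E -> locally_integrable U f.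
Proof.
move=> p1 oU mf ffin; split => // K KU cK.
have mK := compact_measurable cK; have mU := open_measurable oU.
have mfK : measurable_fun K f by exact: measurable_funS mf.
suff /integrableP[] : mu.-integrable K (EFin \o f) by [].
apply: (Lp_integrable p1) => //; first exact: compact_finite_measure.
apply: le_lt_trans ffin; apply: ge0_subset_integral => //.
by apply/measurable_EFinP; apply: (measurableT_comp (measurable_powR p)); exact: measurableT_comp.
Qed.

Lemma integrable_test_mul U v phi : locally_integrable U v -> test_function U phi ->
  mu.-integrable U (EFin \o (fun x => v x * phi x)).
Proof.
move=> [mv oU vK] tphi; have mU := open_measurable oU.
have [_ [cphi phiU]] := tphi.
pose K := closure [set x | phi x != 0]; have mK := compact_measurable cphi.
have iK : mu.-integrable K (EFin \o v).
  by apply/integrableP; split; [apply/measurable_EFinP; exact: measurable_funS mv|exact: vK].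
have [M [B [_ _ phiB _]]] := test_function_bounded tphi.
have ivK : mu.-integrable K (EFin \o (fun x => v x * phi x)).
  apply: (integrable_boundedM (C := B) mK iK); last by move=> x _; have [] := phiB x.
  by exact: measurable_funTS (measurable_test tphi).
apply/(integrable_patch _ mU); move/(integrable_patch _ mK) : ivK.
apply: eq_integrable => // x _; congr EFin; rewrite !patchE.
have [Kx|Kx] := pselect (K x); first by rewrite !mem_set//; exact: phiU.
rewrite memNset//; case: ifPn => // _.
by have [-> _] := test_function_eq0 tphi Kx; rewrite mulr0.
Qed.

Lemma weak_frac_der_unique (s : side) (al : R) U u v w :
  is_weak_frac_der s al U u v -> is_weak_frac_der s al U u w ->
  {ae mu, forall x, U x -> v x = w x}.
Proof.
move=> [lv vE] [lw wE]; have := locally_integrableB lv lw.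
move=> /fundamental_lemma H; apply: ae_lebesgueS (H _) => [x h /h/eqP|phi tphi].
  by rewrite subr_eq0 => /eqP.
have [_ oU _] := lv; have mU := open_measurable oU.
transitivity (\int[mu]_(x in U) (1 * (v x * phi x) + -1 * (w x * phi x))).
  by apply: eq_Rintegral => x _; rewrite /=; ring.
rewrite Rintegral_lin2//; [|exact: integrable_test_mul|exact: integrable_test_mul].
by rewrite vE// wE//; ring.
Qed.

Lemma ae_eq_Lp_integral p U f g : measurable U -> measurable_fun U f -> measurable_fun U g ->
  {ae mu, forall x, U x -> f x = g x} ->
  (\int[mu]_(x in U) (`|f x| `^ p)%:E = \int[mu]_(x in U) (`|g x| `^ p)%:E)%E.
Proof.
move=> mU mf mg fg.
have mp (h : R -> R) : measurable_fun U h -> measurable_fun U (fun x => (`|h x| `^ p)%:E).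
  by move=> mh; apply/measurable_EFinP; apply: (measurableT_comp (measurable_powR p)); exact: measurableT_comp.
apply: ge0_ae_eq_integral => //.
- exact: mp.
- exact: mp.
- by apply: ae_lebesgueS fg => x h /h ->.
Qed.

Lemma weak_frac_derP (s : side) (al : R) U u v : is_weak_frac_der s al U u v ->
  is_weak_frac_der s al U u (weak_frac_der s al U u).
Proof. by move=> h; apply: (@xgetI _ _ [set v | is_weak_frac_der s al U u v]); exact: h. Qed.

(** [weak_frac_der] is an arbitrary choice; as weak derivatives agree almost everywhere, any
    explicit one computes the norm. *)
Lemma W_normE (s : side) (al p : R) U u v : 0 < p -> measurable U ->
  is_weak_frac_der s al U u v ->
  W_norm s al p U u = ((\int[mu]_(x in U) (`|u x| `^ p)%:E +
    \int[mu]_(x in U) (`|v x| `^ p)%:E) `^ p^-1)%E.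
Proof.
move=> p0 mU uv; rewrite /W_norm (Lp_normE u p0 mU) (Lp_normE _ p0 mU).
have uw := weak_frac_derP uv; have [[mv _ _] _] := uv; have [[mw _ _] _] := uw.
by rewrite (ae_eq_Lp_integral p mU mw mv (weak_frac_der_unique uw uv)).
Qed.

Lemma ess_support_sub f (K : set R) : closed K -> (forall x, ~ K x -> f x = 0) ->
  ess_support f `<=` K.
Proof.
move=> cK f0 x; rewrite /ess_support => H; apply: contrapT => nKx; apply: H.
exists (~` K) => //; split; first exact: closed_openC.
by apply: aeW => y; exact: f0.
Qed.

End Lp_facts.

(** * The zero extension in Sobolev norms *)

Section extension.
Context {R : realType}.
Local Notation mu := (@lebesgue_measure R).
Implicit Types (a b : R) (u v : R -> R).

(** The chain [1 <= p < q (1 - al p) <= q (1 - al)] gives the second bound; its middle inequality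
    also gives [p < q], hence the first. *)
Lemma exponent_bounds (al p q : R) : 0 < al < 1 -> 1 <= p -> al * p < 1 ->
  p * (1 - al * p)^-1 < q -> 1 < q /\ al + q^-1 < 1.
Proof.
move=> /andP[al0 al1] p1 alp pq; have p0 : 0 < p by rewrite (lt_le_trans _ p1).
have c0 : 0 < 1 - al * p by rewrite subr_gt0.
have pq' : p < q * (1 - al * p) by rewrite -ltr_pdivrMr.
have q0 : 0 < q by rewrite -(pmulr_lgt0 _ c0) (lt_trans p0).
have alp0 : 0 < al * p by rewrite mulr_gt0.
have pltq : p < q by apply: (lt_le_trans pq'); rewrite ger_pMr// gerBl ltW.
split; first exact: le_lt_trans p1 pltq.
rewrite -ltrBrDl invf_plt ?posrE ?subr_gt0//.
rewrite -[ltLHS]mul1r ltr_pdivrMr ?subr_gt0//.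
apply: (le_lt_trans p1); apply: (lt_le_trans pq').
by rewrite ler_pM2l// lerD2l lerN2 ler_peMr// ltW.
Qed.

(** As [1 <= c], the untouched summand [x] is also at most [c x], so the constant factors out of the
    sum. *)
Lemma poweR_add_le (x y z : \bar R) (c e : R) : (0 <= x)%E -> (0 <= y)%E -> (0 <= z)%E ->
  1 <= c -> 0 <= e -> (y <= c%:E * z)%E ->
  ((x + y) `^ e <= (c `^ e)%:E * (x + z) `^ e)%E.
Proof.
move=> x0 y0 z0 c1 e0 yz; have c0 : 0 <= c by rewrite (le_trans _ c1).
rewrite -poweR_EFin -poweRM ?lee_fin ?adde_ge0//.
apply: gt0_ler_poweR => //; rewrite ?in_itv/= ?leey ?andbT ?adde_ge0 ?mule_ge0 ?adde_ge0//.
rewrite ge0_muleDr// leeD//.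
by rewrite -[leLHS]mul1e lee_wpmul2r// lee_fin.
Qed.

Lemma W_extension (s : side) (al p q a b : R) u : 0 < al < 1 -> 1 <= p -> al * p < 1 ->
  a < b -> p * (1 - al * p)^-1 < q ->
  in_W s al p `]a, b[ u -> in_Lp q `]a, b[ u ->
  in_W s al p setT (u \_ `]a, b[) /\
  (W_norm s al p setT (u \_ `]a, b[) <=
   ((1 + schur_const al p) `^ p^-1)%:E * W_norm s al p `]a, b[ u)%E.
Proof.
move=> al01 p1 alp ab pq [uLp [v uv vLp]] uLq.
have [q1 alq] := exponent_bounds al01 p1 alp pq.
have p0 : 0 < p by rewrite (lt_le_trans _ p1).
have q0 : 0 < q by rewrite (lt_trans _ q1).
have mI : measurable (`]a, b[%classic : set R) by exact: measurable_itv.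
have [mu_ up] := (in_LpP _ p0 mI).1 uLp; have [_ uq] := (in_LpP _ q0 mI).1 uLq.
have [mv vp] := (in_LpP _ p0 mI).1 vLp.
have fin : (mu `]a, b[ < +oo)%E by rewrite lebesgue_measure_itv/= lte_fin ab -EFinB ltry.
have iu := Lp_integrable p1 mI fin mu_ up; have iv := Lp_integrable p1 mI fin mv vp.
have [V [mV VE Vle]] := weak_extension al01 p1 alp q1 alq ab iu iv uq (proj2 uv).
have S0 := schur_const_ge0 al01 p1 alp.
have Vp : (\int[mu]_x (`|V x| `^ p)%:E < +oo)%E.
  by apply: (le_lt_trans Vle); apply: lte_mul_pinfty; rewrite ?lee_fin ?addr_ge0.
have mu0 : measurable_fun setT (u \_ `]a, b[) by exact/(measurable_restrictT _ mI).
have VLp : in_Lp p setT V by apply/(in_LpP _ p0 measurableT).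
have lV : locally_integrable setT V by exact: Lp_locally_integrable p1 openT mV Vp.
have weakV : is_weak_frac_der s al setT (u \_ `]a, b[) V.
  split=> [|phi tphi]; first exact: lV.
  rewrite (VE _ tphi) Rintegral_mkcond; apply: eq_Rintegral => {VE} x _.
  by rewrite (patchMl _ u (frac_der (opposite s) al phi)).
have u0E : (\int[mu]_x (`|(u \_ `]a, b[) x| `^ p)%:E = \int[mu]_(x in `]a, b[) (`|u x| `^ p)%:E)%E.
  rewrite [RHS]integral_mkcond; apply: eq_integral => {VE} x _; rewrite !patchE.
  by case: ifPn => // _; rewrite normr0 powR0// gt_eqF.
split.
  split; last by exists V; [exact: weakV|exact: VLp].
  by apply/(in_LpP _ p0 measurableT); rewrite u0E; split; [exact: mu0|exact: up].
rewrite (W_normE p0 measurableT weakV) (W_normE p0 mI uv) u0E.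
apply: poweR_add_le; last exact: Vle.
- by apply: integral_ge0 => x _; rewrite lee_fin powR_ge0.
- by apply: integral_ge0 => x _; rewrite lee_fin powR_ge0.
- by apply: integral_ge0 => x _; rewrite lee_fin powR_ge0.
- by rewrite lerDl.
- by rewrite invr_ge0 ltW.
Qed.

End extension.

Theorem theorem4p11 (R : realType) (s : side) (alpha p : R) (Omega' : set R)
    (halpha : 0 < alpha < 1) (hp : 1 <= p) (halphap : alpha * p < 1)
    (hOmega' : bounded_domain Omega') :
  exists2 C : R, 0 < C &
    forall (a b mu : R), a < b -> p * (1 - alpha * p)^-1 < mu ->
    compactly_contained `]a, b[ Omega' ->
    exists E : (R -> R) -> (R -> R),
      (* E is well defined on almost-everywhere classes *)
      (forall u v : R -> R,
         in_W s alpha p `]a, b[ u -> in_Lp mu `]a, b[ u ->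
         in_W s alpha p `]a, b[ v -> in_Lp mu `]a, b[ v ->
         eq_ae_on `]a, b[ u v -> eq_ae_on setT (E u) (E v)) /\
      (forall u : R -> R,
         in_W s alpha p `]a, b[ u -> in_Lp mu `]a, b[ u ->
         [/\ in_W s alpha p setT (E u),
             eq_ae_on `]a, b[ (E u) u,
             compactly_contained (ess_support (E u)) Omega' &
             (W_norm s alpha p setT (E u) <=
              C%:E * (W_norm s alpha p `]a, b[ u + Lp_norm mu `]a, b[ u))%E]).
Proof.
have S0 := schur_const_ge0 halpha hp halphap.
(* Only [alpha] and [p] occur, so the constant can be fixed before the interval and [mu] are
   chosen. *)
pose C := (1 + schur_const alpha p) `^ p^-1.
have C0 : 0 < C by rewrite powR_gt0// ltr_pwDl.
exists C => // a b mu ab pmu [cK KO]; exists (fun u => u \_ `]a, b[); split.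
  move=> u v _ _ _ _ uv; apply: ae_lebesgueS uv => x uv _; rewrite !patchE.
  by case: ifPn => // /set_mem/uv.
move=> u uW uL; have [EW Ele] := W_extension halpha hp halphap ab pmu uW uL.
(* The extension vanishes at every point off the closed interval, and that closure is the compact
   subset of [Omega'] given by the hypothesis. *)
have sub : ess_support (u \_ `]a, b[) `<=` closure `]a, b[.
  apply: ess_support_sub => [|x nx]; first exact: closed_closure.
  by rewrite patchE memNset// => xab; apply: nx; exact: subset_closure.
have sub2 : closure (ess_support (u \_ `]a, b[)) `<=` closure `]a, b[.
  by rewrite [X in _ `<=` X](_ : _ = closure (closure `]a, b[)); [exact: closureS|exact/closure_id/closed_closure].
split => //.
- by apply: aeW => x xab; rewrite patchE mem_set.
- split; last exact: subset_trans sub2 KO.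
  by apply: (subclosed_compact _ cK sub2); exact: closed_closure.
- apply: (le_trans Ele); rewrite lee_wpmul2l ?lee_fin ?(ltW C0)//.
  by rewrite leeDl// Lnorm_ge0.
Qed.
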